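(* Let $k$ be a field and let $F \to X \to Y$ be a fibration of topological spaces where $\dim_k \mathrm{H}^j(X;k) < \infty$ and $\dim_k \mathrm{H}^j(Y;k) < \infty$ for each $j$ and where $Y$ is simply connected. (i) If $\operatorname{hd} F < \infty$ and $\operatorname{hd} Y < \infty$, then $$\operatorname{hd} X = \operatorname{hd} F + \operatorname{hd} Y.$$ (ii) If $\operatorname{hd} X < \infty$ and $\operatorname{hd} \Omega Y < \infty$, then $$\operatorname{hd} X = \operatorname{hd} F - \operatorname{hd} \Omega Y.$$
   Context: $\mathrm{H}^j(Z;k)$ denotes the singular cohomology of a topological space $Z$ with coefficients in $k$. The homological dimension of $Z$ is $\operatorname{hd} Z = \sup\{ j \mid \mathrm{H}^j(Z;k) \neq 0\}$; it is a non-negative integer or $\infty$. $\Omega Y$ denotes the Moore loop space of $Y$. In the fibration $F \to X \to Y$, $F$ is the fibre, $X$ the total space and $Y$ the base. *)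

(* Defs.v *)
From HB Require Import structures.
From mathcomp Require Import all_boot all_order all_algebra.
From mathcomp Require Import generic_quotient ring_quotient.
From mathcomp Require Import all_classical reals ereal topology.
From mathcomp Require Import normedtype homotopy.
From mathcomp Require Import zify.

Set Implicit Arguments.
Unset Strict Implicit.
Unset Printing Implicit Defensive.

Import Order.TTheory GRing.Theory Num.Theory.
Import numFieldNormedType.Exports.

Local Open Scope classical_set_scope.
Local Open Scope ring_scope.
Local Open Scope quotient_scope.

(** * Linear algebra *)

(* [ring_quotient] makes the quotient of an additive group by a subgroup a
   [zmodType]; [lquot] adds the scalar multiplication induced on the quotient
   by a submodule. *)
Section LmodQuotient.
Variables (K : pzRingType) (V : lmodType K) (S : {pred V}).
Hypothesis S_submod : submod_closed S.

Definition lquot_pred : {pred V} := let _ := S_submod in S.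

HB.instance Definition _ :=
  GRing.isSubmodClosed.Build K V lquot_pred S_submod.

Definition lquot : Type := Quotient.quot lquot_pred.

HB.instance Definition _ := GRing.Zmodule.on lquot.
HB.instance Definition _ := EqQuotient.on lquot.

Definition lquot_scale (a : K) (x : lquot) : lquot :=
  \pi_lquot (a *: repr x).

Lemma pi_lquotE (x y : V) :
  (\pi_lquot x = \pi_lquot y) <-> (x - y \in S).
Proof.
rewrite -[x - y \in S]/(x - y \in lquot_pred) Quotient.idealrBE.
by split => [->|/eqP].
Qed.

Lemma pi_lquotD (x y : V) : \pi_lquot (x + y) = \pi_lquot x + \pi_lquot y.
Proof. exact: (@pi_addr _ _ _ _ _ (Quotient.quot lquot_pred)). Qed.

Lemma lquot_scaleE a (x : V) :
  lquot_scale a (\pi_lquot x) = \pi_lquot (a *: x).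
Proof.
apply/pi_lquotE; rewrite -scalerBr (@rpredZ _ _ lquot_pred)//.
by apply/pi_lquotE; rewrite reprK.
Qed.

Lemma lquot_scalerA a b x :
  lquot_scale a (lquot_scale b x) = lquot_scale (a * b) x.
Proof.
rewrite -[x]reprK (lquot_scaleE b) (lquot_scaleE a) (lquot_scaleE (a * b)).
by rewrite scalerA.
Qed.

Lemma lquot_scale1r : left_id 1 lquot_scale.
Proof. by move=> x; rewrite -[x]reprK lquot_scaleE scale1r. Qed.

Lemma lquot_scalerDr : right_distributive lquot_scale +%R.
Proof.
move=> a x y; rewrite -[x]reprK -[y]reprK.
rewrite -pi_lquotD (lquot_scaleE a (_ + _)) scalerDr pi_lquotD.
by rewrite 2!lquot_scaleE.
Qed.

Lemma lquot_scalerDl x : {morph lquot_scale^~ x : a b / a + b}.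
Proof.
move=> a b; rewrite -[x]reprK (lquot_scaleE (a + b)) scalerDl pi_lquotD.
by rewrite (lquot_scaleE a) (lquot_scaleE b).
Qed.

HB.instance Definition _ := GRing.Zmodule_isLmodule.Build K lquot
  lquot_scalerA lquot_scale1r lquot_scalerDr lquot_scalerDl.

End LmodQuotient.

Definition finite_dimensional (k : fieldType) (V : lmodType k) : Prop :=
  exists (m : nat) (e : 'I_m -> V),
    forall v : V, exists c : 'I_m -> k, v = \sum_(i < m) c i *: e i.

(** * Cohomology of a cochain complex *)

Section CochainCohomology.
Variables (k : fieldType) (C : nat -> lmodType k).
Variables (d : forall n, {linear C n -> C n.+1}).

Section Cocycles.
Variable n : nat.

Definition cocycle : {pred C n} := fun x => d n x == 0.

Lemma cocycle_submod_closed : submod_closed cocycle.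
Proof.
split=> [|a x y]; rewrite !unfold_in ?linear0// => /eqP dx /eqP dy.
by rewrite linearP dx dy scaler0 addr0.
Qed.
HB.instance Definition _ :=
  GRing.isSubmodClosed.Build k (C n) cocycle cocycle_submod_closed.

Record cocycles := Cocycle { cochain_of :> C n; _ : cochain_of \in cocycle }.

HB.instance Definition _ := [isSub for cochain_of].
HB.instance Definition _ := [Choice of cocycles by <:].
HB.instance Definition _ := [SubChoice_isSubLmodule of cocycles by <:].

End Cocycles.

(* The complex is zero in negative degrees, whence the case n = 0. *)
Definition is_coboundary n : C n -> Prop :=
  match n with
  | 0 => fun x => x = 0
  | m.+1 => fun x => exists y : C m, d m y = x
  end.

Definition coboundary n : {pred cocycles n} :=
  fun z => `[< is_coboundary (val z) >].

Lemma coboundary_submod_closed n : submod_closed (@coboundary n).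
Proof.
split=> [|a x y]; rewrite !unfold_in.
  by apply/asboolP; case: n => [|n] //=; exists 0; rewrite linear0.
move=> /asboolP hx /asboolP hy; apply/asboolP; case: n x y hx hy => [|n] x y /=.
  by move=> -> ->; rewrite scaler0 addr0.
by move=> [u ux] [v vy]; exists (a *: u + v); rewrite linearP ux vy.
Qed.

Definition cohomology n : lmodType k := lquot (@coboundary_submod_closed n).

End CochainCohomology.

(** * Singular cohomology *)

Section StandardSimplex.
Variable R : realType.

Definition simplex (n : nat) : set 'rV[R]_n.+1 :=
  [set t | (forall i, 0 <= t ord0 i) /\ \sum_i t ord0 i = 1].
Arguments simplex n : clear implicits.

(* [lift i] is the increasing injection whose image misses [i]. *)
Definition face_vec n (i : 'I_n.+2) (t : 'rV[R]_n.+1) : 'rV[R]_n.+2 :=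
  \row_j (if unlift i j is Some j' then t ord0 j' else 0).

Lemma face_vec_simplex n (i : 'I_n.+2) t :
  simplex n t -> simplex n.+1 (face_vec i t).
Proof.
move=> [t0 t1]; split=> [j|]; first by rewrite mxE; case: unliftP.
rewrite (bigD1_ord i)//= mxE unlift_none add0r -t1.
by apply: eq_bigr => j _; rewrite mxE liftK.
Qed.

Definition face n (i : 'I_n.+2) (t : simplex n) : simplex n.+1 :=
  exist _ (face_vec i (val t)) (mem_set (face_vec_simplex i (set_mem (valP t)))).

Lemma face_vec_continuous n (i : 'I_n.+2) : continuous (@face_vec n i).
Proof.
move=> t A [/= P tP PA]; exists (fun i0 j => P i0 (lift i j)).
  by move=> i0 j; have := tP i0 (lift i j); rewrite mxE liftK [i0]ord1.
move=> x Px; apply: PA => i0 j; case: (unliftP i j) => [l ->|->].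
  by have := Px i0 l; rewrite mxE liftK [i0]ord1.
by have := nbhs_singleton (tP i0 i); rewrite !mxE unlift_none.
Qed.

Lemma face_continuous n (i : 'I_n.+2) : continuous (@face n i).
Proof.
apply: continuous_comp_initial => t.
apply: (@continuous_comp _ _ _ (set_val : simplex n -> _) (face_vec i)).
  exact: initial_continuous.
exact: face_vec_continuous.
Qed.

HB.instance Definition _ n (i : 'I_n.+2) :=
  isContinuous.Build (simplex n) (simplex n.+1) (face i)
    (@face_continuous n i).

End StandardSimplex.

Arguments simplex R n : clear implicits.

Section SingularCohomology.
Variables (R : realType) (k : fieldType) (Z : topologicalType).

Definition singular_simplex (n : nat) : Type :=
  continuousType (simplex R n) Z.

Definition simplex_face n (s : singular_simplex n.+1) (i : 'I_n.+2) :
  singular_simplex n := s \o face i.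

Definition singular_cochain (n : nat) : lmodType k := singular_simplex n -> k^o.

Definition singular_diff n (f : singular_cochain n) : singular_cochain n.+1 :=
  fun s => \sum_(i < n.+2) (-1) ^+ i * f (simplex_face s i).

Lemma singular_diff_linear n : linear (@singular_diff n).
Proof.
move=> a f g; apply/funext => s.
pose D (h : singular_cochain n) : k :=
  \sum_(i < n.+2) (-1) ^+ i * (h (simplex_face s i) : k).
suff : D (a *: f + g) = a * D f + D g by [].
rewrite /D mulr_sumr -big_split/=; apply: eq_bigr => i _.
have -> : (a *: f + g) (simplex_face s i) =
  a * f (simplex_face s i) + g (simplex_face s i) :> k by [].
by rewrite mulrDr mulrCA.
Qed.

HB.instance Definition _ n :=
  GRing.isLinear.Build k _ _ _ _ (@singular_diff_linear n).

Definition singular_cohomology (j : nat) : lmodType k :=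
  @cohomology k singular_cochain (fun n => @singular_diff n) j.

End SingularCohomology.

Section DiffSquare.

Definition ord_swap n (x : 'I_n.+2 * 'I_n.+1) : 'I_n.+2 * 'I_n.+1 :=
  (lift x.1 x.2, odflt ord0 (unlift (lift x.1 x.2) x.1)).

Lemma ord_swapE n (x : 'I_n.+2 * 'I_n.+1) :
  lift (ord_swap x).1 (ord_swap x).2 = x.1.
Proof.
rewrite /=; case: unliftP => [j e|e]; first by rewrite [RHS]e.
by have := neq_lift x.1 x.2; rewrite -e eqxx.
Qed.

Lemma ord_swapK n : involutive (@ord_swap n).
Proof.
move=> x; rewrite {1}/ord_swap ord_swapE /= liftK.
by case: x.
Qed.

Lemma ord_swap_lt n (x : 'I_n.+2 * 'I_n.+1) :
  ((ord_swap x).2 < (ord_swap x).1)%N = ~~ (x.2 < x.1)%N.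
Proof.
have /(congr1 val) := ord_swapE x; case: x => i j; rewrite /= /bump.
by set u := odflt _ _ => /=; lia.
Qed.

Lemma ord_swap_sign n (x : 'I_n.+2 * 'I_n.+1) :
  odd ((ord_swap x).1 + (ord_swap x).2) = ~~ odd (x.1 + x.2).
Proof.
have /(congr1 val) := ord_swapE x; case: x => i j; rewrite /= /bump.
by set u := odflt _ _ => /=; lia.
Qed.

Lemma lift_ord_swap n (x : 'I_n.+3 * 'I_n.+2) (q : 'I_n.+1) :
  lift x.1 (lift x.2 q) = lift (ord_swap x).1 (lift (ord_swap x).2 q).
Proof.
apply/val_inj; have /(congr1 val) := ord_swapE x; case: x => i j.
rewrite /= /bump; set u := odflt _ _ => /=; lia.
Qed.

Lemma face_vec_face (R : realType) n (x : 'I_n.+3 * 'I_n.+2) (t : 'rV[R]_n.+1) :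
  face_vec x.1 (face_vec x.2 t) =
  face_vec (ord_swap x).1 (face_vec (ord_swap x).2 t).
Proof.
have face0 (y : 'I_n.+3 * 'I_n.+2) l : (forall q, l <> lift y.1 (lift y.2 q)) ->
    face_vec y.1 (face_vec y.2 t) ord0 l = 0.
  move=> nl; rewrite mxE; case: unliftP => // m lm.
  rewrite mxE; case: unliftP => // q mq; by case: (nl q); rewrite lm mq.
have face1 (y : 'I_n.+3 * 'I_n.+2) q :
    face_vec y.1 (face_vec y.2 t) ord0 (lift y.1 (lift y.2 q)) = t ord0 q.
  by rewrite !mxE liftK mxE liftK.
apply/rowP => l.
have [[q lq]|nl] := pselect (exists q, l = lift x.1 (lift x.2 q)).
  by rewrite [in RHS]lq lift_ord_swap face1 lq face1.
have nl' q : l <> lift x.1 (lift x.2 q) by move=> lq; apply: nl; exists q.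
by rewrite !face0 // => q; rewrite -lift_ord_swap.
Qed.

Variables (R : realType) (k : fieldType) (Z : topologicalType).

Lemma simplex_face_swap n (s : singular_simplex R Z n.+2)
    (x : 'I_n.+3 * 'I_n.+2) :
  simplex_face (simplex_face s x.1) x.2 =
  simplex_face (simplex_face s (ord_swap x).1) (ord_swap x).2.
Proof.
apply/continuousEP => t /=; congr (s _); apply/val_inj.
exact: face_vec_face.
Qed.

Lemma singular_diff_diff n (f : singular_cochain R k Z n) :
  singular_diff (singular_diff f) = 0.
Proof.
apply/funext => s.
pose G (x : 'I_n.+3 * 'I_n.+2) : k :=
  (-1) ^+ (x.1 + x.2) * f (simplex_face (simplex_face s x.1) x.2).
suff G0 : \sum_x G x = 0 :> k.
  transitivity (\sum_x G x : k); last exact: G0.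
  rewrite -(pair_bigA _ (fun i j => G (i, j)))/=; apply: eq_bigr => i _.
  rewrite [X in _ * X]/singular_diff mulr_sumr; apply: eq_bigr => j _.
  by rewrite /G/= exprD mulrA.
rewrite (bigID (fun x : 'I_n.+3 * 'I_n.+2 => (x.2 < x.1)%N))/=.
rewrite [X in X + _](reindex_inj (inv_inj (@ord_swapK _)))/=.
rewrite (eq_bigl (fun x : 'I_n.+3 * 'I_n.+2 => ~~ (x.2 < x.1)%N)); last first.
  by move=> x; rewrite -ord_swap_lt.
rewrite -big_split/= big1 // => x _.
rewrite /G -simplex_face_swap -signr_odd -[(-1) ^+ (x.1 + x.2)]signr_odd.
by rewrite ord_swap_sign signrN mulNr addNr.
Qed.

End DiffSquare.

(* The supremum is taken in the extended reals, so hd is -oo for a space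
   without cohomology, that is, for the empty space only. *)
Definition hd (R : realType) (k : fieldType) (Z : topologicalType) : \bar R :=
  ereal_sup [set j%:R%:E | j in
    [set j | exists x : singular_cohomology R k Z j, x != 0]].

(** * Simply connected spaces *)

Definition unit_interval (R : realType) : set R := `[0, 1].
Arguments unit_interval R : clear implicits.

Section UnitInterval.
Variable R : realType.

Let zero_in : (0 : R) \in unit_interval R.
Proof. by apply/mem_set; rewrite /unit_interval/= in_itv/= lexx ler01. Qed.

Let one_in : (1 : R) \in unit_interval R.
Proof. by apply/mem_set; rewrite /unit_interval/= in_itv/= lexx ler01. Qed.

Let zero_one : (exist _ 0 zero_in : unit_interval R) != exist _ 1 one_in.
Proof. by apply/eqP => /(congr1 val)/= /esym/eqP; rewrite oner_eq0. Qed.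

HB.instance Definition _ := isBiPointed.Build (unit_interval R) zero_one.

End UnitInterval.

Definition null_homotopic (R : realType) (Z : topologicalType) (z : Z)
    (p : {path unit_interval R from z to z in Z}) : Prop :=
  exists H : continuousType (unit_interval R * unit_interval R)%type Z,
    [/\ forall s, H (s, zero) = p s, forall s, H (s, one) = z,
        forall t, H (zero, t) = z & forall t, H (one, t) = z].

Definition simply_connected (R : realType) (Z : topologicalType) : Prop :=
  [/\ inhabited Z,
      forall x y : Z, inhabited {path unit_interval R from x to y in Z} &
      forall (z : Z) (p : {path unit_interval R from z to z in Z}),
        null_homotopic p].

(** * Fibrations *)

Definition cube (R : realType) (n : nat) : set 'rV[R]_n :=
  [set t | forall i, 0 <= t ord0 i <= 1].
Arguments cube R n : clear implicits.

(* The homotopy lifting property for all cubes is equivalent to that for all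
   CW complexes. *)
Definition serre_fibration (R : realType) (X Y : topologicalType) (p : X -> Y) :
    Prop :=
  continuous p /\
  forall n (f : continuousType (cube R n) X)
      (H : continuousType (cube R n * unit_interval R)%type Y),
    (forall s, H (s, zero) = p (f s)) ->
    exists G : continuousType (cube R n * unit_interval R)%type X,
      (forall s, G (s, zero) = f s) /\ (forall x, p (G x) = H x).

Definition fibre (X Y : topologicalType) (p : X -> Y) (y : Y) :
  topologicalType := set_type (p @^-1` [set y]).

(** * Moore loops *)

Definition half_line (R : realType) : set R := `[0, +oo[.
Arguments half_line R : clear implicits.

(* A Moore loop is a pair of a path defined on the half line and a length
   beyond which the path stays at the base point. *)
Definition moore_loop (R : realType) (Y : topologicalType) (y : Y) :
    set ({compact-open, half_line R -> Y} * half_line R)%type :=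
  [set x | let g : half_line R -> Y := x.1 in
    [/\ continuous g, forall t, set_val t = 0 -> g t = y &
        forall t, set_val x.2 <= set_val t -> g t = y]].

Definition moore_loop_space (R : realType) (Y : topologicalType) (y : Y) :
  topologicalType := set_type (@moore_loop R Y y).

(* Main.v *)
Require Import Defs.
From HB Require Import structures.
From mathcomp Require Import all_boot all_order all_algebra.
From mathcomp Require Import all_classical reals ereal topology.
From mathcomp Require Import normedtype homotopy.
From mathcomp Require Import zify ring lra.

Set Implicit Arguments.
Unset Strict Implicit.
Unset Printing Implicit Defensive.

Import Order.TTheory GRing.Theory Num.Theory.
Import numFieldNormedType.Exports.

Local Open Scope classical_set_scope.
Local Open Scope ring_scope.
Local Open Scope quotient_scope.


(** The cohomology of the total space of a fibration is approximated by the
    cohomology of the base with coefficients in that of the fibre, and over a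
    simply connected base the coefficients are constant.  If base and fibre have
    nonzero cohomology up to degrees [m] and [n], then the term of bidegree
    [(m, n)] of the spectral sequence is not zero, no differential enters or leaves
    it, and there are no terms of total degree above [m + n].  Hence the degrees
    add up, which is (i).

    For (ii), the same argument is applied to the inclusion of the fibre [F] into
    [X], whose homotopy fibres are loop spaces of [Y].  Its coefficients over [X]
    are pulled back along [p] from those of the path fibration over [Y]; they are
    constant because [Y] is simply connected.  Therefore hd F = hd X + hd (loops),
    and hd (loops) may be subtracted because a loop space is not empty, so that its
    homological dimension is not -oo.

    The spectral sequence is that of a double complex.  Spaces are replaced by
    their singular simplices with arbitrary finite sets of vertices ([sset]).  For
    a map [f] from [A] to [C], a cell of the double complex is a simplex of [A]
    together with a simplex of [C] that extends its image by further vertices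
    ([kcar]).  The rows are contractible, so that the total complex computes the
    cohomology of [A]; the columns split into the cochains of the homotopy fibres
    [hfibre f v] over the simplices [v] of [C].  A [trivialisation] identifies
    their cohomology with that of one semisimplicial set, compatibly with faces.
    The pages are never formed: [corner_killable] removes the entry of a cocycle in
    a bidegree whose second page vanishes, and [kill_step] iterates this, which
    gives [total_acyclic] and [total_corner].

    All comparisons of fibres use one principle, [acyclic_pullback]: a map whose
    columns are exact, which is checked by exhibiting a cone ([cone_exact]), is an
    isomorphism in cohomology.  Over a Kan complex it applies to the restriction of
    a homotopy fibre to a face ([hfibre_triv_fib]), to the fibre and the homotopy
    fibre of a Kan fibration ([to_hfibre_exact]), and to simplicial and Moore loops
    ([simplicial_loops_acyclic]); the last comparison identifies simplicial loops
    with Moore loops of length one and contracts all Moore loops to these.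
    Transport along edges then gives [transport_trivialisation], once it is known
    that loops bound.

    Topology enters in three places: Serre fibrations induce Kan fibrations of
    singular simplices ([sing_map_kan]), simple connectivity lets loops bound
    ([sing_loops_bound]), and families of Moore loops are continuous functions of
    two variables ([continuous_mev], [unit_loop_surj]). *)

(** * First quadrant double complexes *)

Section DoubleComplex.
Variable D : nat -> nat -> zmodType.
Variables (dh : forall p q, D p q -> D p.+1 q) (dv : forall p q, D p q -> D p q.+1).
Hypothesis dhB : forall p q, {morph @dh p q : x y / x - y}.
Hypothesis dvB : forall p q, {morph @dv p q : x y / x - y}.
Hypothesis dhdh : forall p q (x : D p q), dh (dh x) = 0.
Hypothesis dvdv : forall p q (x : D p q), dv (dv x) = 0.
Hypothesis dhdv : forall p q (x : D p q), dh (dv x) + dv (dh x) = 0.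

(** Elements of the total complex are families over the whole quadrant; the
    degree is recorded by a vanishing condition, which avoids dependent casts
    along equations between degrees. *)
Definition tot := forall p q, D p q.

Definition hor (x : tot) : tot := fun p q =>
  match p return D p q with 0%N => 0 | p'.+1 => dh (x p' q) end.
Definition ver (x : tot) : tot := fun p q =>
  match q return D p q with 0%N => 0 | q'.+1 => dv (x p q') end.
Definition tdiff (x : tot) : tot := fun p q => hor x p q + ver x p q.
Definition tsub (x y : tot) : tot := fun p q => x p q - y p q.

Definition of_degree N (x : tot) := forall p q, (p + q != N)%N -> x p q = 0.
Definition below_degree N (x : tot) :=
  forall p q, ((p + q).+1 != N)%N -> x p q = 0.
Definition supported P (x : tot) := forall p q, (p < P)%N -> x p q = 0.

Lemma ver_eq x y p q : (forall q', x p q' = y p q') -> ver x p q = ver y p q.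
Proof. by move=> xy; rewrite /ver; case: q => [|q] //; rewrite xy. Qed.

Lemma dh0 p q : dh (0 : D p q) = 0.
Proof. by rewrite -(subrr 0) dhB subrr. Qed.
Lemma dv0 p q : dv (0 : D p q) = 0.
Proof. by rewrite -(subrr 0) dvB subrr. Qed.
Lemma dhN p q : {morph @dh p q : x / - x}.
Proof. by move=> x; rewrite -[- x]sub0r dhB dh0 sub0r. Qed.
Lemma dvN p q : {morph @dv p q : x / - x}.
Proof. by move=> x; rewrite -[- x]sub0r dvB dv0 sub0r. Qed.
Lemma dhD p q : {morph @dh p q : x y / x + y}.
Proof. by move=> x y; rewrite -{1}[y]opprK dhB dhN opprK. Qed.
Lemma dvD p q : {morph @dv p q : x y / x + y}.
Proof. by move=> x y; rewrite -{1}[y]opprK dvB dvN opprK. Qed.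

Lemma tdiffB x y p q : tdiff (tsub x y) p q = tdiff x p q - tdiff y p q.
Proof.
rewrite /tdiff /tsub /hor /ver; case: p q => [|p] [|q];
  rewrite ?(dhB, dvB) ?(addr0, add0r, subr0, oppr0)//.
  by rewrite opprD addrACA.
Qed.

Lemma tdiff_tdiff x p q : tdiff (tdiff x) p q = 0.
Proof.
rewrite /tdiff /hor /ver; case: p q => [|[|p]] [|[|q]];
  rewrite ?(dhD, dvD, dh0, dv0, dhdh, dvdv, addr0, add0r)//;
  by rewrite ?addrA ?addr0 dhdv ?add0r ?addr0.
Qed.

Lemma tdiff0 p q : tdiff (fun _ _ => 0) p q = 0.
Proof.
by rewrite /tdiff /hor /ver; case: p q => [|?] [|?]; rewrite ?dh0 ?dv0 addr0.
Qed.

Lemma of_degree_tdiff N x : below_degree N x -> of_degree N (tdiff x).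
Proof.
move=> hx p q pq; rewrite /tdiff /hor /ver.
by case: p q pq => [|p] [|q] pq; rewrite ?hx ?dh0 ?dv0 ?addr0//; lia.
Qed.

Lemma of_degreeB N x y : of_degree N x -> of_degree N y -> of_degree N (tsub x y).
Proof. by move=> hx hy p q pq; rewrite /tsub hx// hy// subr0. Qed.

Lemma supportedB P x y : supported P x -> supported P y -> supported P (tsub x y).
Proof. by move=> hx hy p q pq; rewrite /tsub hx// hy// subr0. Qed.

Lemma supported_tdiff P x : supported P x -> supported P (tdiff x).
Proof.
move=> hx p q pq; rewrite /tdiff /hor /ver.
by case: p q pq => [|p] [|q] pq; rewrite ?hx ?dh0 ?dv0 ?addr0//; lia.
Qed.

Lemma hor0 P x p q : supported P x -> (p <= P)%N -> hor x p q = 0.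
Proof. by move=> sx; case: p => //= p pP; rewrite sx ?dh0. Qed.

Lemma supported_le P P' x : (P' <= P)%N -> supported P x -> supported P' x.
Proof. by move=> PP hx p q pq; apply: hx; lia. Qed.

(** The corner [(P, Q)] is killable when its entry on the second page of the
    spectral sequence vanishes; [b] is the first column of the quotient complex
    in which the primitive has to live. *)
Definition killable (b P Q : nat) := forall x : D P Q,
  dv x = 0 ->
  (exists x' : tot, [/\ of_degree (P + Q)%N x', supported P.+1 x' &
     dh x + ver x' P.+1 Q = 0]) ->
  exists y : tot, [/\ below_degree (P + Q)%N y, supported (maxn b P.-1) y,
     supported P (tdiff y) & tdiff y P Q = x].

(** One step of the filtration: a cochain that is nearly a cocycle represents
    a class on the second page at its lowest column, so that its leading term
    can be removed. *)
Lemma kill_step b N P x : (b <= P)%N ->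
  ((P <= N)%N -> killable b P (N - P)%N) ->
  of_degree N x -> supported P x -> supported P.+2 (tdiff x) ->
  exists y, [/\ below_degree N y, supported (maxn b P.-1) y &
    supported P.+1 (tsub x (tdiff y))].
Proof.
move=> bP kP hx sx sdx; have [PN|NP] := leqP P N; last first.
  exists (fun _ _ => 0); split=> // p q pP.
  rewrite /tsub tdiff0 subr0.
  by have [/sx//|Pp] := ltnP p P; apply: hx; lia.
have e : (P + (N - P) = N)%N by rewrite subnKC.
have c1 : dv (x P (N - P)%N) = 0.
  have := sdx P (N - P)%N.+1 (leqW (leqnn _)); rewrite /tdiff /=.
  suff -> : hor x P (N - P)%N.+1 = 0 by rewrite add0r.
  exact: hor0 sx (leqnn P).
have [|y] := kP PN _ c1.
  exists (fun p q => if (P < p)%N then x p q else 0); split => [p q pq|p q pq|].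
  - by case: ifP => // _; apply: hx; lia.
  - by rewrite ltnNge -ltnS pq.
  have := sdx P.+1 (N - P)%N (leqnn _); rewrite /tdiff /=.
  by case: (N - P)%N => [|q] /=; rewrite ?ltnS ?leqnn.
rewrite e => -[hy sy sdy yP]; exists y; split => // p q; rewrite ltnS leq_eqVlt.
move=> /orP[/eqP ->|pP]; last by rewrite /tsub sx// sdy// subr0.
have [->|qN] := eqVneq q (N - P)%N; first by rewrite /tsub yP subrr.
by rewrite /tsub hx ?(of_degree_tdiff hy) ?subr0//; lia.
Qed.

Lemma kill_range b N P n x : (b <= P)%N ->
  (forall p, (P <= p < P + n)%N -> (p <= N)%N -> killable b p (N - p)%N) ->
  of_degree N x -> supported P x -> supported (P + n)%N.+1 (tdiff x) ->
  exists y, [/\ below_degree N y, supported (maxn b P.-1) y &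
    supported (P + n)%N (tsub x (tdiff y))].
Proof.
elim: n P x => [|n IH] P x bP kill hx sx sdx.
  exists (fun _ _ => 0); split=> // p q pP.
  by rewrite /tsub tdiff0 subr0 sx//; lia.
have [||y [hy sy sxy]] := @kill_step b N P x bP _ hx sx.
- by move=> PN; apply: kill => //; lia.
- by apply: supported_le sdx; lia.
have [|||||z [hz sz sxyz]] := IH P.+1 (tsub x (tdiff y)).
- by lia.
- by move=> p pn; apply: kill; lia.
- by apply: of_degreeB => //; apply: of_degree_tdiff.
- exact: sxy.
- by move=> p q pq; rewrite tdiffB tdiff_tdiff subr0; apply: sdx; lia.
exists (fun p q => y p q + z p q); split=> [p q pq|p q pq|p q pq].
- by rewrite hy// hz// addr0.
- by rewrite sy// sz ?addr0//; lia.
have := sxyz p q; rewrite /tsub addSnnS => /(_ pq) <-.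
rewrite -addrA -opprD; congr (_ - _); rewrite /tdiff /hor /ver.
by case: (p) (q) => [|?] [|?]; rewrite ?dhD ?dvD ?addr0 ?add0r// addrACA.
Qed.

Lemma kill_all b N P x : (b <= P)%N ->
  (forall p, (P <= p <= N)%N -> killable b p (N - p)%N) ->
  of_degree N x -> supported P x -> (forall p q, tdiff x p q = 0) ->
  exists y, [/\ below_degree N y, supported (maxn b P.-1) y &
    forall p q, x p q = tdiff y p q].
Proof.
move=> bP kill hx sx dx.
have [|//|y [hy sy sxy]] := @kill_range b N P N.+1 x bP _ hx sx.
  by move=> p pP pN; apply: kill; rewrite pN andbT; case/andP: pP.
exists y; split => // p q; apply/eqP; rewrite -subr_eq0; apply/eqP.
have [pN|pN] := ltnP p (P + N.+1)%N; first exact: sxy pN.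
by rewrite hx ?(of_degree_tdiff hy) ?subr0//; lia.
Qed.

Definition exact_column P := forall q (x : D P q), dv x = 0 ->
  match q return D P q -> Prop with
  | 0%N => fun x => x = 0
  | q'.+1 => fun x => exists w, x = dv w
  end x.

Definition unit_tot P Q (x : D P Q) : tot := fun p q =>
  match @eqP _ (P, Q) (p, q) with
  | ReflectT e => ecast z (D z.1 z.2) e x
  | ReflectF _ => 0
  end.

Lemma unit_totE P Q (x : D P Q) : unit_tot x P Q = x.
Proof.
by rewrite /unit_tot; case: eqP => // e; rewrite (eq_irrelevance e erefl).
Qed.

Lemma unit_tot0 P Q (x : D P Q) p q : (P, Q) != (p, q) -> unit_tot x p q = 0.
Proof. by rewrite /unit_tot; case: eqP => // ->; rewrite eqxx. Qed.

Lemma unit_tot_degree P Q (x : D P Q) : of_degree (P + Q)%N (unit_tot x).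
Proof. by move=> p q pq; rewrite unit_tot0//; apply: contra pq => /eqP[<- <-]. Qed.

Lemma unit_tot_below N P Q (x : D P Q) : (P + Q).+1 = N -> below_degree N (unit_tot x).
Proof. by move=> <- p q; rewrite eqSS; exact: unit_tot_degree. Qed.

Lemma unit_tot_column P Q (x : D P Q) p q : p != P -> unit_tot x p q = 0.
Proof. by move=> pP; rewrite unit_tot0//; apply: contra pP => /eqP[<-]. Qed.

Lemma unit_tot_zero P Q p q : unit_tot (0 : D P Q) p q = 0.
Proof.
rewrite /unit_tot; case: eqP => // e.
have cast0 u v (h : u = v) : ecast z (D z.1 z.2) h (0 : D u.1 u.2) = 0 by case: v / h.
exact: (@cast0 (P, Q) (p, q) e).
Qed.

Lemma exact_column_killable b P Q : (b <= P)%N -> exact_column P -> killable b P Q.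
Proof.
move=> bP ex x dx _; have := ex _ _ dx; case: Q x dx => [|Q] x dx /=.
  move=> ->; exists (fun _ _ => 0); split => // [p q pq|].
    by rewrite tdiff0.
  by rewrite tdiff0.
move=> [w xw]; exists (unit_tot w); split => [|p q pq|p q pq|].
- exact: unit_tot_below (esym (addnS P Q)).
- by rewrite unit_tot_column//; apply/eqP; lia.
- rewrite /tdiff /hor /ver; case: p q pq => [|p] [|q] pq;
  rewrite ?unit_tot0 ?dh0 ?dv0 ?addr0//; by apply/eqP => -[? ?]; lia.
rewrite /tdiff /= unit_totE -xw (@hor0 P) ?add0r// => p q pP.
by rewrite unit_tot_column//; apply/eqP; lia.
Qed.

Lemma exact_columns b N x : (forall P, (b <= P)%N -> exact_column P) ->
  of_degree N x -> supported b x -> (forall p q, tdiff x p q = 0) ->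
  exists y, [/\ below_degree N y, supported b y & forall p q, x p q = tdiff y p q].
Proof.
move=> ex hx sx dx; have [||y [hy sy xy]] := @kill_all b N b x _ _ hx sx dx.
- by [].
- by move=> p /andP[bp _]; apply: exact_column_killable => //; apply: ex.
by exists y; split => //; apply: supported_le sy; rewrite leq_maxl.
Qed.

End DoubleComplex.

(** Exchanging the two indices turns exact columns into exact rows. *)
Lemma exact_rows (D : nat -> nat -> zmodType)
    (dh : forall p q, D p q -> D p.+1 q) (dv : forall p q, D p q -> D p q.+1)
    (dhB : forall p q, {morph @dh p q : x y / x - y})
    (dvB : forall p q, {morph @dv p q : x y / x - y})
    (dhdh : forall p q (x : D p q), dh _ _ (dh _ _ x) = 0)
    (dvdv : forall p q (x : D p q), dv _ _ (dv _ _ x) = 0)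
    (dhdv : forall p q (x : D p q), dh _ _ (dv _ _ x) + dv _ _ (dh _ _ x) = 0)
    b N (x : tot D) :
  (forall q, (b <= q)%N ->
     @exact_column (fun p q => D q p) (fun p q => dh q p) q) ->
  of_degree N x -> (forall p q, (q < b)%N -> x p q = 0) ->
  (forall p q, tdiff dh dv x p q = 0) ->
  exists y, [/\ below_degree N y, forall p q, (q < b)%N -> y p q = 0 &
    forall p q, x p q = tdiff dh dv y p q].
Proof.
move=> ex hx sx dx.
pose D' p q := D q p.
have [|||||p q pq|q p qb|q p|y [hy sy xy]] := @exact_columns D'
   (fun p q => dv q p) (fun p q => dh q p) _ _ _ _ _ b N (fun p q => x q p) ex.
- by move=> p q; apply: dvB.
- by move=> p q; apply: dhB.
- by move=> p q; apply: dvdv.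
- by move=> p q; apply: dhdh.
- by move=> p q z; rewrite addrC dhdv.
- by rewrite hx// addnC.
- exact: sx.
- rewrite -[RHS](dx p q) /tdiff addrC /hor /ver.
  by case: (p) (q) => [|?] [|?].
exists (fun p q => y q p); split => [p q pq|p q qb|p q].
- by rewrite hy// addnC.
- exact: sy.
rewrite (xy q p) /tdiff addrC /hor /ver.
by case: (p) (q) => [|?] [|?].
Qed.

(** * Semisimplicial sets and their cochains *)

(** The index of [cell] is the number of vertices, so that [cell 0] holds the
    augmentation and [cell n.+1] the simplices of dimension [n]. *)
Record semi := Semi {
  cell :> nat -> Type;
  dface : forall n, 'I_n.+1 -> cell n.+1 -> cell n;
  dface_swap : forall n (x : 'I_n.+2 * 'I_n.+1) (e : cell n.+2),
    dface x.2 (dface x.1 e) = dface (ord_swap x).2 (dface (ord_swap x).1 e) }.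

Lemma ord_swap_eq n (x : 'I_n.+2 * 'I_n.+1) a b :
  a = lift x.1 x.2 -> lift a b = x.1 -> ord_swap x = (a, b).
Proof.
move=> -> abx; rewrite [LHS]surjective_pairing /=; congr pair.
by apply: (@lift_inj _ (lift x.1 x.2)); rewrite abx (ord_swapE x).
Qed.

Lemma ord_swap0l n (j : 'I_n.+1) : ord_swap (ord0, j) = (lift ord0 j, ord0).
Proof. by apply: ord_swap_eq => //; apply: val_inj. Qed.

Lemma ord_swap0r n (i : 'I_n.+1) : ord_swap (lift ord0 i, ord0) = (ord0, i).
Proof. by apply: ord_swap_eq => //; apply: val_inj. Qed.

Lemma ord_swap_lift n (x : 'I_n.+2 * 'I_n.+1) :
  ord_swap (lift ord0 x.1, lift ord0 x.2) =
  (lift ord0 (ord_swap x).1, lift ord0 (ord_swap x).2).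
Proof.
apply: ord_swap_eq => /=; last rewrite -[in RHS](ord_swapE x);
  by apply: val_inj; rewrite /= /bump /=; lia.
Qed.

Section Cochains.
Variable k : fieldType.

Section Coboundary.
Variables (E : semi) (V : lmodType k).

Definition cob n (c : E n -> V) : E n.+1 -> V :=
  fun e => \sum_(i < n.+1) (-1) ^+ i *: c (dface i e).

Lemma cobP n (a : k) (c c' : E n -> V) e :
  cob (fun s => a *: c s + c' s) e = a *: cob c e + cob c' e.
Proof.
rewrite /cob scaler_sumr -big_split /=; apply: eq_bigr => i _.
by rewrite scalerDr !scalerA mulrC.
Qed.

Lemma cobB n (c c' : E n -> V) e :
  cob (fun s => c s - c' s) e = cob c e - cob c' e.
Proof.
rewrite /cob -sumrB; apply: eq_bigr => i _; by rewrite scalerBr.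
Qed.

Lemma cob0 n e : cob (fun _ : E n => 0) e = 0.
Proof. by rewrite /cob big1 // => i _; rewrite scaler0. Qed.

Lemma cob_cob n (c : E n -> V) e : cob (cob c) e = 0.
Proof.
pose G (x : 'I_n.+2 * 'I_n.+1) :=
  (-1) ^+ (x.1 + x.2) *: c (dface x.2 (dface x.1 e)).
transitivity (\sum_x G x).
  rewrite -(pair_bigA _ (fun i j => G (i, j)))/=; apply: eq_bigr => i _.
  rewrite /cob scaler_sumr; apply: eq_bigr => j _.
  by rewrite /G/= exprD scalerA.
rewrite (bigID (fun x : 'I_n.+2 * 'I_n.+1 => (x.2 < x.1)%N))/=.
rewrite [X in X + _](reindex_inj (inv_inj (@ord_swapK _)))/=.
rewrite (eq_bigl (fun x : 'I_n.+2 * 'I_n.+1 => ~~ (x.2 < x.1)%N)); last first.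
  by move=> x; rewrite -ord_swap_lt.
rewrite -big_split/= big1 // => x _.
rewrite /G -dface_swap -signr_odd -[(-1) ^+ (x.1 + x.2)]signr_odd.
by rewrite ord_swap_sign signrN scaleNr addNr.
Qed.

Definition is_cob n : (E n -> V) -> Prop :=
  match n with
  | 0%N => fun c => forall e, c e = 0
  | n'.+1 => fun c => exists w : E n' -> V, forall e, c e = cob w e
  end.

Definition exact_semi := forall n (c : E n -> V), (forall e, cob c e = 0) -> is_cob c.

Definition is_cone (h : forall n, E n -> E n.+1) :=
  (forall n (e : E n), dface ord0 (h n e) = e) /\
  (forall n (e : E n.+1) i, dface (lift ord0 i) (h n.+1 e) = h n (dface i e)).

(** A cone operator is a contracting homotopy. *)
Lemma cone_exact h : is_cone h -> exact_semi.
Proof.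
move=> [h0 hS] n c dc; case: n c dc => [|n] c dc /=.
  move=> e; have := dc (h _ e).
  by rewrite /cob big_ord_recl big_ord0 addr0 expr0 scale1r h0.
exists (fun e => c (h n e)) => e; have := dc (h _ e).
rewrite /cob big_ord_recl expr0 scale1r h0 => /eqP; rewrite addr_eq0 => /eqP ->.
rewrite -sumrN; apply: eq_bigr => i _.
by rewrite hS -scaleNr lift0 exprS mulN1r opprK.
Qed.

End Coboundary.

(** Cones may be built by filling: the cone over [e] has [e] opposite to the
    apex and, as its other faces, the cones over the faces of [e].  The relation
    [Q] restricts the admissible cones. *)
Section ConeByFilling.
Variables (E : semi) (Q : forall n, E n -> E n.+1 -> Prop).

Definition compatible n : ('I_n.+1 -> E n) -> Prop :=
  match n with
  | 0%N => fun _ => True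
  | n'.+1 => fun W => forall x : 'I_n'.+2 * 'I_n'.+1,
      dface x.2 (W x.1) = dface (ord_swap x).2 (W (ord_swap x).1)
  end.

Definition admissible n : E n -> ('I_n.+1 -> E n) -> Prop :=
  match n with
  | 0%N => fun _ _ => True
  | n'.+1 => fun e W => forall i, Q (dface i e) (W (lift ord0 i))
  end.

Hypothesis fill : forall n (e : E n) (W : 'I_n.+1 -> E n), W ord0 = e ->
  compatible W -> admissible e W ->
  exists w, Q e w /\ forall i, dface i w = W i.

(* Cones are chosen one dimension at a time; [founded] remembers that the last
   choice extends some choice in the dimension below, which is what makes the
   faces prescribed for the next cone compatible. *)
Let good n (h : E n -> E n.+1) := forall e, dface ord0 (h e) = e /\ Q e (h e).
Let next n (h : E n -> E n.+1) (h' : E n.+1 -> E n.+2) :=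
  forall e i, dface (lift ord0 i) (h' e) = h (dface i e).
Let founded n : (E n -> E n.+1) -> Prop :=
  match n with
  | 0%N => fun _ => True
  | n'.+1 => fun h => exists h', next h' h
  end.

Lemma cone_by_filling : exists h : forall n, E n -> E n.+1, is_cone h.
Proof.
have step n (h : E n -> E n.+1) : good h /\ founded h ->
    exists h', (good h' /\ founded h') /\ next h h'.
  move=> [gh fh].
  have ex (e : E n.+1) : exists w, (dface ord0 w = e /\ Q e w) /\
      forall i, dface (lift ord0 i) w = h (dface i e).
    pose W (i : 'I_n.+2) : E n.+1 :=
      if unlift ord0 i is Some j then h (dface j e) else e.
    have W0 : W ord0 = e by rewrite /W unlift_none.
    have WS i : W (lift ord0 i) = h (dface i e) by rewrite /W liftK.
    have [|i|w [Qw dw]] := fill W0.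
    - move=> [i j]; case: (unliftP ord0 i) => [i'|] ->; last first.
        by rewrite ord_swap0l /= WS W0 (gh _).1.
      case: (unliftP ord0 j) => [j'|] ->; last first.
        by rewrite ord_swap0r /= WS W0 (gh _).1.
      case: n h gh fh e W W0 WS i' j' {i j} => [|n] h gh fh e W W0 WS i' j'.
        by case: j'.
      case: fh => h' nh'.
      rewrite (ord_swap_lift (i', j')) /= !WS !nh'; congr h'.
      exact: (dface_swap (i', j')).
    - by rewrite WS; case: (gh (dface i e)).
    exists w; split; last by move=> i; rewrite dw WS.
    by rewrite dw W0.
  have [h' h'P] := choice ex; exists h'; split; first split.
  - by move=> e; case: (h'P e).
  - by exists h => e i; case: (h'P e).
  - by move=> e i; case: (h'P e).
have [h0 h0P] : exists h0 : E 0%N -> E 1%N, good h0.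
  have ex (e : E 0%N) : exists w, dface ord0 w = e /\ Q e w.
    have [||//|w [Qw dw]] := @fill 0%N e (fun=> e); rewrite //.
    by exists w; rewrite dw.
  by have [h' h'P] := choice ex; exists h'.
pose state n := {h : E n -> E n.+1 | good h /\ founded h}.
pose st := fix st n : state n := match n with
  | 0%N => exist _ h0 (conj h0P I)
  | n'.+1 => let x := cid (step n' _ (proj2_sig (st n'))) in
     exist _ (proj1_sig x) (proj1 (proj2_sig x)) end.
exists (fun n => proj1_sig (st n)); split=> [n e|n e i].
  by case: (proj2_sig (st n)) => + _ => /(_ e)[].
exact: (proj2 (proj2_sig (cid (step n _ (proj2_sig (st n)))))).
Qed.

End ConeByFilling.

End Cochains.

(** * Symmetric simplicial sets and the comparison double complex *)

(** A presheaf on all finite types and all functions between them: joins of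
    simplices are then disjoint sums, and there is no arithmetic of dimensions
    and no monotonicity to check.  Singular simplices have this symmetry.  The
    empty simplex is unique, which turns cochains into augmented complexes. *)
Record sset := SSet {
  scar :> finType -> Type;
  act : forall I J : finType, (I -> J) -> scar J -> scar I;
  act_id : forall (I : finType) (x : scar I), act id x = x;
  act_comp : forall (I J L : finType) (g : I -> J) (h : J -> L) (x : scar L),
    act g (act h x) = act (h \o g) x;
  spt : scar 'I_0;
  spt_uniq : forall x : scar 'I_0, x = spt }.

Arguments act {s I J}.

Record smap (A C : sset) := SMap {
  sfun : forall I : finType, A I -> C I;
  sfun_act : forall (I J : finType) (g : I -> J) (x : A J),
    sfun (act g x) = act g (sfun x) }.

Arguments sfun {A C} _ {I}.

Definition joinmap (I I' J J' : Type) (g : I' -> I) (h : J' -> J) (x : I' + J') :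
  I + J := match x with inl i => inl (g i) | inr j => inr (h j) end.

Lemma joinmap_inj (I I' J J' : Type) (g : I' -> I) (h : J' -> J) :
  injective g -> injective h -> injective (joinmap g h).
Proof. by move=> gi hi [a|a] [b|b] //= e; congr (_ _); [apply: gi | apply: hi]; case: e. Qed.

Definition copair (I J L : Type) (g : I -> L) (h : J -> L) (x : I + J) : L :=
  match x with inl i => g i | inr j => h j end.

Lemma dface_act_swap (S : sset) n (x : 'I_n.+2 * 'I_n.+1) (e : S 'I_n.+2) :
  act (lift x.2) (act (lift x.1) e) =
  act (lift (ord_swap x).2) (act (lift (ord_swap x).1) e).
Proof.
rewrite !act_comp; congr act; apply/funext => q /=.
by case: n x q e => [|n] x q _; [case: q | exact: lift_ord_swap].
Qed.

Definition semi_of (S : sset) : semi :=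
  @Semi (fun n => S 'I_n) (fun n i => act (lift i)) (@dface_act_swap S).

Section Comparison.
Variables (A C : sset) (f : smap A C).

(** The cells of a bisimplicial model of [f].  The direction of [I] is
    contractible once the simplex of [A] is fixed, so that the total complex
    computes the cohomology of [A]; fixing the front face in [C] leaves a homotopy
    fibre of [f]. *)
Definition kcar (I J : finType) : Type :=
  {st : C (I + J)%type * A J | act inr st.1 = sfun f st.2}.

Lemma kcar_eq (I J : finType) (e e' : kcar I J) :
  (sval e).1 = (sval e').1 -> (sval e).2 = (sval e').2 -> e = e'.
Proof.
case: e e' => [[s t] h] [[s' t'] h'] /= es et.
by subst; rewrite (Prop_irrelevance h h').
Qed.

Lemma kact_subproof (I I' J J' : finType) (g : I' -> I) (h : J' -> J)
    (e : kcar I J) :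
  act inr (act (joinmap g h) (sval e).1) = sfun f (act h (sval e).2).
Proof. by rewrite sfun_act -(proj2_sig e) !act_comp. Qed.

Definition kact (I I' J J' : finType) (g : I' -> I) (h : J' -> J) (e : kcar I J) :
    kcar I' J' :=
  exist _ (act (joinmap g h) (sval e).1, act h (sval e).2) (kact_subproof g h e).

Lemma joinmap_id (I J : Type) : @joinmap I I J J id id = id.
Proof. by apply/funext => -[]. Qed.

Lemma joinmap_comp (I I' I'' J J' J'' : Type) (g : I' -> I) (g' : I'' -> I')
    (h : J' -> J) (h' : J'' -> J') : joinmap g h \o joinmap g' h' = joinmap (g \o g') (h \o h').
Proof. by apply/funext => -[]. Qed.

Lemma kact_id (I J : finType) (e : kcar I J) : kact id id e = e.
Proof. by apply: kcar_eq; rewrite /= ?joinmap_id act_id. Qed.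

Lemma kact_comp (I I' I'' J J' J'' : finType) (g : I' -> I) (g' : I'' -> I')
    (h : J' -> J) (h' : J'' -> J') (e : kcar I J) :
  kact g' h' (kact g h e) = kact (g \o g') (h \o h') e.
Proof. by apply: kcar_eq; rewrite /= act_comp// joinmap_comp. Qed.

Lemma hface_swap (J : finType) n (x : 'I_n.+2 * 'I_n.+1) (e : kcar 'I_n.+2 J) :
  kact (lift x.2) id (kact (lift x.1) id e) =
  kact (lift (ord_swap x).2) id (kact (lift (ord_swap x).1) id e).
Proof.
rewrite !kact_comp; congr kact; apply/funext => q /=.
by case: n x q e => [|n] x q _; [case: q | exact: lift_ord_swap].
Qed.

Lemma vface_swap (I : finType) n (x : 'I_n.+2 * 'I_n.+1) (e : kcar I 'I_n.+2) :
  kact id (lift x.2) (kact id (lift x.1) e) =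
  kact id (lift (ord_swap x).2) (kact id (lift (ord_swap x).1) e).
Proof.
rewrite !kact_comp; congr kact; apply/funext => q /=.
by case: n x q e => [|n] x q _; [case: q | exact: lift_ord_swap].
Qed.

Definition hsemi (J : finType) : semi :=
  @Semi (fun n => kcar 'I_n J) (fun n i => kact (lift i) id) (@hface_swap J).
Definition vsemi (I : finType) : semi :=
  @Semi (fun n => kcar I 'I_n) (fun n j => kact id (lift j)) (@vface_swap I).

(** A row is contractible: the first vertex of the simplex of [A] can be
    repeated among the vertices of the extension. *)
Lemma hsemi_cone (J : finType) (j0 : J) : exists h, @is_cone (hsemi J) h.
Proof.
pose kap p (x : 'I_p.+1 + J) : 'I_p + J := match x with
  | inl i => if unlift ord0 i is Some i' then inl i' else inr j0
  | inr j => inr j end.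
have kapP p (e : kcar 'I_p J) : act inr (act (kap p) (sval e).1) = sfun f (sval e).2.
  by rewrite act_comp -(proj2_sig e).
exists (fun p (e : kcar 'I_p J) => exist _ (act (kap p) (sval e).1, (sval e).2) (kapP p e)).
split=> [p e|p e i]; apply: kcar_eq; rewrite /= ?act_id// !act_comp.
  rewrite -[RHS]act_id; congr act; apply/funext => -[l|j] //=.
  by rewrite liftK.
congr act; apply/funext => -[l|j] //=.
case: (unliftP ord0 l) => [l'|] -> /=.
  have -> : lift (lift ord0 i) (lift ord0 l') = lift ord0 (lift i l').
    by apply: val_inj; rewrite /= /bump /=; lia.
  by rewrite liftK.
have -> : lift (lift ord0 i) ord0 = ord0 by apply: val_inj.
by rewrite unlift_none.
Qed.

Variable k : fieldType.

Definition dbl (p q : nat) : zmodType := kcar 'I_p 'I_q -> k^o.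

Definition dhor p q (x : dbl p q) : dbl p.+1 q :=
  @cob k (hsemi 'I_q) k^o p x.
Definition dver p q (x : dbl p q) : dbl p q.+1 :=
  fun e => (-1) ^+ p *: @cob k (vsemi 'I_p) k^o q x e.

Lemma dhorB p q : {morph @dhor p q : x y / x - y}.
Proof.
move=> x y; apply/funext => e.
exact: (@cobB k (hsemi 'I_q) k^o p x y e).
Qed.

Lemma dverB p q : {morph @dver p q : x y / x - y}.
Proof.
move=> x y; apply/funext => e; rewrite /dver.
by rewrite (@cobB k (vsemi 'I_p) k^o q x y e) scalerBr.
Qed.

Lemma dhor_dhor p q (x : dbl p q) : dhor (dhor x) = 0.
Proof. by apply/funext => e; apply: cob_cob. Qed.

Lemma cobZ (E : semi) (V : lmodType k) n (a : k) (c : E n -> V) e :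
  cob (fun s => a *: c s) e = a *: cob c e.
Proof.
by rewrite /cob scaler_sumr; apply: eq_bigr => i _; rewrite !scalerA mulrC.
Qed.

Lemma signZK (V : lmodType k) p (x : V) : (-1) ^+ p *: ((-1) ^+ p *: x) = x.
Proof. by rewrite scalerA -exprD addnn -signr_odd odd_double expr0 scale1r. Qed.

Lemma dver_dver p q (x : dbl p q) : dver (dver x) = 0.
Proof.
apply/funext => e; rewrite /dver.
rewrite (@cobZ (vsemi 'I_p) k^o q.+1 ((-1) ^+ p) (@cob k (vsemi 'I_p) k^o q x) e).
by rewrite cob_cob !scaler0.
Qed.

Lemma dhor_dver p q (x : dbl p q) : dhor (dver x) + dver (dhor x) = 0.
Proof.
apply/funext => e.
transitivity (dhor (dver x) e + dver (dhor x) e) => //.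
rewrite /dhor /dver /cob scaler_sumr.
under eq_bigr do rewrite scalerA scaler_sumr.
under [X in _ + X]eq_bigr do rewrite scalerA scaler_sumr.
rewrite exchange_big /= -big_split /= big1 // => j _.
rewrite -big_split /= big1 // => i _.
rewrite !kact_comp /= !scalerA exprS mulN1r.
rewrite [(-1) ^+ i * _ * _]mulrC [(-1) ^+ i * _]mulrC.
rewrite !mulNr scaleNr mulrA [(-1) ^+ j * _]mulrC; exact: subrr.
Qed.

Local Notation D := dbl.
Local Notation tdf := (@tdiff dbl dhor dver).

Lemma row_exact q : (0 < q)%N ->
  @exact_column (fun p q => D q p) (fun p q => @dhor q p) q.
Proof.
case: q => [//|q] _ p x dx.
have [h hc] := @hsemi_cone 'I_q.+1 ord0.
have ex := @cone_exact k (hsemi 'I_q.+1) k^o h hc.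
have := ex p x (fun e => congr1 (@^~ e) dx).
case: p x dx => [|p] x dx /=; first by move=> h0; apply/funext => e; apply: h0.
by move=> [w xw]; exists w; apply/funext => e; apply: xw.
Qed.

Lemma column_exact p : @exact_semi k (vsemi 'I_p) k^o ->
  @exact_column D (fun p q => @dver p q) p.
Proof.
move=> ex q x dx.
have x0 e : cob (x : vsemi 'I_p q -> k^o) e = 0.
  have := congr1 (fun y => (-1) ^+ p *: y e) dx.
  by rewrite /dver signZK scaler0.
have := ex q x x0; case: q x dx x0 => [|q] x dx x0 /=.
  by move=> h0; apply/funext => e; apply: h0.
move=> [w xw]; exists (fun e => (-1) ^+ p *: w e); apply/funext => e; rewrite xw.
by rewrite /dver cobZ signZK.
Qed.

(** ** Cochains of the target as total cochains *)

(** Coboundaries of families indexed by all dimensions: no equation between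
    dimensions has to be transported. *)
Definition cobfam (c : forall n, C 'I_n -> k^o) : forall n, C 'I_n -> k^o :=
  fun n s => \sum_(i < n) (-1) ^+ i *: c n.-1 (act (lift i) s).

Definition total_of (c : forall n, C 'I_n -> k^o) : tot D :=
  fun p q e => c (p + q)%N (act (@fintype.split p q) (sval e).1).
Arguments total_of c p q e : clear implicits.

Lemma fam_act (c : forall n, C 'I_n -> k^o) n n' (I : finType) (g : 'I_n -> I)
    (g' : 'I_n' -> I) (s : C I) : n = n' ->
  (forall (l : 'I_n) (l' : 'I_n'), l = l' :> nat -> g l = g' l') -> c n (act g s) = c n' (act g' s).
Proof.
move=> e; subst => gg'; congr (c _ (act _ _)); apply/funext => l; exact: gg'.
Qed.

(** The faces of a join are the faces of its two halves, with the signs of the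
    total differential. *)
Lemma tdiff_total_of c p q e :
  tdf (total_of c) p q e = total_of (cobfam c) p q e.
Proof.
rewrite /tdf /tdiff /total_of /cobfam.
transitivity (hor dhor (total_of c) p q e + ver dver (total_of c) p q e) => //.
rewrite big_split_ord /=; congr (_ + _).
  case: p e => [|p] e /=; first by rewrite big_ord0.
  rewrite /dhor /cob; apply: eq_bigr => i _; congr (_ *: _).
  rewrite /total_of /= !act_comp; apply: fam_act => // l l' ll'.
  have -> : l' = l by apply: val_inj.
  have [u ->] : exists u, l = unsplit u by exists (fintype.split l); rewrite splitK.
  rewrite /= unsplitK; case: u => [a|b] /=.
    have -> : lift (lshift q i) (lshift q a) = lshift q (lift i a).
      exact: val_inj.
    by rewrite -[lshift _ _]/(unsplit (inl _)) unsplitK.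
  have -> : lift (lshift q i) (rshift p b) = rshift p.+1 b.
    by apply: val_inj; rewrite /= /bump /=; have := ltn_ord i; lia.
  by rewrite -[rshift p.+1 b]/(unsplit (inr b)) unsplitK.
case: q e => [|q] e /=; first by rewrite big_ord0.
rewrite /dver /cob scaler_sumr; apply: eq_bigr => j _.
rewrite scalerA -exprD; congr (_ *: _).
rewrite /total_of /= !act_comp; apply: fam_act => [|l l' ll']; first by rewrite addnS.
have [u lu] : exists u, l = unsplit u by exists (fintype.split l); rewrite splitK.
move: ll'; rewrite lu /= unsplitK; case: u {lu} => [a|b] /= ll'.
  have -> : lift (rshift p j) l' = lshift q.+1 a.
    by apply: val_inj; rewrite /= /bump /= -ll' /=; have := ltn_ord a; lia.
  by rewrite -[lshift _ _]/(unsplit (inl _)) unsplitK.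
have -> : lift (rshift p j) l' = rshift p (lift j b).
  by apply: val_inj; rewrite /= /bump /= -ll' /=; lia.
by rewrite -[rshift p _]/(unsplit (inr _)) unsplitK.
Qed.

End Comparison.

Arguments total_of {A C} f {k} c p q e.
Arguments cobfam {C k} c n s.

(** * Maps with contractible fibres induce isomorphisms in cohomology *)

Section Unaugmented.
Variables (k : fieldType) (E : semi) (V : lmodType k).

(** Coboundaries of the complex without augmentation, in dimension [n]. *)
Definition is_bd n : (E n.+1 -> V) -> Prop :=
  match n with
  | 0%N => fun c => forall e, c e = 0
  | n'.+1 => fun c => exists w : E n'.+1 -> V, forall e, c e = cob w e
  end.

Definition is_cocycle n (c : E n.+1 -> V) := forall e, cob c e = 0.

Lemma is_bdP n a (c c' : E n.+1 -> V) :
  is_bd c -> is_bd c' -> is_bd (fun e => a *: c e + c' e).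
Proof.
case: n c c' => [|n] c c' /=; first by move=> h h' e; rewrite h h' scaler0 addr0.
by move=> [w h] [w' h']; exists (fun e => a *: w e + w' e) => e; rewrite h h' cobP.
Qed.

Lemma is_bd_ext n (c c' : E n.+1 -> V) : (forall e, c e = c' e) -> is_bd c -> is_bd c'.
Proof. by move=> /funext ->. Qed.

Lemma is_bd0 n : is_bd (fun _ : E n.+1 => 0 : V).
Proof. by case: n => [|n] //=; exists (fun _ => 0) => e; rewrite cob0. Qed.

Lemma is_bdB n (c c' : E n.+1 -> V) :
  is_bd c -> is_bd c' -> is_bd (fun e => c e - c' e).
Proof.
move=> h h'; have := is_bdP (-1) h' h; apply: is_bd_ext => e.
by rewrite scaleN1r addrC.
Qed.

Lemma is_cocycleP n a (c c' : E n.+1 -> V) :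
  is_cocycle c -> is_cocycle c' -> is_cocycle (fun e => a *: c e + c' e).
Proof. by move=> h h' e; rewrite cobP h h' scaler0 addr0. Qed.

Lemma is_cocycleB n (c c' : E n.+1 -> V) :
  is_cocycle c -> is_cocycle c' -> is_cocycle (fun e => c e - c' e).
Proof. by move=> h h' e; rewrite cobB h h' subrr. Qed.

End Unaugmented.

Definition acyclic (k : fieldType) (E : semi) n :=
  forall c : E n.+1 -> k^o, is_cocycle c -> is_bd c.

Lemma not_acyclic (k : fieldType) (E : semi) n : ~ acyclic k E n ->
  exists2 c : E n.+1 -> k^o, is_cocycle c & ~ is_bd c.
Proof.
move=> nac; apply: contrapT => h; apply: nac => c dc; apply: contrapT => nc.
by apply: h; exists c.
Qed.

Lemma ord0_False : 'I_0 -> False. Proof. by case. Qed.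

Definition ord0_elim (T : Type) (i : 'I_0) : T := False_rect T (ord0_False i).

Section ContractibleFibres.
Variables (k : fieldType) (A C : sset) (f : smap A C).

Local Notation D := (dbl f k).
Local Notation tdf := (@tdiff D (@dhor A C f k) (@dver A C f k)).
Local Notation dh := (@dhor A C f k).
Local Notation dv := (@dver A C f k).

(** The two edges of the double complex: without vertices in one of the two
    directions it is [C] or [A]. *)
Lemma embC_subproof (I : finType) (s : C I) :
  act inr (act (copair id (@ord0_elim I)) s) = sfun f (spt A).
Proof. by rewrite [LHS](spt_uniq) [RHS]spt_uniq. Qed.

Definition embC (I : finType) (s : C I) : kcar f I 'I_0 :=
  exist _ (act (copair id (@ord0_elim I)) s, spt A) (embC_subproof s).

Lemma embA_subproof (J : finType) (t : A J) :
  act inr (act (copair (@ord0_elim J) id) (sfun f t)) = sfun f t.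
Proof. by rewrite act_comp -[RHS]act_id. Qed.

Definition embA (J : finType) (t : A J) : kcar f 'I_0 J :=
  exist _ (act (copair (@ord0_elim J) id) (sfun f t), t) (embA_subproof t).

Lemma kact_embC (I I' : finType) (g : I' -> I) (s : C I) :
  kact g id (embC s) = embC (act g s).
Proof.
apply: kcar_eq; rewrite /= ?act_id// !act_comp; congr act.
by apply/funext => -[i|[]].
Qed.

Lemma kact_embA (J J' : finType) (h : J' -> J) (t : A J) :
  kact id h (embA t) = embA (act h t).
Proof.
apply: kcar_eq; rewrite //= sfun_act !act_comp; congr act.
by apply/funext => -[[]|j].
Qed.

Lemma dhor_embC p (x : D p 0%N) (s : C 'I_p.+1) :
  dh x (embC s) = @cob k (semi_of C) k^o p (fun u => x (embC u)) s.
Proof. by apply: eq_bigr => i _; rewrite /= kact_embC. Qed.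

Lemma dver_embA q (x : D 0%N q) (t : A 'I_q.+1) :
  dv x (embA t) = @cob k (semi_of A) k^o q (fun u => x (embA u)) t.
Proof.
by rewrite /dver expr0 scale1r; apply: eq_bigr => i _; rewrite /= kact_embA.
Qed.

Lemma kcar0r (I : finType) (e : kcar f I 'I_0) : e = embC (act inl (sval e).1).
Proof.
apply: kcar_eq => /=; last by rewrite [LHS]spt_uniq.
rewrite act_comp -[LHS]act_id; congr act.
by apply/funext => -[i|[]].
Qed.

Lemma kcar0l (J : finType) (e : kcar f 'I_0 J) : e = embA (sval e).2.
Proof.
apply: kcar_eq => //=; rewrite -(proj2_sig e) act_comp -[LHS]act_id; congr act.
by apply/funext => -[[]|i].
Qed.

(** On the edges, the total cochain of [c] is [c] itself and its pullback. *)
Lemma total_of_embC (c : forall n, C 'I_n -> k^o) b (s : C 'I_b) : total_of f c b 0 (embC s) = c b s.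
Proof.
rewrite /total_of /= act_comp -[in RHS](act_id s); apply: fam_act.
  by rewrite addn0.
move=> l l' ll'; rewrite /=.
have -> : l = unsplit (inl l') by apply: val_inj.
by rewrite unsplitK.
Qed.

Lemma total_of_embA (c : forall n, C 'I_n -> k^o) b (t : A 'I_b) : total_of f c 0 b (embA t) = c b (sfun f t).
Proof.
rewrite /total_of /= act_comp -[in RHS](act_id (sfun f t)); apply: fam_act => //.
move=> l l' ll'; rewrite /=.
have -> : l = unsplit (inr l') by apply: val_inj.
by rewrite unsplitK.
Qed.

Definition fam_of n (c : C 'I_n -> k^o) : forall m, C 'I_m -> k^o := fun m =>
  match @eqP _ n m with
  | ReflectT e => ecast z (C 'I_z -> k^o) e c
  | ReflectF _ => fun=> 0
  end.
Arguments fam_of {n} c m s.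

Lemma fam_ofE n (c : C 'I_n -> k^o) : fam_of c n = c.
Proof.
by rewrite /fam_of; case: eqP => // e; rewrite (eq_irrelevance e erefl).
Qed.

Lemma fam_of0 n (c : C 'I_n -> k^o) m s : n != m -> fam_of c m s = 0.
Proof. by rewrite /fam_of; case: eqP => // ->; rewrite eqxx. Qed.

Lemma cobfam_cocycle n (c : C 'I_n.+1 -> k^o) :
  @is_cocycle k (semi_of C) k^o n c -> forall m s, cobfam (fam_of c) m s = 0.
Proof.
move=> dc [|m] s; first by rewrite /cobfam big_ord0.
rewrite /cobfam /=; have [e|nm] := eqVneq n.+1 m.
  by subst m; rewrite fam_ofE; apply: dc.
by rewrite big1 // => i _; rewrite fam_of0 // scaler0.
Qed.

Lemma total_of_degree n (c : C 'I_n -> k^o) : of_degree n (total_of f (fam_of c)).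
Proof.
by move=> p q pq; apply/funext => e; rewrite /total_of fam_of0// eq_sym.
Qed.

Lemma total_of_cocycle n (c : C 'I_n.+1 -> k^o) :
  @is_cocycle k (semi_of C) k^o n c ->
  forall p q, tdf (total_of f (fam_of c)) p q = 0.
Proof.
move=> dc p q; apply/funext => e.
by rewrite tdiff_total_of /total_of cobfam_cocycle.
Qed.

Hypothesis fibre_exact : forall p, @exact_semi k (vsemi f 'I_p.+1) k^o.

Let rows_exact N (x : tot D) : of_degree N x ->
  (forall p q, (q < 1)%N -> x p q = 0) -> (forall p q, tdf x p q = 0) ->
  exists y, [/\ below_degree N y, forall p q, (q < 1)%N -> y p q = 0 &
    forall p q, x p q = tdf y p q].
Proof.
apply: exact_rows.
- exact: dhorB.
- exact: dverB.
- exact: dhor_dhor.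
- exact: dver_dver.
- exact: dhor_dver.
- by move=> q q0; apply: row_exact.
Qed.

Let columns_exact N (x : tot D) : of_degree N x ->
  supported 1 x -> (forall p q, tdf x p q = 0) ->
  exists y, [/\ below_degree N y, supported 1 y & forall p q, x p q = tdf y p q].
Proof.
apply: exact_columns.
- exact: dhorB.
- exact: dverB.
- exact: dhor_dhor.
- exact: dver_dver.
- exact: dhor_dver.
- by move=> [//|p] _; apply: column_exact.
Qed.

Let tdfB := @tdiffB D dh dv (@dhorB A C f k) (@dverB A C f k).
Let tdf2 := @tdiff_tdiff D dh dv (@dhorB A C f k) (@dverB A C f k)
  (@dhor_dhor A C f k) (@dver_dver A C f k) (@dhor_dver A C f k).
Let tdf_degree := @of_degree_tdiff D dh dv (@dhorB A C f k) (@dverB A C f k).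
Let dh0' p q : dh 0 = 0 :> D p.+1 q := @dh0 D dh (@dhorB A C f k) p q.
Let dv0' p q : dv 0 = 0 :> D p q.+1 := @dv0 D dv (@dverB A C f k) p q.

(** Both [A] and [C] compute the cohomology of the total complex, and a cocycle
    of [C] spreads over all corners of the complex, with its pullback to [A] at
    the other end. *)
Lemma pullback_inj n (c : C 'I_n.+1 -> k^o) :
  @is_cocycle k (semi_of C) k^o n c ->
  @is_bd k (semi_of A) k^o n (fun t => c (sfun f t)) ->
  @is_bd k (semi_of C) k^o n c.
Proof.
move=> dc bc.
have [w [wn wd]] : exists w : A 'I_n -> k^o, (n = 0%N -> forall t, w t = 0) /\
    forall t, c (sfun f t) = @cob k (semi_of A) k^o n w t.
  case: n c dc bc => [|n] c dc /= => [c0|[w cw]].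
    exists (fun=> 0); split => // t; rewrite c0.
    by rewrite (@cob0 k (semi_of A) k^o).
  by exists w.
pose W : D 0%N n := fun e => w (sval e).2.
have W0 : n = 0%N -> W = 0 by move=> n0; apply/funext => e; apply: wn.
pose x := tsub (total_of f (fam_of c)) (tdf (unit_tot W)).
have hW : below_degree n.+1 (unit_tot W) by exact: unit_tot_below.
have hx : of_degree n.+1 x.
  by apply: of_degreeB; [exact: total_of_degree | exact: tdf_degree].
have sx : supported 1 x.
  move=> [|//] q _; rewrite /x /tsub; have [->|qn] := eqVneq q n.+1; last first.
    by rewrite total_of_degree// ?(tdf_degree hW) ?subr0//= add0n.
  apply/funext => e; rewrite [e]kcar0l /=.
  transitivity (total_of f (fam_of c) 0 n.+1 (embA (sval e).2) -
     tdf (unit_tot W) 0%N n.+1 (embA (sval e).2)) => //.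
  rewrite total_of_embA fam_ofE /tdiff /= unit_totE.
  rewrite [X in _ - X](_ : _ = dv W (embA (sval e).2)); last exact: add0r.
  by rewrite dver_embA wd subrr.
have dx p q : tdf x p q = 0.
  by rewrite tdfB tdf2 subr0 total_of_cocycle.
have [z [hz sz xz]] := columns_exact hx sx dx.
have cz s : c s = dh (z n 0%N) (embC s).
  have := congr1 (fun y : D n.+1 0%N => y (embC s)) (xz n.+1 0%N).
  rewrite /x /tsub.
  have -> : tdf (unit_tot W) n.+1 0%N = 0.
    rewrite /tdiff /= addr0; have [n0|n0] := eqVneq n 0%N.
      suff -> : unit_tot W n 0%N = 0 by rewrite dh0'.
      by rewrite (W0 n0) unit_tot_zero.
    by rewrite unit_tot0 ?dh0'//; apply: contra n0 => /eqP[] <-.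
  rewrite subr0 total_of_embC fam_ofE => ->.
  by rewrite /tdiff /= addr0.
move: z sz cz {xz hz x W W0 hW hx sx dx wn wd bc w}.
case: n c dc => [|n] c dc z sz cz /=.
  by move=> s; rewrite cz sz// dh0'.
by exists (fun u => z n.+1 0%N (embC u)) => s; rewrite cz dhor_embC.
Qed.

(** Since the columns away from the edge of [A] are exact, a cocycle on that edge
    is cohomologous, in the total complex, to one on the edge of [C]. *)
Lemma pullback_surj n (a : A 'I_n.+1 -> k^o) :
  @is_cocycle k (semi_of A) k^o n a ->
  exists2 c : C 'I_n.+1 -> k^o, @is_cocycle k (semi_of C) k^o n c &
  @is_bd k (semi_of A) k^o n (fun t => a t - c (sfun f t)).
Proof.
move=> da.
pose W : D 0%N n.+1 := fun e => a (sval e).2.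
have hU : of_degree n.+1 (unit_tot W) := unit_tot_degree W.
have hU' : below_degree n.+2 (unit_tot W) by exact: unit_tot_below.
have sU : supported 1 (tdf (unit_tot W)).
  move=> [|//] q _; have [->|qn] := eqVneq q n.+2; last first.
    by rewrite (tdf_degree hU')//= add0n.
  apply/funext => e; rewrite [e]kcar0l /tdiff /= unit_totE.
  transitivity (dv W (embA (sval e).2)); first exact: add0r.
  by rewrite dver_embA; apply: da.
have [|y [hy sy Uy]] := columns_exact (tdf_degree hU') sU.
  by move=> p q; rewrite tdf2.
pose x := tsub (unit_tot W) y.
have hx : of_degree n.+1 x.
  exact: of_degreeB.
have dx p q : tdf x p q = 0 by rewrite tdfB -Uy subrr.
pose c (s : C 'I_n.+1) : k^o := x n.+1 0%N (embC s).
have dc : @is_cocycle k (semi_of C) k^o n c.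
  move=> s; rewrite /c.
  transitivity (dh (x n.+1 0%N) (embC s)); first by rewrite dhor_embC.
  have := dx n.+2 0%N; rewrite /tdiff /= addr0.
  by move=> /(congr1 (fun y : D n.+2 0%N => y (embC s))) ->.
exists c => //.
pose x' := tsub x (total_of f (fam_of c)).
have [|p [|//] _|p q|z [hz sz xz]] := @rows_exact n.+1 x'.
- by apply: of_degreeB => //; apply: total_of_degree.
- rewrite /x' /tsub; have [->|qn] := eqVneq p n.+1; last first.
    by rewrite hx ?total_of_degree ?subr0 ?addn0.
  apply/funext => e; rewrite [e]kcar0r.
  transitivity (x n.+1 0%N (embC (act inl (sval e).1)) -
    total_of f (fam_of c) n.+1 0 (embC (act inl (sval e).1))) => //.
  by rewrite total_of_embC fam_ofE subrr.
- by rewrite tdfB dx total_of_cocycle// subrr.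
have az t : a t - c (sfun f t) = dv (z 0%N n) (embA t).
  transitivity (x' 0%N n.+1 (embA t)); last by rewrite xz /tdiff /=; exact: add0r.
  transitivity ((unit_tot W 0%N n.+1 - y 0%N n.+1) (embA t) -
    total_of f (fam_of c) 0 n.+1 (embA t)) => //.
  by rewrite sy// subr0 unit_totE total_of_embA fam_ofE.
suff bd m (g : A 'I_m.+1 -> k^o) : (forall t, g t = dv (z 0%N m) (embA t)) ->
  @is_bd k (semi_of A) k^o m g by exact: bd az.
case: m g => [|m] g gz; first by move=> t; rewrite gz sz// dv0'.
by exists (fun u => z 0%N m.+1 (embA u)) => t; rewrite gz dver_embA.
Qed.

End ContractibleFibres.

(** * Coefficients in a vector space *)

Section LinearExtension.
Variables (k : fieldType) (U V : lmodType k) (T : Type) (u : T -> U) (w : T -> V).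

Hypothesis consistent : forall s : seq (k * T),
  \sum_(x <- s) x.1 *: u x.2 = 0 -> \sum_(x <- s) x.1 *: w x.2 = 0.

Let linear_graph (A : set (U * V)) :=
  [/\ A (0, 0),
      forall a p q, A p -> A q -> A (a *: p.1 + q.1, a *: p.2 + q.2),
      forall v, A (0, v) -> v = 0 &
      forall t, A (u t, w t)].

Let spanned : set (U * V) := [set p | exists s : seq (k * T),
  p = (\sum_(x <- s) x.1 *: u x.2, \sum_(x <- s) x.1 *: w x.2)].

Let spanned_graph : linear_graph spanned.
Proof.
split.
- by exists [::]; rewrite !big_nil.
- move=> a _ _ [s ->] [s' ->] /=.
  exists ([seq (a * x.1, x.2) | x <- s] ++ s').
  rewrite !big_cat !big_map !scaler_sumr /=.
  by congr (_ + _, _ + _); apply: eq_bigr => x _; rewrite scalerA.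
- by move=> v [s [/esym/consistent e ->]].
- by move=> t; exists [:: (1, t)]; rewrite !big_seq1 !scale1r.
Qed.

(** Prescribed values extend to a linear map as soon as they respect the linear
    relations: a maximal linear graph is defined everywhere. *)
Lemma linear_extension : exists G : U -> V,
  (forall a x y, G (a *: x + y) = a *: G x + G y) /\ forall t, G (u t) = w t.
Proof.
have [F FP totF|A [AP Amax]] := @Zorn_bigcup _ [set A | A = set0 \/ linear_graph A].
  have [[X FX gX]|noX] := pselect (exists2 X, F X & linear_graph X); last first.
    left; apply/seteqP; split => // p [X FX Xp].
    by have [X0|gX] := FP X FX; [rewrite X0 in Xp | case: noX; exists X].
  right; split.
  - by exists X => //; case: gX.
  - move=> a p q [Y FY Yp] [Z FZ Zq].
    have gY W r : F W -> W r -> linear_graph W.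
      by move=> FW Wr; have [W0|//] := FP W FW; rewrite W0 in Wr.
    have [YZ|ZY] := totF Y Z FY FZ.
      by exists Z => //; have [_ + _ _] := gY Z q FZ Zq; apply => //; apply: YZ.
    by exists Y => //; have [_ + _ _] := gY Y p FY Yp; apply => //; apply: ZY.
  - by move=> v [Y FY Yv]; have [Y0|[_ _ + _]] := FP Y FY; [rewrite Y0 in Yv | apply].
  - by move=> t; exists X => //; case: gX.
have gA : linear_graph A.
  case: AP => // A0; exfalso; apply: (Amax spanned); last by right.
  rewrite A0; split => // sub; suff : (set0 : set (U * V)) (0, 0) by [].
  by apply: sub; exists [::]; rewrite !big_nil.
have [A00 Alin Afun Auw] := gA.
have Atot x : exists v, A (x, v).
  apply: contrapT => nx.
  pose B := [set p : U * V | exists a y, p.1 = a *: x + y /\ A (y, p.2)].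
  apply: (Amax B); last first.
    right; split.
    - by exists 0, 0; rewrite scale0r addr0.
    - move=> a [p1 p2] [q1 q2] [b [y [-> py]]] [c [z [-> qz]]] /=.
      exists (a * b + c), (a *: y + z); split; last exact: (Alin a _ _ py qz).
      by rewrite scalerDr scalerDl scalerA addrACA.
    - move=> v [a [y [/= ax yv]]]; have [a0|a0] := eqVneq a 0.
        by apply: Afun; move: ax yv; rewrite a0 scale0r add0r => <-.
      case: nx; exists (- a^-1 *: v).
      have := Alin (- a^-1) _ _ yv A00; rewrite /= !addr0.
      have -> : y = - a *: x.
        by apply/eqP; rewrite scaleNr -addr_eq0 addrC -ax.
      by rewrite scalerA mulrNN mulVf// scale1r.
    - by move=> t; exists 0, (u t); rewrite scale0r add0r.
  split=> [[y v] yv|sub]; first by exists 0, y; rewrite scale0r add0r.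
  by apply: nx; exists 0; apply: sub; exists 1, 0; rewrite scale1r addr0.
have [G GA] := choice Atot.
have Auniq x v v' : A (x, v) -> A (x, v') -> v = v'.
  move=> xv xv'; apply/eqP; rewrite -subr_eq0; apply/eqP/Afun.
  by have := Alin (-1) _ _ xv' xv; rewrite /= !scaleN1r addNr addrC.
exists G; split=> [a x y|t]; last exact: Auniq (GA _) (Auw t).
exact: Auniq (GA _) (Alin a _ _ (GA x) (GA y)).
Qed.

End LinearExtension.

Lemma functional_at (k : fieldType) (V : lmodType k) (v : V) : v != 0 ->
  exists l : V -> k^o, (forall a x y, l (a *: x + y) = a *: l x + l y) /\ l v = 1.
Proof.
move=> v0; have [s|l [lL lv]] := @linear_extension k V k^o unit (fun=> v) (fun=> 1).
  rewrite -!scaler_suml => /eqP; rewrite scaler_eq0 (negPf v0) orbF => /eqP ->.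
  by rewrite scale0r.
by exists l; split => //; apply: (lv tt).
Qed.

Section LinearMaps.
Variables (k : fieldType) (U V : lmodType k) (G : U -> V).
Hypothesis Glin : forall a x y, G (a *: x + y) = a *: G x + G y.

Lemma lin0 : G 0 = 0.
Proof.
have := Glin (-1) 0 0; rewrite scaler0 addr0 scaleN1r addNr; exact.
Qed.

Lemma lin_sum (I : Type) (r : seq I) (a : I -> k) (x : I -> U) :
  G (\sum_(i <- r) a i *: x i) = \sum_(i <- r) a i *: G (x i).
Proof.
elim: r => [|i r IH]; first by rewrite !big_nil lin0.
by rewrite !big_cons Glin IH.
Qed.

Lemma cob_lin (E : semi) n (c : E n -> U) e :
  cob (fun s => G (c s)) e = G (cob c e).
Proof. by rewrite /cob lin_sum. Qed.

End LinearMaps.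

(** Over a field, vanishing of cohomology does not depend on the coefficients.
    Chains are replaced by the functionals on cochains that they define, so
    that no free module is needed. *)
Lemma acyclic_coefficients (k : fieldType) (E : semi) n : acyclic k E n ->
  forall (V : lmodType k) (c : E n.+1 -> V), is_cocycle c -> is_bd c.
Proof.
move=> ac V c dc.
have lc (l : V -> k^o) : (forall a x y, l (a *: x + y) = a *: l x + l y) ->
    is_bd (fun e => l (c e)).
  by move=> lL; apply: ac => e; rewrite (cob_lin lL) dc (lin0 lL).
case: n c {ac} dc lc => [|n] c dc lc.
  move=> e; apply: contrapT => /eqP /functional_at [l [lL le]].
  by have := lc l lL e; rewrite le => /eqP; rewrite oner_eq0.
pose U := ((E n.+1 -> k^o) -> k^o) : lmodType k.
pose ev (s : E n.+1) : U := fun phi => phi s.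
pose bnd (e : E n.+2) : U := \sum_(i < n.+2) (-1) ^+ i *: ev (dface i e).
have bndE e phi : bnd e phi = cob phi e.
  by rewrite /bnd fct_sumE.
have [s|G [GL Gu]] := @linear_extension k U V (E n.+2) bnd c.
  move=> us; apply: contrapT => /eqP /functional_at [l [lL]].
  rewrite (lin_sum lL); have [phi lphi] := lc l lL.
  have := congr1 (@^~ phi) us; rewrite fct_sumE.
  have -> : \sum_(i <- s) (i.1 *: bnd i.2) phi = \sum_(i <- s) i.1 *: l (c i.2).
    by apply: eq_bigr => x _; rewrite lphi -bndE.
  by move=> -> /eqP; rewrite eq_sym oner_eq0.
exists (fun s => G (ev s)) => e.
by rewrite -Gu (cob_lin GL).
Qed.

(** * Homotopy fibres *)

Section Fibres.
Variables (A C : sset) (f : smap A C).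

Definition front (I J : finType) (e : kcar f I J) : C I := act inl (sval e).1.

Lemma front_kact (I I' J J' : finType) (g : I' -> I) (h : J' -> J) (e : kcar f I J) :
  front (kact g h e) = act g (front e).
Proof. by rewrite /front /= !act_comp. Qed.

Section Fibre.
Variables (I : finType) (v : C I).

(** The simplices joined to [v]: a model of the homotopy fibre of [f] over the
    simplex [v] that lifts no paths and chooses nothing. *)
Definition hfibre_car (J : finType) := {e : kcar f I J | front e = v}.

Lemma hfibre_act_subproof (J J' : finType) (h : J' -> J) (e : hfibre_car J) :
  front (kact id h (sval e)) = v.
Proof. by rewrite front_kact (proj2_sig e) act_id. Qed.

Definition hfibre_act (J J' : finType) (h : J' -> J) (e : hfibre_car J) : hfibre_car J' :=
  exist _ (kact id h (sval e)) (hfibre_act_subproof h e).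

Lemma hfibre_eq (J : finType) (e e' : hfibre_car J) : sval e = sval e' -> e = e'.
Proof. by case: e e' => [e h] [e' h'] /= ee; subst; rewrite (Prop_irrelevance h h'). Qed.

Lemma hfibre_act_id (J : finType) (e : hfibre_car J) : hfibre_act id e = e.
Proof. by apply: hfibre_eq; rewrite /= kact_id. Qed.

Lemma hfibre_act_comp (J J' J'' : finType) (g : J -> J') (h : J' -> J'') e :
  hfibre_act g (hfibre_act h e) = hfibre_act (h \o g) e.
Proof. by apply: hfibre_eq; rewrite /= kact_comp. Qed.

Lemma front_embC : front (embC f v) = v.
Proof. by rewrite /front /= act_comp act_id. Qed.

Definition hfibre_pt : hfibre_car 'I_0 := exist _ (embC f v) front_embC.

Lemma hfibre_pt_uniq (e : hfibre_car 'I_0) : e = hfibre_pt.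
Proof.
apply: hfibre_eq; case: e => e ev /=; rewrite [e]kcar0r; congr embC; exact: ev.
Qed.

Definition hfibre : sset := @SSet hfibre_car (fun J' J => @hfibre_act J J')
  hfibre_act_id hfibre_act_comp hfibre_pt hfibre_pt_uniq.

End Fibre.

Lemma hfibre_map_subproof (I I' J : finType) (th : I' -> I) (v : C I) (u : C I')
    (h : act th v = u) (e : hfibre v J) : front (kact th id (sval e)) = u.
Proof. by rewrite front_kact (proj2_sig e). Qed.

(** Fibres are contravariant in their base simplex; the equation on base points
    is an argument so that these maps compose without casts. *)
Definition hfibre_map (I I' : finType) (th : I' -> I) (v : C I) (u : C I')
    (h : act th v = u) (J : finType) (e : hfibre v J) : hfibre u J :=
  exist _ (kact th id (sval e)) (hfibre_map_subproof h e).

Lemma hfibre_map_act (I I' : finType) (th : I' -> I) (v : C I) (u : C I')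
    (h : act th v = u) (J J' : finType) (g : J' -> J) (e : hfibre v J) :
  hfibre_map h (act g e) = act g (hfibre_map h e).
Proof. by apply: hfibre_eq; rewrite /= !kact_comp. Qed.

Definition hfibre_smap (I I' : finType) (th : I' -> I) (v : C I) (u : C I')
    (h : act th v = u) : smap (hfibre v) (hfibre u) :=
  @SMap (hfibre v) (hfibre u) (hfibre_map h) (fun J' J => @hfibre_map_act _ _ _ _ _ h J J').

Variable k : fieldType.

Definition res (I J : finType) (v : C I) (x : kcar f I J -> k^o) (e : hfibre v J) : k^o :=
  x (sval e).

(** Cells with distinct front faces lie in distinct fibres, so that a cochain of
    the double complex may be prescribed on each fibre independently. *)
Definition assemble (I J : finType) (X : forall v : C I, hfibre v J -> k^o)
    (e : kcar f I J) : k^o :=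
  X (front e) (exist _ e erefl).

Lemma res_assemble (I J : finType) (X : forall v : C I, hfibre v J -> k^o) (v : C I) :
  res (v := v) (assemble X) = X v.
Proof. by apply/funext => -[e h]; rewrite /res /assemble /=; case: v / h. Qed.

Lemma cob_res (I : finType) n (v : C I) (x : kcar f I 'I_n -> k^o) e :
  @cob k (semi_of (hfibre v)) k^o n (res x) e = @cob k (vsemi f I) k^o n x (sval e).
Proof. by []. Qed.

End Fibres.

Arguments front {A C f I J} e.
Arguments hfibre {A C} f {I} v.
Arguments res {A C f k I J} v x e.
Arguments assemble {A C f k I J} X e.
Arguments hfibre_map {A C f I I' th v u} h {J} e.

Section CochainComplex.
Variables (k : fieldType) (E : semi).

Definition cochain_space (n : nat) : lmodType k := E n.+1 -> k^o.

Definition cochain_diff n (c : cochain_space n) : cochain_space n.+1 :=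
  @cob k E k^o n.+1 c.

Lemma cochain_diff_linear n : linear (@cochain_diff n).
Proof. by move=> a c c'; apply/funext => e; apply: (@cobP k E k^o). Qed.

HB.instance Definition _ n :=
  GRing.isLinear.Build k _ _ _ _ (@cochain_diff_linear n).

End CochainComplex.

(** The cohomology of a semisimplicial set as a vector space of classes, which is
    needed where it serves as coefficients. *)
Lemma cohomology_space (k : fieldType) (E : semi) n :
  exists (V : lmodType k) (cls : (E n.+1 -> k^o) -> V),
  [/\ forall a c c', is_cocycle c -> is_cocycle c' ->
        cls (fun e => a *: c e + c' e) = a *: cls c + cls c',
      forall c, is_cocycle c -> (cls c = 0 <-> is_bd c) &
      forall x, exists2 c, is_cocycle c & cls c = x].
Proof.
pose dL i : {linear cochain_space k E i -> cochain_space k E i.+1} :=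
  @cochain_diff k E i.
have coP (c : cochain_space k E n) : is_cocycle c -> c \in cocycle dL (n := n).
  by move=> dc; apply/eqP/funext => e; apply: dc.
have coP' (c : cocycles dL n) : is_cocycle (cochain_of c).
  case: c => c /= cc e; have /eqP := cc; by move=> /(congr1 (@^~ e)).
have bdP (c : cocycles dL n) : (c \in @coboundary _ _ dL n) <-> is_bd (cochain_of c).
  rewrite unfold_in; split=> [/asboolP|h]; last apply/asboolP.
    case: n c {coP coP'} => [|m] c /=; first by move=> -> e.
    by move=> [y yc]; exists y => e; rewrite -yc.
  case: n c h {coP coP'} => [|m] c /=; first by move=> h; apply/funext.
  by move=> [w cw]; exists w; apply/funext => e; rewrite cw.
pose V := cohomology dL n.
pose cls (c : E n.+1 -> k^o) : V :=
  if pselect (is_cocycle c) is left h then \pi_V (Cocycle (coP c h)) else 0.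
have clsE c (h : is_cocycle c) : cls c = \pi_V (Cocycle (coP c h)).
  by rewrite /cls; case: pselect => // h'; rewrite (Prop_irrelevance h h').
exists V, cls; split.
- move=> a c c' dc dc'.
  rewrite (clsE _ (is_cocycleP a dc dc')) (clsE _ dc) (clsE _ dc').
  rewrite -[a *: \pi_V _]/(lquot_scale _ _) lquot_scaleE -pi_lquotD.
  by congr \pi; apply: val_inj.
- move=> c dc; rewrite (clsE _ dc).
  have <- : \pi_V 0 = 0 :> V.
    have := @pi_lquotD _ _ _ (@coboundary_submod_closed _ _ dL n) 0 0.
    by rewrite addr0 => /eqP; rewrite -subr_eq0 opprD addrA subrr sub0r oppr_eq0 => /eqP.
  by rewrite pi_lquotE subr0 bdP.
move=> x; exists (cochain_of (repr x)) => //.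
rewrite (clsE _ (coP' _)) -[RHS]reprK; congr \pi; exact: val_inj.
Qed.

(** * The corner of the spectral sequence *)

Lemma is_cocycle_sum (k : fieldType) (E : semi) (V : lmodType k) n (J : Type) (r : seq J) (a : J -> k)
    (c : J -> E n.+1 -> V) : (forall j, is_cocycle (c j)) ->
  is_cocycle (fun e => \sum_(j <- r) a j *: c j e).
Proof.
move=> cc; elim: r => [|j r IH].
  have -> : (fun e => \sum_(j <- [::]) a j *: c j e) = (fun=> 0).
    by apply/funext => e; rewrite big_nil.
  by move=> e; rewrite cob0.
have -> : (fun e => \sum_(j <- j :: r) a j *: c j e) =
    (fun e => a j *: c j e + \sum_(j <- r) a j *: c j e).
  by apply/funext => e; rewrite big_cons.
exact: is_cocycleP.
Qed.

Lemma cls_sum (k : fieldType) (E : semi) n (V : lmodType k) (cls : (E n.+1 -> k^o) -> V)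
    (J : Type) (r : seq J) (a : J -> k) (c : J -> E n.+1 -> k^o) :
  (forall a c c', is_cocycle c -> is_cocycle c' ->
     cls (fun e => a *: c e + c' e) = a *: cls c + cls c') ->
  (forall c, is_cocycle c -> (cls c = 0 <-> is_bd c)) ->
  (forall j, is_cocycle (c j)) ->
  cls (fun e => \sum_(j <- r) a j *: c j e) = \sum_(j <- r) a j *: cls (c j).
Proof.
move=> clsL cls0 cc; elim: r => [|j r IH].
  have -> : (fun e => \sum_(j <- [::]) a j *: c j e) = (fun=> 0).
    by apply/funext => e; rewrite big_nil.
  rewrite big_nil; apply/cls0; last exact: is_bd0.
  by move=> e; rewrite (@cob0 k E k^o).
have -> : (fun e => \sum_(j <- j :: r) a j *: c j e) =
    (fun e => a j *: c j e + \sum_(j <- r) a j *: c j e).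
  by apply/funext => e; rewrite big_cons.
by rewrite clsL ?IH ?big_cons//; apply: is_cocycle_sum.
Qed.

(** An identification, modulo coboundaries, of the [q]-th cohomology of every
    fibre with that of [G], compatible with changing the base simplex.  It is a
    relation between cocycles because neither direction is canonical on
    cochains. *)
Record trivialisation (k : fieldType) (A C : sset) (f : smap A C) (G : semi) (q : nat) :=
  Trivialisation {
  triv : forall (I : finType) (v : C I),
    (G q.+1 -> k^o) -> (hfibre f v 'I_q.+1 -> k^o) -> Prop;
  triv_lin : forall (I : finType) (v : C I) a g g' x x',
    @triv I v g x -> @triv I v g' x' ->
    @triv I v (fun e => a *: g e + g' e) (fun e => a *: x e + x' e);
  triv_base : forall p (v : C 'I_p.+1) x, @is_cocycle k (semi_of (hfibre f v)) k^o q x ->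
    exists2 g, is_cocycle g & @triv 'I_p.+1 v g x;
  triv_fibre : forall p (v : C 'I_p.+1) g, is_cocycle g ->
    exists2 x, @is_cocycle k (semi_of (hfibre f v)) k^o q x & @triv 'I_p.+1 v g x;
  triv_bd : forall p (v : C 'I_p.+1) g x, is_cocycle g ->
    @is_cocycle k (semi_of (hfibre f v)) k^o q x -> @triv 'I_p.+1 v g x ->
    (is_bd g <-> @is_bd k (semi_of (hfibre f v)) k^o q x);
  triv_nat : forall (I I' : finType) (th : I' -> I) (v : C I) (u : C I')
    (h : act th v = u) g x, inhabited I' -> @triv I' u g x -> @triv I v g (fun e => x (hfibre_map h e)) }.

Arguments triv {k A C f G q} _ {I} v g x.

Section Corner.
Variables (k : fieldType) (A C : sset) (f : smap A C) (G : semi).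
Variable T : forall q, trivialisation k f G q.

Local Notation D := (fun p q => dbl f k p q.+1).
Local Notation dh := (fun p q => @dhor A C f k p q.+1).
Local Notation dv := (fun p q => @dver A C f k p q.+1).
Local Notation tdf := (@tdiff D dh dv).

Let dhB' p q : {morph dh p q : x y / x - y} := @dhorB A C f k p q.+1.
Let dvB' p q : {morph dv p q : x y / x - y} := @dverB A C f k p q.+1.
Let dhdh' p q (x : D p q) : dh _ _ (dh _ _ x) = 0 := dhor_dhor x.
Let dvdv' p q (x : D p q) : dv _ _ (dv _ _ x) = 0 := dver_dver x.
Let dhdv' p q (x : D p q) : dh _ _ (dv _ _ x) + dv _ _ (dh _ _ x) = 0 := dhor_dver x.
Let tdfB := @tdiffB D dh dv dhB' dvB'.
Let tdf2 := @tdiff_tdiff D dh dv dhB' dvB' dhdh' dvdv' dhdv'.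
Let tdf_degree := @of_degree_tdiff D dh dv dhB' dvB'.
Let dh00 p q : dh p q 0 = 0 := @dh0 D dh dhB' p q.
Let dv00 p q : dv p q 0 = 0 := @dv0 D dv dvB' p q.

Lemma triv_zero q p (v : C 'I_p.+1) : triv (T q) v (fun=> 0) (fun=> 0).
Proof.
have [|g _ vg] := @triv_base _ _ _ _ _ _ (T q) p v (fun=> 0).
  by move=> e; rewrite (@cob0 k (semi_of (hfibre f v)) k^o).
have := triv_lin (-1) vg vg; congr triv.
  by apply/funext => e; rewrite scaleN1r addNr.
by apply/funext => e; rewrite scaleN1r addNr.
Qed.

Lemma triv_scale q p (v : C 'I_p.+1) a g x : triv (T q) v g x ->
  triv (T q) v (fun e => a *: g e) (fun e => a *: x e).
Proof.
move=> vg; have := triv_lin a vg (triv_zero q v); congr triv.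
  by apply/funext => e; rewrite addr0.
by apply/funext => e; rewrite addr0.
Qed.

Lemma triv_sub q p (v : C 'I_p.+1) g g' x x' : triv (T q) v g x -> triv (T q) v g' x' ->
  triv (T q) v (fun e => g e - g' e) (fun e => x e - x' e).
Proof.
move=> vg vg'; have := triv_lin (-1) vg' vg; congr triv.
  by apply/funext => e; rewrite scaleN1r addrC.
by apply/funext => e; rewrite scaleN1r addrC.
Qed.

Lemma triv_sum q p (v : C 'I_p.+1) (J : Type) (r : seq J) (a : J -> k)
    (g : J -> G q.+1 -> k^o) (x : J -> hfibre f v 'I_q.+1 -> k^o) :
  (forall j, triv (T q) v (g j) (x j)) ->
  triv (T q) v (fun e => \sum_(j <- r) a j *: g j e) (fun e => \sum_(j <- r) a j *: x j e).
Proof.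
move=> vgx; elim: r => [|j r IH].
  have := triv_zero q v; congr triv; apply/funext => e; by rewrite big_nil.
have := triv_lin (a j) (vgx j) IH.
by congr triv; apply/funext => e; rewrite big_cons.
Qed.

(** The horizontal differential acts on the classes of the restrictions to the
    fibres as the coboundary of the base. *)
Lemma triv_dhor q p (g : C 'I_p.+1 -> G q.+1 -> k^o) (x : D p.+1 q)
    (u : C 'I_p.+2) : (forall v, triv (T q) v (g v) (res v x)) ->
  triv (T q) u (fun e => \sum_(i < p.+2) (-1) ^+ i *: g (act (lift i) u) e)
    (res u (dh _ _ x)).
Proof.
move=> gx; have := @triv_sum q p.+1 u _ (index_enum 'I_p.+2) (fun i => (-1) ^+ i)
  _ _ (fun i => triv_nat (erefl (act (lift i) u)) (inhabits ord0) (gx (act (lift i) u))).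
by congr triv.
Qed.

Lemma res_cocycle q p (x : D p q) v : dv _ _ x = 0 ->
  @is_cocycle k (semi_of (hfibre f v)) k^o q (res v x).
Proof.
move=> dx e; rewrite cob_res; have := congr1 (fun y => (-1) ^+ p *: y (sval e)) dx.
by rewrite /dver signZK => ->; exact: scaler0.
Qed.

Lemma assemble_cocycle q p (X : forall v : C 'I_p, hfibre f v 'I_q.+1 -> k^o) :
  (forall v, @is_cocycle k (semi_of (hfibre f v)) k^o q (X v)) ->
  dv p q (assemble X) = 0.
Proof.
move=> dX; apply/funext => e; rewrite /dver.
have := dX (front e) (exist _ e erefl).
by rewrite -[X in cob X]res_assemble cob_res /= => ->; rewrite scaler0.
Qed.

Lemma assemble_bd q p (x : D p q) :
  (forall v, @is_bd k (semi_of (hfibre f v)) k^o q (res v x)) ->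
  match q return D p q -> Prop with
  | 0%N => fun x => x = 0
  | q'.+1 => fun x => exists w, x = dv p q' w
  end x.
Proof.
case: q x => [|q] x bx.
  by apply/funext => e; apply: (bx (front e) (exist _ e erefl)).
pose W v := sval (cid (bx v)); have WP v := svalP (cid (bx v)).
exists (fun e => (-1) ^+ p *: assemble W e); apply/funext => e.
rewrite /dver cobZ signZK.
have := WP (front e) (exist _ e erefl); rewrite {1}/res /= => ->.
by rewrite -[sval _]/(W (front e)) -[X in cob X]res_assemble cob_res.
Qed.

Lemma ver_bd q p (x : tot D) v :
  @is_bd k (semi_of (hfibre f v)) k^o q (res v (ver dv x p q)).
Proof.
case: q => [|q] //=; exists (fun e => (-1) ^+ p *: res v (x p q) e) => e.
by rewrite cobZ cob_res.
Qed.

Lemma dv_dhor q p (x : D p q) : dv _ _ x = 0 -> dv _ _ (dh _ _ x) = 0.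
Proof.
move=> dx; have := dhdv' x; have -> : dh p q.+1 (dv p q x) = 0 by rewrite dx dh00.
by rewrite add0r.
Qed.

(** The vanishing of a term of the second page, with cohomology classes of the
    fibre replaced by families of cocycles: over a field, either factor kills the
    cohomology of the base with coefficients in the classes. *)
Lemma base_coboundary p q (g : C 'I_p.+1 -> G q.+1 -> k^o) :
  acyclic k (semi_of C) p \/ acyclic k G q ->
  (forall v, is_cocycle (g v)) ->
  (forall u : C 'I_p.+2,
     is_bd (fun e => \sum_(i < p.+2) (-1) ^+ i *: g (act (lift i) u) e)) ->
  exists b : C 'I_p -> G q.+1 -> k^o,
  [/\ forall v, is_cocycle (b v), p = 0%N -> b = (fun _ _ => 0) &
     forall v, is_bd (fun e => g v e - \sum_(i < p.+1) (-1) ^+ i *: b (act (lift i) v) e)].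
Proof.
move=> ac gc bdg.
have [V [cls [clsL cls0 clsS]]] := cohomology_space k G q.
have : @is_bd k (semi_of C) V p (fun v => cls (g v)).
  case: ac => [ac|ac].
    apply: (acyclic_coefficients ac) => u.
    rewrite [LHS](esym (cls_sum _ _ clsL cls0 (fun i => gc (act (lift i) u)))).
    by apply/cls0 => //; apply: is_cocycle_sum => i; apply: gc.
  apply: (@is_bd_ext _ _ _ _ (fun=> 0)); last exact: is_bd0.
  by move=> v; apply/esym/cls0 => //; apply: ac.
case: p g ac gc bdg => [|p] g ac gc bdg /=.
  move=> g0; exists (fun _ _ => 0); split => // [v|v].
    by move=> e; rewrite (@cob0 k G k^o).
  have := proj1 (cls0 _ (gc v)) (g0 v); apply: is_bd_ext => e.
  by rewrite big1 ?subr0// => i _; rewrite scaler0.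
move=> [w gw].
have ex v : exists c, is_cocycle c /\ cls c = w v.
  by have [c c1 c2] := clsS (w v); exists c.
have [b bP] := choice ex.
exists b; split => // [v|v]; first by case: (bP v).
have c1 : is_cocycle (fun e => \sum_(i < p.+2) (-1) ^+ i *: b (act (lift i) v) e).
  by apply: is_cocycle_sum => i; case: (bP (act (lift i) v)).
apply/cls0; first exact: is_cocycleB.
have -> : (fun e => g v e - \sum_(i < p.+2) (-1) ^+ i *: b (act (lift i) v) e) =
   (fun e => -1 *: (\sum_(i < p.+2) (-1) ^+ i *: b (act (lift i) v) e) + g v e).
  by apply/funext => e; rewrite scaleN1r addrC.
rewrite clsL// (cls_sum _ _ clsL cls0 (fun i => proj1 (bP (act (lift i) v)))).
rewrite gw /cob scaleN1r addrC -sumrB big1 // => i _.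
by rewrite (proj2 (bP _)) subrr.
Qed.

(** The classes of the entry on the fibres form a cocycle of the base, because
    the entry is nearly a cocycle.  That cocycle bounds; cocycles on the fibres
    that represent the bounding cochain make up [z], and what remains of the entry
    bounds on every fibre. *)
Lemma corner_killable p q : acyclic k (semi_of C) p \/ acyclic k G q ->
  @killable D dh dv 1 p.+1 q.
Proof.
move=> ac x dx [x' [_ _ xx']].
have bdx (u : C 'I_p.+2) : @is_bd k (semi_of (hfibre f u)) k^o q (res u (dh _ _ x)).
  have -> : dh p.+1 q x = 0 - ver dv x' p.+2 q.
    by rewrite sub0r; apply/eqP; rewrite -addr_eq0 xx'.
  apply: (@is_bdB k (semi_of (hfibre f u)) k^o q (fun=> 0)); first exact: is_bd0.
  exact: ver_bd.
have exg (v : C 'I_p.+1) : exists g, is_cocycle g /\ triv (T q) v g (res v x).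
  by have [g g1 g2] := triv_base (T q) (@res_cocycle q _ x v dx); exists g.
have [g gP] := choice exg.
have bdg (u : C 'I_p.+2) :
    is_bd (fun e => \sum_(i < p.+2) (-1) ^+ i *: g (act (lift i) u) e).
  apply/(triv_bd _ _ (triv_dhor u (fun v => proj2 (gP v)))) => //.
    by apply: is_cocycle_sum => i; case: (gP (act (lift i) u)).
  exact/res_cocycle/dv_dhor.
have [b [bc b0 gb]] := base_coboundary ac (fun v => proj1 (gP v)) bdg.
have [z [dz z0 bz]] : exists z : D p q, [/\ dv _ _ z = 0, p = 0%N -> z = 0 &
    forall v : C 'I_p.+1, triv (T q) v
      (fun e => \sum_(i < p.+1) (-1) ^+ i *: b (act (lift i) v) e) (res v (dh _ _ z))].
  case: p {x dx x' xx' bdx exg g gP bdg ac gb} b bc b0 => [|p] b bc b0.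
    exists 0; split=> [|//|v]; first exact: dv00.
    rewrite dh00; have := triv_zero q v; congr triv; apply/funext => e.
    by rewrite b0// big1 // => i _; rewrite scaler0.
  have ex v : exists x, @is_cocycle k (semi_of (hfibre f v)) k^o q x /\
      triv (T q) v (b v) x.
    by have [x x1 x2] := triv_fibre (T q) v (bc v); exists x.
  pose X v := sval (cid (ex v)); have XP v := svalP (cid (ex v)).
  exists (assemble X); split => // [|v].
    by apply: assemble_cocycle => v; case: (XP v).
  by apply: triv_dhor => w; rewrite res_assemble; case: (XP w).
have xz : match q return D p.+1 q -> Prop with
    | 0%N => fun x => x = 0 | q'.+1 => fun x => exists w, x = dv _ q' w
    end (x - dh _ _ z).
  apply: assemble_bd => v; apply/(triv_bd _ _ (triv_sub (proj2 (gP v)) (bz v))).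
  - apply: is_cocycleB; first by case: (gP v).
    by apply: is_cocycle_sum => i; apply: bc.
  - apply: is_cocycleB; first exact: res_cocycle.
    exact/res_cocycle/dv_dhor.
  - exact: gb.
have [w [hw sw xw]] : exists w : tot D, [/\ below_degree (p.+1 + q)%N w,
    forall p' q', p' != p.+1 -> w p' q' = 0 & x - dh _ _ z = ver dv w p.+1 q].
  case: q x z xz {dx x' xx' bdx exg g gP bdg ac b gb bc b0 dz z0 bz} => [|q] x z.
    by move=> ->; exists (fun _ _ => 0).
  move=> [w ->]; exists (@unit_tot D p.+1 q w); split => [|p' q'|].
  - exact: (unit_tot_below (D := D) w (esym (addnS _ _))).
  - exact: (unit_tot_column (D := D)).
  - by rewrite /= unit_totE.
pose y : tot D := fun p' q' => @unit_tot D p q z p' q' + w p' q'.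
have zE p' q' : (p', q') != (p, q) -> @unit_tot D p q z p' q' = 0.
  by move=> pq; rewrite unit_tot0// eq_sym.
have sy : supported (maxn 1 p) y.
  move=> p' q' pp; rewrite /y sw ?addr0; last by apply/eqP; lia.
  have [[ep eq]|//] := eqVneq (p', q') (p, q); last exact: zE.
  by rewrite z0 ?unit_tot_zero//; lia.
exists y; split => //.
- move=> p' q' pq; rewrite /y hw// zE ?addr0//.
  by apply: contra pq => /eqP[-> ->].
- move=> p' q' pp; rewrite /tdiff (@hor0 D dh dhB' p) ?add0r//; last first.
    by apply: supported_le sy; rewrite leq_maxr.
  case: q' => [|q'] //=; rewrite /y sw ?addr0; last by apply/eqP; lia.
  have [[-> ->]|pq] := eqVneq (p', q') (p, q); first by rewrite unit_totE.
  by rewrite zE// dv00.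
rewrite /tdiff /= {1}/y unit_totE sw ?addr0; last by apply/eqP; lia.
have -> : ver dv y p.+1 q = ver dv w p.+1 q.
  apply: (@ver_eq D dv) => q'; rewrite /y zE ?add0r//.
  by apply/eqP => -[e _]; lia.
by rewrite -xw addrC subrK.
Qed.

Let rows_exact N (x : tot D) : of_degree N x -> (forall p q, tdf x p q = 0) ->
  exists y, [/\ below_degree N y & forall p q, x p q = tdf y p q].
Proof.
move=> hx dx.
have [||y [hy _ xy]] := @exact_rows D dh dv dhB' dvB' dhdh' dvdv' dhdv' 0 N x _ hx _ dx.
- by move=> q _; apply: (@row_exact A C f k q.+1).
- by [].
by exists y.
Qed.

Let total_kill N P (x : tot D) : (0 < P)%N ->
  (forall p, (P <= p.+1 <= N)%N ->
     acyclic k (semi_of C) p \/ acyclic k G (N - p.+1)%N) ->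
  of_degree N x -> supported P x -> (forall p q, tdf x p q = 0) ->
  exists y, [/\ below_degree N y, supported (maxn 1 P.-1) y &
    forall p q, x p q = tdf y p q].
Proof.
move=> P0 ac hx sx dx; apply: (@kill_all D dh dv dhB' dvB' dhdh' dvdv' dhdv') => //.
by move=> [|p] pN; [lia | apply: corner_killable; apply: ac].
Qed.

(** All the terms of the second page on the antidiagonal vanish, so that a cocycle
    can be removed column by column. *)
Lemma total_acyclic N :
  (forall p q, (p + q)%N = N -> acyclic k (semi_of C) p \/ acyclic k G q) ->
  acyclic k (semi_of A) N.
Proof.
move=> ac a da.
pose al : D 0%N N := fun e => a (sval e).2.
pose u := @unit_tot D 0 N al.
have hu : below_degree N.+1 u by exact: unit_tot_below.
have dal : dv _ _ al = 0.
  apply/funext => e; rewrite [e]kcar0l /= dver_embA; exact: da.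
have su : supported 1 (tdf u).
  move=> [|//] q _; rewrite /tdiff /= add0r; case: q => [|q] //=.
  have [->|qN] := eqVneq q N; first by rewrite /u unit_totE.
  by rewrite /u unit_tot0 ?dv00//; apply: contra qN => /eqP[->].
have [||p q|y [hy sy uy]] := @total_kill N.+1 1 (tdf u) _ _ (tdf_degree hu) su.
- by [].
- by move=> p /andP[_ pN]; apply: ac; lia.
- exact: tdf2.
have hx : of_degree N (tsub u y).
  by apply: of_degreeB => p q pq; [apply: hu | apply: hy]; rewrite eqSS.
have [|z [hz xz]] := rows_exact hx; first by move=> p q; rewrite tdfB -uy subrr.
have az t : a t = ver dv z 0 N (embA f t).
  have := congr1 (fun y : D 0%N N => y (embA f t)) (xz 0%N N).
  rewrite /tsub sy ?leq_max// subr0 /u unit_totE /tdiff add0r.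
  exact.
suff bd M (c : A 'I_M.+1 -> k^o) : (forall t, c t = ver dv z 0 M (embA f t)) ->
  @is_bd k (semi_of A) k^o M c by exact: bd az.
case: M c => [|M] c cz; first by move=> t; rewrite cz.
by exists (fun t => z 0%N M (embA f t)) => t; rewrite cz /=; exact: dver_embA.
Qed.

(** If the leading term is horizontally exact modulo vertical coboundaries, its
    classes are a coboundary of the base. *)
Lemma base_boundary m n (V : lmodType k) (cls : (G n.+1 -> k^o) -> V)
    (g : C 'I_m.+1 -> G n.+1 -> k^o) (xi : D m.+1 n) (ze : D m n) :
  (forall a c c', is_cocycle c -> is_cocycle c' ->
     cls (fun e => a *: c e + c' e) = a *: cls c + cls c') ->
  (forall c, is_cocycle c -> (cls c = 0 <-> is_bd c)) ->
  (forall v, is_cocycle (g v)) -> (forall v, triv (T n) v (g v) (res v xi)) ->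
  dv _ _ xi = 0 -> dv _ _ ze = 0 -> (m = 0%N -> ze = 0) ->
  (forall v, @is_bd k (semi_of (hfibre f v)) k^o n (res v (xi - dh _ _ ze))) ->
  @is_bd k (semi_of C) V m (fun v => cls (g v)).
Proof.
move=> clsL cls0 gc gx dx dz.
case: m g xi ze gc gx dx dz => [|m] g xi ze gc gx dx dz z0 bx /=.
  move=> v; apply/cls0 => //; apply/(triv_bd _ _ (gx v)) => //.
    exact: res_cocycle.
  by have := bx v; rewrite z0// dh00 subr0.
have ex v : exists b, is_cocycle b /\ triv (T n) v b (res v ze).
  by have [b b1 b2] := triv_base (T n) (@res_cocycle n _ ze v dz); exists b.
have [b bP] := choice ex.
have c1 v : is_cocycle (fun e => \sum_(i < m.+2) (-1) ^+ i *: b (act (lift i) v) e).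
  by apply: is_cocycle_sum => i; case: (bP (act (lift i) v)).
exists (fun v => cls (b v)) => v.
rewrite [RHS](esym (cls_sum _ _ clsL cls0 (fun i => proj1 (bP (act (lift i) v))))).
apply/eqP; rewrite -subr_eq0; apply/eqP.
rewrite addrC -scaleN1r -clsL//; apply/cls0; first exact: is_cocycleP.
have := triv_sub (gx v) (triv_dhor v (fun w => proj2 (bP w))).
move=> /triv_bd[||_ bd].
- exact: is_cocycleB.
- apply: is_cocycleB; apply: res_cocycle => //; exact: dv_dhor.
by have := bd (bx v); apply: is_bd_ext => e; rewrite scaleN1r addrC.
Qed.

(** No differential enters or leaves the corner that is occupied by a top class of
    the base and a top class of the fibre, so that their product survives. *)
Lemma total_corner m n :
  ~ acyclic k (semi_of C) m -> ~ acyclic k G n ->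
  (forall p, (m < p)%N -> acyclic k (semi_of C) p) ->
  (forall q, (n < q)%N -> acyclic k G q) ->
  ~ acyclic k (semi_of A) (m + n)%N.
Proof.
move=> nC nG acC acG acA.
have [phi dphi nphi] := not_acyclic nC.
have [g0 dg0 ng0] := not_acyclic nG.
have exX (v : C 'I_m.+1) : exists x, @is_cocycle k (semi_of (hfibre f v)) k^o n x /\
    triv (T n) v g0 x.
  by have [x x1 x2] := triv_fibre (T n) v dg0; exists x.
pose X v := sval (cid (exX v)); have XP v := svalP (cid (exX v)).
pose xi : D m.+1 n := assemble (fun v e => phi v *: X v e).
have dxi : dv _ _ xi = 0.
  apply: assemble_cocycle => v e; rewrite cobZ (proj1 (XP v)); exact: scaler0.
have txi v : triv (T n) v (fun e => phi v *: g0 e) (res v xi).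
  by rewrite res_assemble; apply: triv_scale; case: (XP v).
have bdxi (u : C 'I_m.+2) : @is_bd k (semi_of (hfibre f u)) k^o n (res u (dh _ _ xi)).
  have z0 : (fun e => \sum_(i < m.+2) (-1) ^+ i *: (phi (act (lift i) u) *: g0 e)) =
      (fun=> 0 : k^o).
    apply/funext => e; under eq_bigr do rewrite scalerA.
    rewrite -scaler_suml -[X in X *: _](_ : @cob k (semi_of C) k^o m.+1 phi u = _).
      by rewrite dphi scale0r.
    by [].
  have := triv_dhor u txi; rewrite z0 => tu.
  apply/(triv_bd _ _ tu).
  - by move=> e; rewrite (@cob0 k G k^o).
  - exact/res_cocycle/dv_dhor.
  - exact: is_bd0.
(* The corner [xi] is a cocycle up to coboundaries on the fibres; the correction
   [w] in the next column makes it one up to column [m.+3]. *)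
pose M := (m.+1 + n)%N.
have [w [hw sw xw]] : exists w : tot D, [/\ of_degree M w,
    forall p' q', p' != m.+2 -> w p' q' = 0 & dh _ _ xi = ver dv w m.+2 n].
  have := assemble_bd bdxi; rewrite /M.
  case: (n) (dh _ _ xi) => [|n'] y /=; first by move=> ->; exists (fun _ _ => 0).
  move=> [w ->]; exists (@unit_tot D m.+2 n' w); split => [|p' q'|].
  - by rewrite addnS; exact: (@unit_tot_degree D m.+2 n' w).
  - exact: (unit_tot_column (D := D)).
  - by rewrite unit_totE.
pose x1 := tsub (@unit_tot D m.+1 n xi) w.
have hx1 : of_degree M x1.
  by apply: of_degreeB => //; exact: unit_tot_degree.
have sx1 : supported m.+1 x1.
  move=> p q pm; rewrite /x1 /tsub sw ?subr0; last by apply/eqP; lia.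
  by rewrite unit_tot_column//; apply/eqP; lia.
have x1E : x1 m.+1 n = xi.
  by rewrite /x1 /tsub unit_totE sw ?subr0//; apply/eqP; lia.
have sdx1 : supported m.+3 (tdf x1).
  move=> p q pm; have [pq|pq] := eqVneq (p + q)%N M.+1; last first.
    by rewrite (@tdf_degree M.+1).
  have [pm1|pm1] := ltnP p m.+1; first exact: (supported_tdiff dhB' dvB' sx1).
  rewrite /tdiff; have [pm2|pm2] := ltnP p m.+2.
    have ep : p = m.+1 by lia.
    have eq : q = n.+1 by rewrite /M in pq; lia.
    by subst p q; rewrite (@hor0 D dh dhB' m.+1)// add0r /= x1E.
  have ep : p = m.+2 by lia.
  have eq : q = n by rewrite /M in pq; lia.
  subst p q; rewrite /= x1E xw (_ : ver dv x1 m.+2 n = ver dv (fun p q => 0 - w p q) m.+2 n).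
    case: (n) => [|n'] /=; first by rewrite addr0.
    by rewrite dvB' dv00 sub0r subrr.
  apply: (@ver_eq D dv) => q; rewrite /x1 /tsub unit_tot_column//.
  by apply/eqP; lia.
(* The remaining defect lies over dimensions in which the base has no cohomology,
   and can be removed without changing the corner. *)
have [||p q|y [hy sy x1y]] := @total_kill M.+1 m.+3 (tdf x1) _ _ (@tdf_degree M.+1 _ hx1) sdx1.
- by [].
- by move=> p pM; left; apply: acC; lia.
- exact: tdf2.
pose x := tsub x1 y.
have hx : of_degree M x by apply: of_degreeB.
have dx p q : tdf x p q = 0 by rewrite tdfB x1y subrr.
have sx : supported m.+1 x.
  by apply: supportedB => //; apply: supported_le sy; lia.
have xE : x m.+1 n = xi by rewrite /x /tsub x1E sy ?subr0//; lia.
(* The rows are exact, so that the cocycle bounds; the primitive starts on the edge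
   of [A] with a cocycle, which bounds by assumption. *)
have [z [hz xz]] := rows_exact hx dx.
pose a (t : A 'I_(m + n).+1) : k^o := z 0%N (m + n)%N (embA f t).
have da : @is_cocycle k (semi_of A) k^o (m + n) a.
  move=> t; have := dver_embA (z 0%N (m + n)%N) t => <-.
  have := xz 0%N (m + n).+1; rewrite sx//= /tdiff add0r => e.
  by have := congr1 (fun y : D 0%N (m + n).+1 => y (embA f t)) e.
have [W [hW sW zW]] : exists W : tot D, [/\ below_degree (m + n)%N W,
    forall p q, p != 0%N -> W p q = 0 & z 0%N (m + n)%N = ver dv W 0 (m + n)%N].
  have := acA a da; rewrite /a.
  case: (m + n)%N (z 0%N) => [|N] z0 /=.
    move=> h; exists (fun _ _ => 0); split => //.
    by apply/funext => e; rewrite [e]kcar0l h.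
  move=> [w0 h]; pose w1 : D 0%N N := fun e => w0 (sval e).2.
  exists (@unit_tot D 0 N w1); split => [|p q|].
  - exact: (unit_tot_below (D := D)).
  - exact: (unit_tot_column (D := D)).
  - rewrite unit_totE; apply/funext => e.
    by rewrite [e]kcar0l h; have -> := dver_embA w1 (sval e).2.
pose Z := tsub z (tdf W).
have hZ : of_degree (m + n)%N Z by apply: of_degreeB => //; apply: tdf_degree.
have sZ : supported 1 Z.
  move=> [|//] q _; have [->|qN] := eqVneq q (m + n)%N; last by rewrite hZ.
  by rewrite /Z /tsub /tdiff /= add0r zW subrr.
have dZ p q : tdf Z p q = x p q by rewrite tdfB tdf2 subr0 xz.
(* In the columns before the corner the fibre has no cohomology, so that the
   primitive can be moved to column [m]: it exhibits the corner as horizontally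
   exact. *)
have [Z' [sZ' dZ']] : exists Z', supported (maxn 1 m) Z' /\ forall p q, tdf Z' p q = x p q.
  have [m0|m0] := posnP m; first by exists Z; rewrite m0.
  have [|||y' [hy' sy' Zy]] := @kill_range D dh dv dhB' dvB' dhdh' dvdv' dhdv' 1 (m + n)%N 1 m.-1 Z _ _ hZ sZ.
  - by [].
  - move=> [|p] pm pN; first by lia.
    by apply: corner_killable; right; apply: acG; lia.
  - by move=> p q pm; rewrite dZ sx//; lia.
  exists (tsub Z (tdf y')); split; last by move=> p q; rewrite tdfB tdf2 subr0 dZ.
  by apply: supported_le Zy; lia.
pose ze := Z' m n.
have ze0 : m = 0%N -> ze = 0 by move=> m0; rewrite /ze sZ'//; lia.
have dze : dv _ _ ze = 0.
  have := dZ' m n.+1; rewrite sx// /tdiff (@hor0 D dh dhB' m) ?add0r//.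
  by apply: supported_le sZ'; rewrite leq_maxr.
have xize : xi - dh _ _ ze = ver dv Z' m.+1 n.
  by rewrite -xE -dZ' /tdiff /= addrC addKr.
have [V [cls [clsL cls0 clsS]]] := cohomology_space k G n.
have c00 : @is_cocycle k G k^o n (fun=> 0) by move=> e; rewrite (@cob0 k G k^o).
have clsZ c : cls (fun e => c *: g0 e) = c *: cls g0.
  have := clsL c _ _ dg0 c00; rewrite (proj2 (cls0 _ c00) (is_bd0 _ _ _)) addr0 => <-.
  by congr cls; apply/funext => e; rewrite addr0.
have dcg0 c : is_cocycle (fun e => c *: g0 e).
  by move=> e; rewrite cobZ dg0; exact: scaler0.
have clsg0 : cls g0 != 0 by apply/eqP => /cls0 => /(_ dg0).
have [l [lL lg0]] := functional_at clsg0.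
suff : @is_bd k (semi_of C) V m (fun v => phi v *: cls g0).
  move=> h; apply: nphi; case: m phi {nC acC acA dphi exX X XP xi dxi txi bdxi M w hw sw xw x1 hx1 sx1 x1E sdx1 y hy sy x1y x hx dx sx xE z hz xz a da W hW sW zW Z hZ sZ dZ Z' sZ' dZ' ze ze0 dze xize} h => [|m] phi /=.
    move=> h v; have /eqP := h v.
    by rewrite scaler_eq0 (negPf clsg0) orbF => /eqP.
  move=> [b hb]; exists (fun v => l (b v)) => v.
  rewrite (cob_lin lL) -hb -[phi v *: _]addr0 lL (lin0 lL) addr0 lg0.
  by rewrite -[RHS]/(phi v * 1) mulr1.
have -> : (fun v => phi v *: cls g0) = (fun v => cls (fun e => phi v *: g0 e)).
  by apply/funext => v; rewrite clsZ.
apply: base_boundary clsL cls0 _ txi dxi dze ze0 _ => // v.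
by rewrite xize; apply: ver_bd.
Qed.

End Corner.

(** * Kan fibrations *)

Lemma lift_swap n (x : 'I_n.+2 * 'I_n.+1) (q : 'I_n) :
  lift x.1 (lift x.2 q) = lift (ord_swap x).1 (lift (ord_swap x).2 q).
Proof. by case: n x q => [x []//|n x q]; apply: lift_ord_swap. Qed.

(** A section of a simplicial set over a subcomplex of a simplex, given by its
    values on the simplices of a covering family. *)
Definition compatible_family (X : sset) (I : finType) (J : Type) (T : J -> finType)
    (iota : forall a, T a -> I) (x : forall a, X (T a)) :=
  forall a b (L : finType) (al : L -> T a) (be : L -> T b),
    iota a \o al = iota b \o be -> act al (x a) = act be (x b).

Section Kan.
Variables (X Y : sset) (f : smap X Y).

(** Horns are indexed by their apex [a]; the face opposite to [i] is
    parametrised by the subtype of the other vertices. *)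
Definition kan := forall (I : finType) (a : I) (x : forall i : {i : I | i != a},
    X {j : I | j != val i}) (y : Y I),
  (exists i : I, i != a) ->
  @compatible_family X I _ (fun i : {i : I | i != a} => {j : I | j != val i})
    (fun _ => val) x ->
  (forall i, sfun f (x i) = act val y) ->
  exists2 z : X I, sfun f z = y & forall i, act val z = x i.

Definition covered (I : finType) (J : Type) (T : J -> finType)
    (iota : forall a, T a -> I) (S : {set I}) :=
  exists a, forall i, i \in S -> exists l, iota a l = i.

(** A Kan fibration lifts along the inclusion of any subcomplex that is a cone
    with apex [a0], by filling horns with apex [a0] in order of dimension. *)
Lemma kan_cone : kan -> forall (I : finType) (a0 : I) (J : Type) (T : J -> finType)
    (iota : forall a, T a -> I) (x : forall a, X (T a)) (y : Y I),
  inhabited J -> compatible_family iota x ->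
  (forall a, sfun f (x a) = act (iota a) y) ->
  (forall a, exists b, (forall l, exists l', iota b l' = iota a l) /\
     exists l', iota b l' = a0) ->
  exists2 z : X I, sfun f z = y & forall a, act (iota a) z = x a.
Proof.
move=> kf I a0.
have [n] := ubnP #|{set I}|; move: n => n.
suff H m : forall J (T : J -> finType) (iota : forall a, T a -> I)
    (x : forall a, X (T a)) (y : Y I),
  (#|[set S : {set I} | ~~ `[< covered iota S >]]%SET| < m)%N ->
  inhabited J -> compatible_family iota x ->
  (forall a, sfun f (x a) = act (iota a) y) ->
  (forall a, exists b, (forall l, exists l', iota b l' = iota a l) /\
     exists l', iota b l' = a0) ->
  exists2 z : X I, sfun f z = y & forall a, act (iota a) z = x a.
  by move=> _ J T iota x y; apply: H (ltnSn _).
elim: m => [//|m IH] J T iota x y unc [a1] cx fx cone.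
have [[a /= sa]|nT] := pselect (covered iota [set: I]).
  have [ga gaP] := choice (fun i => sa i (finset.in_setT i)).
  exists (act ga (x a)).
    rewrite sfun_act fx act_comp -[RHS]act_id; congr act.
    by apply/funext => i /=.
  move=> b; rewrite act_comp -[RHS]act_id; apply: cx.
  by apply/funext => l /=.
have nT' : ~~ `[< covered iota [set: I] >] by apply/asboolP.
(* The set [S] is a minimal set of vertices that lies in no member of the family.
   Adding the apex to a proper subset of [S] gives a covered set, so that the
   family is defined on a horn of the simplex on [S] and the apex. *)
case: (@arg_minnP _ [set: I]%SET (fun S => ~~ `[< covered iota S >]) (fun S => #|S|) nT').
move=> S /asboolP nS minS.
have cov_lt (S' : {set I}) : (#|S'| < #|S|)%N -> covered iota S'.
  move=> lt; apply: contrapT => ns; move: lt; rewrite ltnNge minS//.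
  exact/asboolP.
have cov_cone (S' : {set I}) : covered iota S' -> covered iota (a0 |: S').
  move=> [a sa]; have [b [ab [l' bl']]] := cone a; exists b => i.
  rewrite finset.in_setU1 => /orP[/eqP ->|iS]; first by exists l'.
  by have [l <-] := sa i iS; apply: ab.
have a0S : a0 \notin S.
  apply/negP => a0S; apply: nS; rewrite -(finset.setD1K a0S); apply: cov_cone.
  by apply: cov_lt; rewrite [X in (_ < X)%N](cardsD1 a0) a0S.
have covS i : i \in S -> covered iota (a0 |: S :\ i).
  move=> iS; apply/cov_cone/cov_lt.
  by rewrite [X in (_ < X)%N](cardsD1 i) iS.
pose I' : finType := {j : I | j \in a0 |: S}.
pose a0' : I' := exist _ a0 (finset.setU11 a0 S).
have ex (i : {i : I' | i != a0'}) : exists bg : {b : J & {j : I' | j != val i} -> T b},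
    forall j, iota (projT1 bg) (projT2 bg j) = val (val j).
  have iS : val (val i) \in S.
    have := valP (val i); rewrite finset.in_setU1 => /orP[/eqP e|//].
    by have := valP i; rewrite -(inj_eq val_inj) /= e eqxx.
  have [b bP] := covS _ iS.
  have ex' (j : {j : I' | j != val i}) : exists l, iota b l = val (val j).
    apply: bP; have := valP j; rewrite -(inj_eq val_inj) => ji.
    by have := valP (val j); rewrite !inE => /orP[->//|->]; rewrite ji orbT.
  have [ga gaP] := choice ex'.
  by exists (existT _ b ga).
pose bg i := sval (cid (ex i)).
have bgP i j : iota (projT1 (bg i)) (projT2 (bg i) j) = val (val j) := svalP (cid (ex i)) j.
have [||i|z fz xz] := kf I' a0' (fun i => act (projT2 (bg i)) (x (projT1 (bg i)))) (act val y).
- have [i iS] : exists i, i \in S.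
    by apply/finset.set0Pn/eqP => S0; apply: nS; exists a1 => i; rewrite S0 inE.
  exists (exist _ i (finset.setU1r a0 iS)); rewrite -(inj_eq val_inj) /=.
  by apply: contraNneq a0S => <-.
- move=> i i' L al be e; rewrite !act_comp; apply: cx; apply/funext => l /=.
  by rewrite !bgP; have /= -> := congr1 (@^~ l) e.
- rewrite sfun_act fx !act_comp; congr act; apply/funext => j /=.
  by rewrite bgP.
(* The filled simplex joins the family, which leaves fewer uncovered sets. *)
pose T' (o : option J) : finType := if o is Some a then T a else I'.
pose iota' (o : option J) : T' o -> I :=
  match o return T' o -> I with Some a => @iota a | None => val end.
pose x' (o : option J) : X (T' o) :=
  match o return X (T' o) with Some a => x a | None => z end.
have sepx a (L : finType) (al : L -> I') (be : L -> T a) :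
    val \o al = iota a \o be -> act al z = act be (x a).
  move=> e.
  have [i [iS ia]] : exists i, i \in S /\ forall l, val (al l) != i.
    apply: contrapT => h; apply: nS; exists a => i iS.
    apply: contrapT => h'; apply: h; exists i; split => // l.
    apply/eqP => ali; apply: h'; exists (be l).
    by rewrite -ali; have /= -> := congr1 (@^~ l) e.
  pose ipt : I' := exist _ i (finset.setU1r a0 iS).
  have ia0 : ipt != a0'.
    by rewrite -(inj_eq val_inj) /=; apply: contraNneq a0S => <-.
  pose ii : {i : I' | i != a0'} := exist (fun i : I' => i != a0') ipt ia0.
  have ali l : al l != val ii by rewrite -(inj_eq val_inj) /= ia.
  pose al' l : {j : I' | j != val ii} :=
    exist (fun j : I' => j != val ii) (al l) (ali l).
  have -> : al = val \o al' by [].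
  rewrite -act_comp (xz ii) act_comp; apply: cx.
  by apply/funext => l /=; rewrite bgP /=; have /= -> := congr1 (@^~ l) e.
have [||o o' L al be e|o|o|z' fz' xz'] := IH (option J) T' iota' x' y.
- rewrite -ltnS; apply: leq_trans unc; apply: fintype.proper_card.
  apply/fintype.properP; split.
    apply/fintype.subsetP => S'; rewrite !inE; apply: contra => /asboolP[a sa].
    by apply/asboolP; exists (Some a).
  exists S; rewrite !inE; first by apply/asboolP.
  rewrite negbK; apply/asboolP; exists None => i iS.
  by exists (exist _ i (finset.setU1r a0 iS)).
- exact: (inhabits None).
- case: o al e => [a|] al e; case: o' be e => [b|] be e /=.
  + exact: cx.
  + by apply/esym/sepx.
  + exact: sepx.
  + congr act; apply/funext => l; apply: val_inj.
    by have := congr1 (@^~ l) e.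
- by case: o => [a|] /=; [apply: fx | apply: fz].
- case: o => [a|].
    by have [b [h1 h2]] := cone a; exists (Some b).
  by exists None; split; [move=> l; exists l | exists a0'].
by exists z' => // a; apply: (xz' (Some a)).
Qed.

End Kan.

(** ** Merging the apex of a cone into a vertex *)

Definition merge_apex (I : Type) (i0 : I) n (x : I + 'I_n.+1) : I + 'I_n :=
  match x with
  | inl i => inl i
  | inr j => if unlift ord0 j is Some j' then inr j' else inl i0
  end.

Arguments merge_apex {I} i0 {n} x.

Lemma merge_apex_lift (I : Type) (i0 : I) n (j : 'I_n.+1) :
  joinmap id (lift j) \o @merge_apex I i0 n =
  @merge_apex I i0 n.+1 \o joinmap id (lift (lift ord0 j)).
Proof.
apply/funext => -[i|l] //=; case: (unliftP ord0 l) => [l'|] -> /=.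
  have -> : lift (lift ord0 j) (lift ord0 l') = lift ord0 (lift j l').
    by apply: val_inj; rewrite /= /bump /=; lia.
  by rewrite liftK.
have -> : lift (lift ord0 j) ord0 = ord0 by apply: val_inj.
by rewrite unlift_none.
Qed.

Lemma merge_apex0 (I : Type) (i0 : I) n : @merge_apex I i0 n \o joinmap id (lift ord0) = id.
Proof. by apply/funext => -[i|l] //=; rewrite liftK. Qed.

(** ** Trivial fibrations *)

Definition triv_fib (A C : sset) (f : smap A C) :=
  forall n (w : 'I_n.+1 -> A 'I_n) (c : C 'I_n.+1),
  @compatible (semi_of A) n w ->
  (forall i, sfun f (w i) = act (lift i) c) ->
  exists2 a : A 'I_n.+1, sfun f a = c & forall i, act (lift i) a = w i.

Section TrivialFibration.
Variables (A C : sset) (f : smap A C).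
Hypothesis tf : triv_fib f.

(** The simplex of the base is coned off degenerately, onto the vertex [i0] of
    its front face; the cone is lifted by hypothesis. *)
Lemma triv_fib_cone (I : finType) (i0 : I) : exists h, @is_cone (vsemi f I) h.
Proof.
pose kap n : I + 'I_n.+1 -> I + 'I_n := merge_apex i0.
have kap_lift n (j : 'I_n.+1) := merge_apex_lift i0 j.
have kap0 n : @kap n \o joinmap id (lift ord0) = id by exact: merge_apex0.
apply: (@cone_by_filling (vsemi f I) (fun n (e : kcar f I 'I_n) (w : kcar f I 'I_n.+1) =>
  (sval w).1 = act (@kap n) (sval e).1)) => n e W W0 cW aW.
have W1 (i : 'I_n.+1) : (sval (W i)).1 = act (joinmap id (lift i)) (act (@kap n) (sval e).1).
  case: (unliftP ord0 i) => [j|] ->; last by rewrite W0 act_comp kap0 act_id.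
  case: n e W W0 cW aW i j => [|n] e W W0 cW aW i j; first by case: j.
  by rewrite aW /= !act_comp kap_lift.
have [||a fa aw] := tf (w := fun i => (sval (W i)).2) (c := act inr (act (@kap n) (sval e).1)).
- case: n e W W0 cW aW W1 => [//|n] e W W0 cW aW W1 x.
  by have /(congr1 (fun y => (sval y).2)) := cW x.
- by move=> i; rewrite -(proj2_sig (W i)) W1 !act_comp.
exists (exist _ (act (@kap n) (sval e).1, a) (esym fa)); split => // i.
by apply: kcar_eq => /=; rewrite ?W1 ?aw.
Qed.

Lemma triv_fib_exact (k : fieldType) p : @exact_semi k (vsemi f 'I_p.+1) k^o.
Proof. by have [h /cone_exact] := @triv_fib_cone 'I_p.+1 ord0; apply. Qed.

End TrivialFibration.

(** The faces of the second half of a join, in the form required for filling. *)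
Lemma join_faces (X : sset) (I : finType) n (s : 'I_n.+1 -> X (I + 'I_n)%type) :
  match n return ('I_n.+1 -> X (I + 'I_n)%type) -> Prop with
  | 0%N => fun _ => True
  | n'.+1 => fun s => forall x : 'I_n'.+2 * 'I_n'.+1,
      act (joinmap id (lift x.2)) (s x.1) =
      act (joinmap id (lift (ord_swap x).2)) (s (ord_swap x).1)
  end s ->
  compatible_family (fun i : 'I_n.+1 => joinmap id (lift i)) s.
Proof.
have inj m (i : 'I_m.+1) : injective (@joinmap I I 'I_m.+1 'I_m id (lift i)).
  by apply: joinmap_inj => //; exact: lift_inj.
move=> cs i i' L al be e; have [ii|ii] := eqVneq i i'.
  subst i'; congr act; apply/funext => l; apply: (inj n i).
  exact: (congr1 (@^~ l) e).
case: n s cs i i' al be e ii => [|n] s cs i i' al be e ii.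
  by case/eqP: ii; rewrite [i]ord1 [i']ord1.
have [j ej] : exists j, i' = lift i j.
  by case: (unliftP i i') ii => [j ->|->]; [exists j | rewrite eqxx].
have ex l : exists c, al l = joinmap id (lift j) c.
  have := congr1 (@^~ l) e => /=; case: (al l) => [a _|b]; first by exists (inl a).
  case: (be l) => [//|b'] /= [bb']; case: (unliftP j b) => [c ->|bj].
    by exists (inr c).
  have e' : lift i' b' = i' by apply: val_inj; rewrite /= -bb' bj ej.
  by have := neq_lift i' b'; rewrite e' eqxx.
have [ga gaP] := choice ex.
have -> : al = joinmap id (lift j) \o ga by apply/funext.
have i'E : (ord_swap (i, j)).1 = i' by rewrite ej.
have -> : be = joinmap id (lift (ord_swap (i, j)).2) \o ga.
  apply/funext => l; apply: (inj n.+1 i'); rewrite -[LHS](congr1 (@^~ l) e) /= gaP.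
  case: (ga l) => [//|c] /=; congr inr.
  by rewrite (lift_swap (i, j) c : lift i (lift j c) = _) i'E.
by rewrite -[LHS]act_comp -[RHS]act_comp (cs (i, j)) i'E.
Qed.

(** * Base change between the fibres over a Kan complex *)

Lemma inr_inj (S T : Type) : injective (@inr S T).
Proof. by move=> x y []. Qed.

Definition point_sset : sset :=
  @SSet (fun _ => unit) (fun _ _ _ _ => tt) (fun _ x => let: tt := x in erefl)
    (fun _ _ _ _ _ _ => erefl) tt (fun x => let: tt := x in erefl).

Definition to_point (C : sset) : smap C point_sset :=
  @SMap C point_sset (fun _ _ => tt) (fun _ _ _ _ => erefl).

Definition kan_complex (C : sset) := kan (to_point C).

Lemma kan_complex_cone (C : sset) : kan_complex C ->
  forall (I : finType) (a0 : I) (J : Type) (T : J -> finType)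
    (iota : forall a, T a -> I) (x : forall a, C (T a)),
  inhabited J -> compatible_family iota x ->
  (forall a, exists b, (forall l, exists l', iota b l' = iota a l) /\
     exists l', iota b l' = a0) ->
  exists z : C I, forall a, act (iota a) z = x a.
Proof.
move=> kC I a0 J T iota x iJ cx cone.
by have [z _ zP] := kan_cone kC (y := tt) iJ cx (fun _ => erefl) cone; exists z.
Qed.

Section BaseChange.
Variables (A C : sset) (f : smap A C).
Hypothesis kC : kan_complex C.

(** Restricting the base simplex to a face does not change the homotopy type of
    the fibre: the missing vertices are filled in by a cone. *)
Lemma hfibre_triv_fib (I I' : finType) (th : I' -> I) (v : C I) (u : C I')
    (h : act th v = u) : inhabited I' -> injective th -> triv_fib (hfibre_smap f h).
Proof.
move=> [i0] thi n w c cw fw.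
have cfw : compatible_family (fun i : 'I_n.+1 => joinmap id (lift i))
    (fun i => (sval (sval (w i))).1).
  apply: join_faces; case: n w c cw fw => [//|n] w c cw fw y.
  by have /(congr1 (fun y => (sval (sval y)).1)) := cw y.
pose T (o : option 'I_n.+1) : finType :=
  if o is Some _ then (I + 'I_n)%type : finType else (I' + 'I_n.+1)%type : finType.
pose iota (o : option 'I_n.+1) : T o -> (I + 'I_n.+1)%type :=
  match o return T o -> (I + 'I_n.+1)%type with
  | Some i => joinmap id (lift i) | None => joinmap th id end.
pose x (o : option 'I_n.+1) : C (T o) := match o return C (T o) with
  | Some i => (sval (sval (w i))).1 | None => (sval (sval c)).1 end.
have wc i : act (joinmap th id) (x (Some i)) = act (joinmap id (lift i)) (x None).
  exact: (congr1 (fun y => (sval (sval y)).1) (fw i)).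
have thi' : injective (joinmap th (@id 'I_n)).
  exact: joinmap_inj.
have jl (i : 'I_n.+1) : injective (@joinmap I I 'I_n.+1 'I_n id (lift i)).
  by apply: joinmap_inj => //; exact: lift_inj.
have sep (i : 'I_n.+1) (L : finType) (al : L -> (I + 'I_n)%type) (be : L -> (I' + 'I_n.+1)%type) :
    joinmap id (lift i) \o al = joinmap th id \o be ->
    act al (x (Some i)) = act be (x None).
  move=> e.
  have ex l : exists c, be l = joinmap id (lift i) c.
    have := congr1 (@^~ l) e => /=; case: (al l) (be l) => [a|a] [b|b] //= eb.
      by exists (inl b).
    by exists (inr a); rewrite /= (inr_inj eb).
  have [ga gaP] := choice ex.
  have -> : be = joinmap id (lift i) \o ga by apply/funext.
  rewrite -[RHS]act_comp -wc act_comp; congr act; apply/funext => l; apply: (jl i).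
  have /= -> := congr1 (@^~ l) e; rewrite gaP.
  by case: (ga l).
have [|o|s sP] := @kan_complex_cone C kC _ (inl (th i0)) _ T iota x (inhabits None).
- move=> [i|] [j|] L al be e.
  + exact: cfw.
  + exact: sep.
  + by apply/esym/sep.
  + congr act; apply/funext => l; have := congr1 (@^~ l) e => /=.
    by case: (al l) (be l) => [a|a] [b|b] //=; [case=> /thi -> | case=> ->].
- exists o; split; first by move=> l; exists l.
  by case: o => [i|]; [exists (inl (th i0)) | exists (inl i0)].
have bs : act inr s = sfun f (sval (sval c)).2.
  rewrite -(proj2_sig (sval c)).
  by have /= <- := sP None; rewrite act_comp.
have fs : act inl s = v.
  by have /= e := sP (Some ord0); have := proj2_sig (w ord0); rewrite /front -e act_comp.
exists (exist _ (exist _ (s, (sval (sval c)).2) bs) fs).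
  apply: hfibre_eq; apply: kcar_eq; rewrite /= ?act_id//.
  by have /= := sP None.
move=> i; apply: hfibre_eq; apply: kcar_eq => /=; first by have /= := sP (Some i).
by have /(congr1 (fun y => (sval (sval y)).2)) /= := fw i; rewrite act_id.
Qed.

Variable k : fieldType.

Definition hpull (I I' J : finType) (th : I' -> I) (v : C I) (u : C I')
  (h : act th v = u) (x : hfibre f u J -> k^o) : hfibre f v J -> k^o :=
  fun e => x (hfibre_map h e).

Lemma cob_hpull (I I' : finType) n (th : I' -> I) (v : C I) (u : C I')
    (h : act th v = u) (x : hfibre f u 'I_n -> k^o) e :
  @cob k (semi_of (hfibre f v)) k^o n (hpull h x) e =
  @cob k (semi_of (hfibre f u)) k^o n x (hfibre_map h e).
Proof.
by rewrite /cob; apply: eq_bigr => i _; rewrite /hpull /= hfibre_map_act.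
Qed.

Lemma hpull_comp (I I' I'' J : finType) (th : I' -> I) (th' : I'' -> I') (v : C I)
    (u : C I') (t : C I'') (h : act th v = u) (h' : act th' u = t)
    (h'' : act (th \o th') v = t) (x : hfibre f t J -> k^o) :
  hpull h (hpull h' x) = hpull h'' x.
Proof.
apply/funext => e; congr x; apply: hfibre_eq => /=; exact: kact_comp.
Qed.

Section Degree.
Variable q : nat.

Local Notation bd v := (@is_bd k (semi_of (hfibre f v)) k^o q).
Local Notation cocyc v := (@is_cocycle k (semi_of (hfibre f v)) k^o q).

Lemma hpull_cocycle (I I' : finType) (th : I' -> I) (v : C I) (u : C I')
    (h : act th v = u) x : cocyc u x -> cocyc v (hpull h x).
Proof. by move=> dx e; rewrite cob_hpull dx. Qed.

Lemma hpull_bd (I I' : finType) (th : I' -> I) (v : C I) (u : C I')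
    (h : act th v = u) x : bd u x -> bd v (hpull h x).
Proof.
case: (q) x => [|n] x /=; first by move=> bx e; apply: bx.
by move=> [w xw]; exists (hpull h w) => e; rewrite cob_hpull -xw.
Qed.

Lemma hpull_inj (I I' : finType) (th : I' -> I) (v : C I) (u : C I')
    (h : act th v = u) x : inhabited I' -> injective th -> cocyc u x ->
  bd v (hpull h x) -> bd u x.
Proof.
move=> iI thi dx bx; apply: (@pullback_inj k _ _ (hfibre_smap f h)) => // p.
exact/triv_fib_exact/hfibre_triv_fib.
Qed.

Lemma hpull_surj (I I' : finType) (th : I' -> I) (v : C I) (u : C I')
    (h : act th v = u) x : inhabited I' -> injective th -> cocyc v x ->
  exists2 y, cocyc u y & bd v (fun e => x e - hpull h y e).
Proof.
move=> iI thi dx.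
have [|y dy yx] := @pullback_surj k _ _ (hfibre_smap f h) _ _ x dx; last by exists y.
by move=> p; exact/triv_fib_exact/hfibre_triv_fib.
Qed.

End Degree.

End BaseChange.

(** * Transport along edges *)

Definition cst_ord (I : Type) (i : I) (_ : 'I_1) : I := i.
Definition edge (I : Type) (i j : I) (l : 'I_2) : I := if l == ord0 then i else j.

Definition i20 : 'I_2 := ord0.
Definition i21 : 'I_2 := lift ord0 ord0.
Definition i30 : 'I_3 := ord0.
Definition i31 : 'I_3 := lift ord0 ord0.
Definition i32 : 'I_3 := lift ord0 (lift ord0 ord0).

Lemma ord2P (l : 'I_2) : l = i20 \/ l = i21.
Proof. by case: l => [[|[|//]] h]; [left | right]; apply: val_inj. Qed.

Lemma edge_inj (I : eqType) (i j : I) : i != j -> injective (edge i j).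
Proof.
move=> ij a b; case: (ord2P a) => ->; case: (ord2P b) => -> //= e.
  by rewrite /edge /= in e; rewrite e eqxx in ij.
by rewrite /edge /= in e; rewrite e eqxx in ij.
Qed.

Lemma cst_ord_inj (I : Type) (i : I) : injective (cst_ord i).
Proof. by move=> a b _; rewrite [a]ord1 [b]ord1. Qed.

Lemma act_cst_ord (C : sset) (I J : finType) (th : I -> J) (v : C J) (u : C I) i :
  act th v = u -> act (cst_ord i) u = act (cst_ord (th i)) v.
Proof. by move=> <-; rewrite act_comp. Qed.

(** Triviality of the fundamental group, by triangles with two degenerate sides. *)
Definition loops_bound (C : sset) := forall (z : C 'I_1) (e : C 'I_2),
  act (cst_ord i20) e = z -> act (cst_ord i21) e = z ->
  exists t : C 'I_3, [/\ act (edge i30 i31) t = e,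
    act (edge i31 i32) t = act (fun _ => ord0) z &
    act (edge i30 i32) t = act (fun _ => ord0) z].

Definition path_connected_from (C : sset) (y : C 'I_1) := forall w : C 'I_1,
  exists e : C 'I_2, act (cst_ord i20) e = y /\ act (cst_ord i21) e = w.

Section Transport.
Variables (k : fieldType) (A C : sset) (f : smap A C) (q : nat).
Hypothesis kC : kan_complex C.

Local Notation bd v := (@is_bd k (semi_of (hfibre f v)) k^o q).
Local Notation cocyc v := (@is_cocycle k (semi_of (hfibre f v)) k^o q).
Local Notation pullv h x := (@hpull A C f k _ _ 'I_q.+1 _ _ _ h x).

(** Transport along the edge from [i] to [j], as a correspondence: the fibre over
    a simplex restricts isomorphically to the fibres over its vertices.  The two
    vertices are variables with equations, as are all base points below. *)
Definition linked (I : finType) (v : C I) (i j : I) (w w' : C 'I_1)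
    (x : hfibre f w 'I_q.+1 -> k^o) (x' : hfibre f w' 'I_q.+1 -> k^o) :=
  exists (h : act (cst_ord i) v = w) (h' : act (cst_ord j) v = w'),
    bd v (fun e => pullv h x e - pullv h' x' e).

Lemma bd_trans (I : finType) (v : C I) (x y z : hfibre f v 'I_q.+1 -> k^o) :
  bd v (fun e => x e - y e) -> bd v (fun e => y e - z e) -> bd v (fun e => x e - z e).
Proof.
move=> h h'; have := is_bdP 1 h h'; apply: is_bd_ext => e.
by rewrite scale1r addrA subrK.
Qed.

Lemma bd_sym (I : finType) (v : C I) (x y : hfibre f v 'I_q.+1 -> k^o) :
  bd v (fun e => x e - y e) -> bd v (fun e => y e - x e).
Proof.
move=> h; have := is_bdB (is_bd0 _ _ _) h; apply: is_bd_ext => e.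
by rewrite sub0r opprB.
Qed.

Lemma linked_sym (I : finType) (v : C I) i j w w' (x : hfibre f w 'I_q.+1 -> k^o)
    (x' : hfibre f w' 'I_q.+1 -> k^o) : linked v i j x x' -> linked v j i x' x.
Proof. by move=> [h [h' /bd_sym b]]; exists h', h. Qed.

Lemma linked_trans (I : finType) (v : C I) i j l w w' w''
    (x : hfibre f w 'I_q.+1 -> k^o) (x' : hfibre f w' 'I_q.+1 -> k^o)
    (x'' : hfibre f w'' 'I_q.+1 -> k^o) :
  linked v i j x x' -> linked v j l x' x'' -> linked v i l x x''.
Proof.
move=> [h [h' b]] [g [g' b']]; exists h, g'; apply: bd_trans b _.
by rewrite (Prop_irrelevance h' g).
Qed.

Lemma hpullB (I I' : finType) (th : I' -> I) (v : C I) (u : C I') (h : act th v = u)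
    (x y : hfibre f u 'I_q.+1 -> k^o) :
  (fun e => pullv h x e - pullv h y e) = pullv h (fun e => x e - y e).
Proof. by []. Qed.

Lemma linked_extend (I I' : finType) (th : I' -> I) (v : C I) (u : C I') i j w w'
    (x : hfibre f w 'I_q.+1 -> k^o) (x' : hfibre f w' 'I_q.+1 -> k^o) :
  act th v = u -> linked u i j x x' -> linked v (th i) (th j) x x'.
Proof.
move=> h [g [g' b]].
have h1 : act (cst_ord (th i)) v = w by rewrite -(act_cst_ord i h).
have h2 : act (cst_ord (th j)) v = w' by rewrite -(act_cst_ord j h).
exists h1, h2; have := hpull_bd h b; apply: is_bd_ext => e.
by rewrite -(hpull_comp h g h1 x) -(hpull_comp h g' h2 x').
Qed.

Lemma linked_restrict (I I' : finType) (th : I' -> I) (v : C I) (u : C I') i j w w'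
    (x : hfibre f w 'I_q.+1 -> k^o) (x' : hfibre f w' 'I_q.+1 -> k^o) :
  act th v = u -> injective th -> cocyc w x -> cocyc w' x' ->
  linked v (th i) (th j) x x' -> linked u i j x x'.
Proof.
move=> h thi dx dx' [g [g' b]].
have h1 : act (cst_ord i) u = w by rewrite (act_cst_ord i h).
have h2 : act (cst_ord j) u = w' by rewrite (act_cst_ord j h).
exists h1, h2; apply: (hpull_inj kC (h := h)) => //.
  by apply: is_cocycleB; apply: hpull_cocycle.
apply: is_bd_ext b => e.
by rewrite -(hpull_comp h h1 g x) -(hpull_comp h h2 g' x').
Qed.

Lemma linked_exists (I : finType) (v : C I) i j w w' (x : hfibre f w 'I_q.+1 -> k^o) :
  act (cst_ord i) v = w -> act (cst_ord j) v = w' -> cocyc w x ->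
  exists2 x', cocyc w' x' & linked v i j x x'.
Proof.
move=> h h' dx; have [|||x' dx' b] := hpull_surj kC h' (x := pullv h x).
- exact: inhabits ord0.
- exact: cst_ord_inj.
- exact: hpull_cocycle.
by exists x' => //; exists h, h'.
Qed.

Lemma linked_bd (I : finType) (v : C I) i j w w' (x : hfibre f w 'I_q.+1 -> k^o)
    (x' : hfibre f w' 'I_q.+1 -> k^o) : linked v i j x x' ->
  cocyc w x -> bd w' x' -> bd w x.
Proof.
move=> [h [h' b]] dx bx'; apply: (hpull_inj kC (h := h)) => //; [exact: inhabits ord0 | exact: cst_ord_inj |].
have := is_bdP 1 b (hpull_bd h' bx'); apply: is_bd_ext => e.
by rewrite scale1r subrK.
Qed.

(** Two edges with a common vertex form a horn. *)
Lemma fill_triangle (m m' : 'I_2 -> 'I_3) (l l' : 'I_2) (e e' : C 'I_2) :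
  injective m -> injective m' -> m l = m' l' ->
  (forall a b, m a = m' b -> a = l /\ b = l') ->
  act (cst_ord l) e = act (cst_ord l') e' ->
  exists t : C 'I_3, act m t = e /\ act m' t = e'.
Proof.
move=> mi mi' mll ml ee'.
pose x (b : bool) : C 'I_2 := if b then e else e'.
pose iota (b : bool) : 'I_2 -> 'I_3 := if b then m else m'.
have sep (L : finType) (al be : L -> 'I_2) : m \o al = m' \o be -> act al e = act be e'.
  move=> h; have hl z : al z = l /\ be z = l' by apply/ml/(congr1 (@^~ z) h).
  have -> : al = cst_ord l \o (fun=> ord0) by apply/funext => z; case: (hl z).
  have -> : be = cst_ord l' \o (fun=> ord0) by apply/funext => z; case: (hl z).
  by rewrite -[LHS]act_comp -[RHS]act_comp ee'.
have [||b|t tP] := @kan_complex_cone C kC 'I_3 (m l) bool (fun _ => 'I_2 : finType) iota x.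
- exact: (inhabits true).
- move=> [] [] L al be h.
  + by congr act; apply/funext => z; apply: mi; apply: (congr1 (@^~ z) h).
  + exact: sep.
  + exact/esym/sep/esym.
  + by congr act; apply/funext => z; apply: mi'; apply: (congr1 (@^~ z) h).
- exists b; split; first by move=> z; exists z.
  by case: b; [exists l | exists l'].
by exists t; split; [apply: (tP true) | apply: (tP false)].
Qed.

Hypothesis lb : loops_bound C.

(** Since loops bound, transport from [y] to a vertex does not depend on the
    path. *)
Lemma transport_unique (y : C 'I_1) (g : hfibre f y 'I_q.+1 -> k^o) (I : finType)
    (v : C I) (i j : I) (w w' : C 'I_1) (e e' : C 'I_2)
    (x : hfibre f w 'I_q.+1 -> k^o) (x' : hfibre f w' 'I_q.+1 -> k^o) :
  act (cst_ord i) v = w -> act (cst_ord j) v = w' ->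
  cocyc y g -> cocyc w x -> cocyc w' x' ->
  linked e i20 i21 g x -> linked e' i20 i21 g x' -> linked v i j x x'.
Proof.
move=> vi vj dg dx dx' egx egx'.
pose c := act (edge i j) v.
have c0 : act (cst_ord i20) c = w by rewrite /c act_comp.
have c1 : act (cst_ord i21) c = w' by rewrite /c act_comp.
suff lc : linked c i20 i21 x x' by apply: (linked_extend (u := c) (th := edge i j) erefl lc).
have [x2 dx2 cx2] := linked_exists c0 c1 dx.
have [ee0 [ee1 _]] := egx; have [ee0' [ee1' _]] := egx'.
have e01 : injective (edge i30 i31) by apply: edge_inj.
have e12 : injective (edge i31 i32) by apply: edge_inj.
have e02 : injective (edge i30 i32) by apply: edge_inj.
(* The triangle [t] composes [e] with the edge [c] from [w] to [w'], the triangle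
   [s] compares the composite with [e'], and the loop [la] that is left over bounds
   by the triangle [r]. *)
have [t [te tc]] : exists t, act (edge i30 i31) t = e /\ act (edge i31 i32) t = c.
  apply: (@fill_triangle _ _ i21 i20) => //; last by rewrite ee1 c0.
  by move=> a b; case: (ord2P a) => ->; case: (ord2P b) => ->.
have t02 : linked t i30 i32 g x2.
  apply: (linked_trans (j := i31) (x' := x)).
    exact: (linked_extend te egx).
  exact: (linked_extend tc cx2).
pose ga := act (edge i30 i32) t.
have gax2 : linked ga i20 i21 g x2 by apply: (linked_restrict (th := edge i30 i32) (v := t)).
have [g0 [g1 _]] := gax2.
have [s [sg se]] : exists s, act (edge i30 i31) s = ga /\ act (edge i30 i32) s = e'.
  apply: (@fill_triangle _ _ i20 i20) => //; last by rewrite g0 ee0'.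
  by move=> a b; case: (ord2P a) => ->; case: (ord2P b) => ->.
have s12 : linked s i31 i32 x2 x'.
  apply: (linked_trans (j := i30) (x' := g)).
    exact/linked_sym/(linked_extend sg gax2).
  exact: (linked_extend se egx').
pose la := act (edge i31 i32) s.
have lax : linked la i20 i21 x2 x' by apply: (linked_restrict (th := edge i31 i32) (v := s)).
have [l0 [l1 _]] := lax.
have [r [rl r1 r0]] := lb l0 l1.
set z := act _ w' in r1 r0.
have z0 : act (cst_ord i20) z = w'.
  by rewrite /z act_comp -[RHS]act_id; congr act; apply/funext => a; rewrite [a]ord1.
have z1 : act (cst_ord i21) z = w'.
  by rewrite /z act_comp -[RHS]act_id; congr act; apply/funext => a; rewrite [a]ord1.
have [x3 dx3 zx3] := linked_exists z0 z1 dx'.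
have r02 : linked r i30 i32 x2 x3.
  apply: (linked_trans (j := i31) (x' := x')).
    exact: (linked_extend rl lax).
  exact: (linked_extend r1 zx3).
have zx23 : linked z i20 i21 x2 x3 by apply: (linked_restrict (th := edge i30 i32) (v := r)).
have [h [h' b]] := linked_trans zx23 (linked_sym zx3).
have bx : bd w' (fun e => x2 e - x' e).
  apply: (hpull_inj kC (h := h)); [exact: inhabits ord0 | exact: cst_ord_inj | exact: is_cocycleB |].
  by move: b; rewrite (Prop_irrelevance h' h).
have [k0 [k1 b1]] := cx2; exists k0, k1.
by apply: bd_trans b1 _; rewrite hpullB; apply: hpull_bd.
Qed.

Variable y : C 'I_1.
Hypothesis py : path_connected_from y.

(** Transport from [y] along all paths to all vertices of [v] at once, so that no
    path has to be chosen. *)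
Definition transported (I : finType) (v : C I) (g : hfibre f y 'I_q.+1 -> k^o)
    (x : hfibre f v 'I_q.+1 -> k^o) :=
  [/\ cocyc y g, cocyc v x & forall (i : I) (w : C 'I_1) (h : act (cst_ord i) v = w) e x',
    cocyc w x' -> linked e i20 i21 g x' -> bd v (fun e => pullv h x' e - x e)].

Lemma transported_one (I : finType) (v : C I) (g : hfibre f y 'I_q.+1 -> k^o)
    (x : hfibre f v 'I_q.+1 -> k^o) (i : I) (w : C 'I_1) (h : act (cst_ord i) v = w) e x' :
  cocyc y g -> cocyc v x -> cocyc w x' -> linked e i20 i21 g x' ->
  bd v (fun e => pullv h x' e - x e) -> transported g x.
Proof.
move=> dg dx dx' egx b; split => // j w2 h2 e2 x2 dx2 egx2.
have [h3 [h4 b']] := transport_unique h2 h dg dx2 dx' egx2 egx.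
apply: bd_trans b; move: b'.
by rewrite (Prop_irrelevance h3 h2) (Prop_irrelevance h4 h).
Qed.

Lemma transport_path (w : C 'I_1) (g : hfibre f y 'I_q.+1 -> k^o) : cocyc y g ->
  exists e x, cocyc w x /\ linked e i20 i21 g x.
Proof.
move=> dg; have [e [e0 e1]] := py w.
by have [x dx egx] := linked_exists e0 e1 dg; exists e, x.
Qed.

Lemma transported_lin (I : finType) (v : C I) a g g' (x x' : hfibre f v 'I_q.+1 -> k^o) :
  transported g x -> transported g' x' ->
  transported (fun e => a *: g e + g' e) (fun e => a *: x e + x' e).
Proof.
move=> [dg dx gx] [dg' dx' gx']; split.
- exact: is_cocycleP.
- exact: is_cocycleP.
move=> i w h e x2 dx2 [h0 [h1 b2]].
have [x3 dx3 egx3] := linked_exists h0 h1 dg.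
have [x4 dx4 egx4] := linked_exists h0 h1 dg'.
have b3 := gx i w h e x3 dx3 egx3; have b4 := gx' i w h e x4 dx4 egx4.
suff b5 : bd w (fun e => x2 e - (a *: x3 e + x4 e)).
  apply: bd_trans (hpull_bd h b5) _.
  have := is_bdP a b3 b4; apply: is_bd_ext => e' /=.
  by rewrite /hpull scalerBr addrACA -opprD.
have : linked e i21 i20 x2 (fun e => a *: g e + g' e) by apply: linked_sym; exists h0, h1.
move=> l2.
have l3 : linked e i20 i21 (fun e => a *: g e + g' e) (fun e => a *: x3 e + x4 e).
  exists h0, h1; have [u0 [u1 c3]] := egx3; have [t0 [t1 c4]] := egx4.
  move: c3 c4; rewrite (Prop_irrelevance u0 h0) (Prop_irrelevance t0 h0).
  rewrite (Prop_irrelevance u1 h1) (Prop_irrelevance t1 h1) => c3 c4.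
  have := is_bdP a c3 c4; apply: is_bd_ext => e' /=.
  by rewrite /hpull scalerBr addrACA -opprD.
have [u [u' c]] := linked_trans l2 l3.
apply: (hpull_inj kC (h := u)); [exact: inhabits ord0 | exact: cst_ord_inj | |].
  by apply: is_cocycleB => //; apply: is_cocycleP.
by move: c; rewrite (Prop_irrelevance u' u).
Qed.

Lemma transported_base p (v : C 'I_p.+1) x : cocyc v x ->
  exists2 g, cocyc y g & transported g x.
Proof.
move=> dx; pose w := act (cst_ord (ord0 : 'I_p.+1)) v.
have [|||x' dx' b] := hpull_surj kC (erefl w) (x := x).
- exact: inhabits ord0.
- exact: cst_ord_inj.
- exact: dx.
have [e [e0 e1]] := py w.
have [g dg exg] := linked_exists e1 e0 dx'.
exists g => //; apply: (transported_one (h := erefl w) dg dx dx' (linked_sym exg)).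
exact: bd_sym.
Qed.

Lemma transported_fibre p (v : C 'I_p.+1) g : cocyc y g ->
  exists2 x, cocyc v x & transported g x.
Proof.
move=> dg; pose w := act (cst_ord (ord0 : 'I_p.+1)) v.
have [e [x [dx egx]]] := transport_path w dg.
have dhx : cocyc v (pullv (erefl w) x) by exact: hpull_cocycle.
exists (pullv (erefl w) x) => //.
apply: (transported_one (h := erefl w) dg dhx dx egx).
by apply: is_bd_ext (is_bd0 _ _ _) => e'; rewrite subrr.
Qed.

Lemma transported_bd p (v : C 'I_p.+1) g x : cocyc y g -> cocyc v x ->
  transported g x -> (bd y g <-> bd v x).
Proof.
move=> dg dx [_ _ gx]; pose w := act (cst_ord (ord0 : 'I_p.+1)) v.
have [e [x' [dx' egx]]] := transport_path w dg.
have b := gx _ w erefl e x' dx' egx; split=> bb.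
  have bx' := linked_bd (linked_sym egx) dx' bb.
  have := is_bdB (hpull_bd (erefl w) bx') b; apply: is_bd_ext => e'.
  by rewrite opprB addrC subrK.
apply: (linked_bd egx dg).
apply: (hpull_inj kC (h := erefl w)); [exact: inhabits ord0 | exact: cst_ord_inj | by [] |].
have := is_bdP 1 b bb; apply: is_bd_ext => e'; by rewrite scale1r subrK.
Qed.

Lemma transported_nat (I I' : finType) (th : I' -> I) (v : C I) (u : C I')
    (h : act th v = u) g (x : hfibre f u 'I_q.+1 -> k^o) : inhabited I' -> transported g x ->
  transported g (fun e => x (hfibre_map h e)).
Proof.
move=> [i] [dg dx gx]; pose w := act (cst_ord i) u.
have [e [x' [dx' egx]]] := transport_path w dg.
have b := gx i w erefl e x' dx' egx.
have h' : act (cst_ord (th i)) v = w by rewrite -(act_cst_ord i h).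
apply: (transported_one (h := h') dg (hpull_cocycle h dx) dx' egx).
have := hpull_bd h b; apply: is_bd_ext => e'.
by rewrite -(hpull_comp h (erefl w) h' x').
Qed.

(** Over a simply connected Kan complex the cohomology of the fibres is
    constant. *)
Definition transport_trivialisation : trivialisation k f (semi_of (hfibre f y)) q :=
  @Trivialisation k A C f (semi_of (hfibre f y)) q
    (fun I v => @transported I v) transported_lin
    transported_base transported_fibre transported_bd transported_nat.

End Transport.

(** * Strict fibres of Kan fibrations *)

Lemma acyclic_pullback (k : fieldType) (A C : sset) (f : smap A C) n :
  (forall p, @exact_semi k (vsemi f 'I_p.+1) k^o) ->
  acyclic k (semi_of A) n <-> acyclic k (semi_of C) n.
Proof.
move=> ex; split=> ac.
  move=> c dc; apply: (pullback_inj ex dc); apply: ac => t.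
  rewrite -[RHS](dc (sfun f t)) /cob; apply: eq_bigr => i _.
  by rewrite /= sfun_act.
move=> a da; have [c dc bac] := pullback_surj ex da.
have bc : @is_bd k (semi_of A) k^o n (fun t => c (sfun f t)).
  have := ac c dc; case: n c {a da dc bac} ac => [|n] c ac /=; first by move=> h t; apply: h.
  move=> [w cw]; exists (fun t => w (sfun f t)) => t; rewrite cw /cob.
  by apply: eq_bigr => i _; rewrite /= sfun_act.
have := is_bdP 1 bac bc; apply: is_bd_ext => t; by rewrite scale1r subrK.
Qed.

Definition to_ord1 (I : Type) (_ : I) : 'I_1 := ord0.

Lemma to_ord1_uniq (I : Type) (g h : I -> 'I_1) : g = h.
Proof. by apply/funext => i; rewrite [g i]ord1 [h i]ord1. Qed.

Section StrictFibre.
Variables (X Y : sset) (p : smap X Y) (y : Y 'I_1).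

Definition strict_car (J : finType) := {t : X J | sfun p t = act (@to_ord1 J) y}.

Lemma strict_eq (J : finType) (t t' : strict_car J) : sval t = sval t' -> t = t'.
Proof. by case: t t' => [t h] [t' h'] /= e; subst; rewrite (Prop_irrelevance h h'). Qed.

Lemma strict_act_subproof (J' J : finType) (g : J' -> J) (t : strict_car J) :
  sfun p (act g (sval t)) = act (@to_ord1 J') y.
Proof. by rewrite sfun_act (proj2_sig t) act_comp; congr act; apply: to_ord1_uniq. Qed.

Definition strict_act (J' J : finType) (g : J' -> J) (t : strict_car J) : strict_car J' :=
  exist _ (act g (sval t)) (strict_act_subproof g t).

Lemma strict_act_id (J : finType) (t : strict_car J) : strict_act id t = t.
Proof. by apply: strict_eq; rewrite /= act_id. Qed.

Lemma strict_act_comp (I J L : finType) (g : I -> J) (h : J -> L) t :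
  strict_act g (strict_act h t) = strict_act (h \o g) t.
Proof. by apply: strict_eq; rewrite /= act_comp. Qed.

Lemma strict_pt_subproof : sfun p (spt X) = act (@to_ord1 'I_0) y.
Proof. by rewrite [LHS]spt_uniq [RHS]spt_uniq. Qed.

Definition strict_pt : strict_car 'I_0 := exist _ (spt X) strict_pt_subproof.

Lemma strict_pt_uniq t : t = strict_pt.
Proof. by apply: strict_eq; apply: spt_uniq. Qed.

Definition strict_fibre : sset :=
  @SSet strict_car (fun I J => @strict_act I J) strict_act_id strict_act_comp
    strict_pt strict_pt_uniq.

Definition strict_incl : smap strict_fibre X :=
  @SMap strict_fibre X (fun J t => sval t) (fun _ _ _ _ => erefl).

Lemma to_hfibre_subproof (J : finType) (t : strict_fibre J) :
  act inr (act (@to_ord1 ('I_1 + J)%type) y) = sfun p (sval t).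
Proof. by rewrite (proj2_sig t) act_comp; congr act; apply: to_ord1_uniq. Qed.

Lemma to_hfibre_subproof' (J : finType) (t : strict_fibre J) :
  front (exist _ (act (@to_ord1 ('I_1 + J)%type) y, sval t) (to_hfibre_subproof t)
    : kcar p 'I_1 J) = y.
Proof. by rewrite /front /= act_comp -[RHS]act_id; congr act; apply: to_ord1_uniq. Qed.

Definition to_hfibre_fun (J : finType) (t : strict_fibre J) : hfibre p y J :=
  exist _ _ (to_hfibre_subproof' t).

Lemma to_hfibre_act (I J : finType) (g : I -> J) (t : strict_fibre J) :
  to_hfibre_fun (act g t) = act g (to_hfibre_fun t).
Proof.
apply: hfibre_eq; apply: kcar_eq => //=.
by rewrite act_comp; congr act; apply: to_ord1_uniq.
Qed.

Definition to_hfibre : smap strict_fibre (hfibre p y) :=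
  @SMap _ (hfibre p y) to_hfibre_fun to_hfibre_act.

Hypothesis kp : kan p.

Lemma kan_join (I : finType) (i0 : I) n (s : 'I_n.+1 -> X (I + 'I_n)%type)
    (b : Y (I + 'I_n.+1)%type) :
  compatible_family (fun i : 'I_n.+1 => joinmap id (lift i)) s ->
  (forall i, sfun p (s i) = act (joinmap id (lift i)) b) ->
  exists2 z, sfun p z = b & forall i, act (joinmap id (lift i)) z = s i.
Proof.
move=> cs ps.
apply: (@kan_cone _ _ _ kp _ (inl i0) 'I_n.+1 (fun _ => (I + 'I_n)%type : finType)
  (fun i : 'I_n.+1 => joinmap id (lift i)) s b (inhabits ord0) cs ps).
by move=> i; exists i; split; [move=> l; exists l | exists (inl i0)].
Qed.

Section FillFibre.
Hypothesis kY : kan_complex Y.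

Definition assoc (I J : Type) (x : ('I_1 + I) + J) : 'I_1 + (I + J) := match x with
  | inl (inl o) => inl o | inl (inr i) => inr (inl i) | inr j => inr (inr j) end.
Definition unassoc (I J : Type) (x : 'I_1 + (I + J)) : ('I_1 + I) + J := match x with
  | inl o => inl (inl o) | inr (inl i) => inl (inr i) | inr (inr j) => inr j end.

Lemma assocK (I J : Type) : @assoc I J \o @unassoc I J = id.
Proof. by apply/funext => -[o|[i|j]]. Qed.

Lemma assoc_joinmap (I J J' : Type) (h : J' -> J) :
  @assoc I J \o joinmap id h = joinmap id (joinmap id h) \o @assoc I J'.
Proof. by apply/funext => -[[o|i]|j]. Qed.

Lemma unassoc_joinmap (I J J' : Type) (h : J' -> J) :
  @unassoc I J \o joinmap id (joinmap id h) = joinmap id h \o @unassoc I J'.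
Proof. by apply/funext => -[o|[i|j]]. Qed.

(** The path from [y] in the base is filled first, with the constant path over
    the new simplex prescribed; then the total space is lifted. *)
Lemma to_hfibre_exact (k : fieldType) m : @exact_semi k (vsemi to_hfibre 'I_m.+1) k^o.
Proof.
set I : finType := 'I_m.+1.
suff [h /cone_exact] : exists h, @is_cone (vsemi to_hfibre I) h by apply.
apply: (@cone_by_filling (vsemi to_hfibre I) (fun _ _ _ => True)) => n e W _ cW _.
pose s i := (sval (sval (sval (W i)).1)).1.
pose t i := (sval (sval (sval (W i)).1)).2.
have ws i : act (joinmap id inr) (s i) = act (@to_ord1 _) y.
  by have /(congr1 (fun e => (sval (sval e)).1)) := proj2_sig (W i).
have wt i : act inr (t i) = sval (sval (W i)).2.
  by have /(congr1 (fun e => (sval (sval e)).2)) := proj2_sig (W i).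
have st i : act inr (s i) = sfun p (t i) by exact: (proj2_sig (sval (sval (W i)).1)).
have cs : compatible_family (fun i : 'I_n.+1 => joinmap id (lift i))
    (fun i => act (@assoc I 'I_n) (s i)).
  apply: join_faces; rewrite /s; case: n e W cW {s t ws wt st} => [//|n] e W cW x.
  have /(congr1 (fun e => (sval (sval (sval e).1)).1)) /= := cW x.
  by rewrite !act_comp !assoc_joinmap -!(act_comp (@assoc I 'I_n)) => ->.
have ct : compatible_family (fun i : 'I_n.+1 => joinmap id (lift i)) t.
  apply: join_faces; rewrite /t; case: n e W cW {s t ws wt st cs} => [//|n] e W cW x.
  by have /(congr1 (fun e => (sval (sval (sval e).1)).2)) /= := cW x.
pose T (o : option 'I_n.+1) : finType :=
  if o is Some _ then (('I_1 + I) + 'I_n)%type : finType else ('I_1 + 'I_n.+1)%type : finType.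
pose iota (o : option 'I_n.+1) : T o -> (('I_1 + I) + 'I_n.+1)%type :=
  match o return T o -> (('I_1 + I) + 'I_n.+1)%type with
  | Some i => joinmap id (lift i) | None => joinmap inl id end.
pose x (o : option 'I_n.+1) : Y (T o) := match o return Y (T o) with
  | Some i => act (@assoc I 'I_n) (s i) | None => act (@to_ord1 _) y end.
have sep (i : 'I_n.+1) (L : finType) (al : L -> (('I_1 + I) + 'I_n)%type)
    (be : L -> ('I_1 + 'I_n.+1)%type) :
    joinmap id (lift i) \o al = joinmap inl id \o be ->
    act al (x (Some i)) = act be (x None).
  move=> ab.
  have ex l : exists c : 'I_1 + 'I_n, al l = joinmap inl id c.
    have := congr1 (@^~ l) ab => /=; case: (al l) (be l) => [[o|i']|j] [b|b] //= eb.
      by exists (inl o).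
    by exists (inr j).
  have [ga gaP] := choice ex.
  have -> : al = joinmap inl id \o ga by apply/funext.
  have ac : act (joinmap inl id) (act (@assoc I 'I_n) (s i)) = act (@to_ord1 _) y.
    by rewrite act_comp -(ws i); congr act; apply/funext => -[o|j].
  rewrite -[LHS]act_comp [X in act ga X]ac !act_comp.
  by congr act; apply: to_ord1_uniq.
have [|o|sz szP] := @kan_complex_cone Y kY _ (inl (inl ord0)) _ T iota x (inhabits None).
- move=> [i|] [j|] L al be ab.
  + exact: cs.
  + exact: sep.
  + exact/esym/sep/esym.
  + by rewrite /= !act_comp; congr act; apply: to_ord1_uniq.
- exists o; split; first by move=> l; exists l.
  by case: o => [i|]; [exists (inl (inl ord0)) | exists (inl ord0)].
have sz1 i : act (joinmap id (lift i)) sz = act (@assoc I 'I_n) (s i) := szP (Some i).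
have sz2 : act (joinmap inl id) sz = act (@to_ord1 ('I_1 + 'I_n.+1)%type) y := szP None.
pose sf := act (@unassoc I 'I_n.+1) sz.
have sf1 i : act (joinmap id (joinmap id (lift i))) sf = s i.
  rewrite /sf act_comp unassoc_joinmap -act_comp sz1 act_comp assocK.
  exact: act_id.
have [|tz tzp tzP] := kan_join (ord0 : I) (b := act inr sf) ct.
  move=> i; rewrite -st -(sf1 i) !act_comp; congr act.
have sft : act inr sf = sfun p tz by rewrite tzp.
have sfy : act inl sf = y.
  rewrite /sf act_comp; have -> : @unassoc I 'I_n.+1 \o inl = joinmap inl id \o inl by [].
  by rewrite -act_comp sz2 act_comp -[RHS]act_id; congr act; apply: to_ord1_uniq.
have sfb : act (joinmap id inr) sf = act (@to_ord1 ('I_1 + 'I_n.+1)%type) y.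
  rewrite -sz2 /sf act_comp; congr act; by apply/funext => -[o|j].
have tzy : sfun p (act inr tz) = act (@to_ord1 _) y.
  rewrite sfun_act -sft act_comp.
  have -> : @inr 'I_1 (I + 'I_n.+1) \o inr = joinmap id inr \o inr by [].
  by rewrite -act_comp sfb act_comp; congr act; apply: to_ord1_uniq.
pose sig : hfibre p y (I + 'I_n.+1)%type := exist _ (exist _ (sf, tz) sft) sfy.
pose tau : strict_fibre 'I_n.+1 := exist _ (act inr tz) tzy.
have wz : act inr sig = sfun to_hfibre tau.
  by apply: hfibre_eq; apply: kcar_eq => /=; rewrite ?sfb.
exists (exist _ (sig, tau) wz); split => // i; apply: kcar_eq => /=.
  apply: hfibre_eq; apply: kcar_eq => /=; first exact: sf1.
  exact: tzP.
apply: strict_eq => /=; rewrite -wt -tzP !act_comp; congr act.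
Qed.

End FillFibre.

(** ** The path fibre over the total space *)

Lemma const_map_subproof (I J : finType) (g : I -> J) (x : point_sset J) :
  act (@to_ord1 I) y = act g (act (@to_ord1 J) y).
Proof. by rewrite act_comp; congr act; apply: to_ord1_uniq. Qed.

Definition const_map : smap point_sset Y :=
  @SMap point_sset Y (fun J _ => act (@to_ord1 J) y) const_map_subproof.

Section PathFibre.
Variables (I : finType) (v : X I).

Lemma path_fibre_subproof (J : finType) (e : hfibre strict_incl v J) :
  act inr (sfun p (sval (sval e)).1) = sfun const_map (tt : point_sset J).
Proof. by rewrite -sfun_act (proj2_sig (sval e)) (proj2_sig (sval (sval e)).2). Qed.

Lemma path_fibre_subproof' (J : finType) (e : hfibre strict_incl v J) :
  front (exist _ (sfun p (sval (sval e)).1, tt) (path_fibre_subproof e) :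
    kcar const_map I J) = sfun p v.
Proof. by rewrite /front /= -sfun_act; congr sfun; exact: (proj2_sig e). Qed.

Definition path_fibre_fun (J : finType) (e : hfibre strict_incl v J) :
  hfibre const_map (sfun p v) J := exist _ _ (path_fibre_subproof' e).

Lemma path_fibre_act (J' J : finType) (g : J' -> J) (e : hfibre strict_incl v J) :
  path_fibre_fun (act g e) = act g (path_fibre_fun e).
Proof. by apply: hfibre_eq; apply: kcar_eq => //=; rewrite sfun_act. Qed.

Definition path_fibre : smap (hfibre strict_incl v) (hfibre const_map (sfun p v)) :=
  @SMap _ (hfibre const_map (sfun p v)) path_fibre_fun path_fibre_act.

(** A path in the base ending at [y] lifts to a path ending in the strict fibre,
    uniquely up to homotopy. *)
Lemma path_fibre_triv_fib : inhabited I -> triv_fib path_fibre.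
Proof.
move=> [i0] n w c cw fw.
have [||z pz zP] := kan_join i0 (s := fun i => (sval (sval (w i))).1)
  (b := (sval (sval c)).1).
- apply: join_faces; case: n w c cw fw => [//|n] w c cw fw x.
  by have /(congr1 (fun e => (sval (sval e)).1)) := cw x.
- by move=> i; have /(congr1 (fun e => (sval (sval e)).1)) := fw i.
have zb : sfun p (act inr z) = act (@to_ord1 'I_n.+1) y.
  by rewrite sfun_act pz (proj2_sig (sval c)).
have zf : act inl z = v.
  have := proj2_sig (w ord0); rewrite /front -(zP ord0) act_comp => <-.
  by congr act.
pose e : kcar strict_incl I 'I_n.+1 :=
  exist _ (z, exist _ (act inr z) zb : strict_fibre 'I_n.+1) erefl.
exists (exist _ e zf).
  by apply: hfibre_eq; apply: kcar_eq => //=; case: (_.2).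
move=> i; apply: hfibre_eq; apply: kcar_eq => /=; first exact: zP.
apply: strict_eq; rewrite /= act_comp.
have /= -> := esym (proj2_sig (sval (w i))).
by rewrite -(zP i) act_comp; congr act.
Qed.

End PathFibre.

Section PullTrivialisation.
Variables (k : fieldType) (G : semi) (q : nat) (T : trivialisation k const_map G q).

Local Notation cocyc v := (@is_cocycle k (semi_of (hfibre strict_incl v)) k^o q).
Local Notation bd v := (@is_bd k (semi_of (hfibre strict_incl v)) k^o q).

Definition path_pull (I J : finType) (v : X I)
    (x : hfibre const_map (sfun p v) J -> k^o) : hfibre strict_incl v J -> k^o :=
  fun e => x (path_fibre_fun e).

Definition pull_triv (I : finType) (v : X I) (g : G q.+1 -> k^o)
    (x : hfibre strict_incl v 'I_q.+1 -> k^o) :=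
  exists x', [/\ @is_cocycle k (semi_of (hfibre const_map (sfun p v))) k^o q x',
    triv T (sfun p v) g x' & bd v (fun e => path_pull x' e - x e)].

Lemma path_pull_bd (I : finType) (v : X I) x : 
  @is_bd k (semi_of (hfibre const_map (sfun p v))) k^o q x -> bd v (path_pull x).
Proof.
case: (q) x => [|n] x /=; first by move=> h e; apply: h.
move=> [w xw]; exists (path_pull w) => e; rewrite /path_pull xw /cob.
by apply: eq_bigr => i _; rewrite /= path_fibre_act.
Qed.

Lemma path_pull_cocycle (I : finType) (v : X I) x : 
  @is_cocycle k (semi_of (hfibre const_map (sfun p v))) k^o q x -> cocyc v (path_pull x).
Proof.
move=> dx e; rewrite -[RHS](dx (path_fibre_fun e)) /cob.
by apply: eq_bigr => i _; rewrite /path_pull /= path_fibre_act.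
Qed.

Lemma pull_triv_lin (I : finType) (v : X I) a g g' (x x' : hfibre strict_incl v 'I_q.+1 -> k^o) :
  pull_triv g x -> pull_triv g' x' ->
  pull_triv (fun e => a *: g e + g' e) (fun e => a *: x e + x' e).
Proof.
move=> [z [dz gz bz]] [z' [dz' gz' bz']].
exists (fun e => a *: z e + z' e); split; [exact: is_cocycleP | exact: triv_lin |].
have := is_bdP a bz bz'; apply: is_bd_ext => e.
by rewrite /path_pull scalerBr addrACA -opprD.
Qed.

Lemma pull_triv_base n (v : X 'I_n.+1) x : cocyc v x ->
  exists2 g, is_cocycle g & pull_triv g x.
Proof.
move=> dx; have [|x' dx' bx] := @pullback_surj k _ _ (path_fibre v) _ _ x dx.
  by move=> r; apply/triv_fib_exact/path_fibre_triv_fib/(inhabits ord0).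
have [g dg gx] := triv_base T dx'; exists g => //; exists x'; split => //.
have := is_bdB (is_bd0 _ _ _) bx; apply: is_bd_ext => e; by rewrite sub0r opprB.
Qed.

Lemma pull_triv_fibre n (v : X 'I_n.+1) g : is_cocycle g ->
  exists2 x, cocyc v x & pull_triv g x.
Proof.
move=> dg; have [x dx gx] := triv_fibre T (sfun p v) dg.
exists (path_pull x); first exact: path_pull_cocycle.
exists x; split => //; apply: is_bd_ext (is_bd0 _ _ _) => e; by rewrite subrr.
Qed.

Lemma pull_triv_bd n (v : X 'I_n.+1) g x : is_cocycle g -> cocyc v x ->
  pull_triv g x -> (is_bd g <-> bd v x).
Proof.
move=> dg dx [x' [dx' gx' b]]; rewrite (triv_bd dg dx' gx'); split=> bx.
  have := is_bdB (path_pull_bd bx) b; apply: is_bd_ext => e.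
  by rewrite opprB addrC subrK.
apply: (@pullback_inj k _ _ (path_fibre v)) => //.
  by move=> r; apply/triv_fib_exact/path_fibre_triv_fib/(inhabits ord0).
have := is_bdP 1 b bx; apply: is_bd_ext => e; by rewrite scale1r subrK.
Qed.

Lemma pull_triv_nat (I I' : finType) (th : I' -> I) (v : X I) (u : X I')
    (h : act th v = u) g (x : hfibre strict_incl u 'I_q.+1 -> k^o) : inhabited I' ->
  pull_triv g x -> pull_triv g (fun e => x (hfibre_map h e)).
Proof.
move=> iI [x' [dx' gx' b]].
have h' : act th (sfun p v) = sfun p u by rewrite -sfun_act h.
exists (fun e => x' (hfibre_map h' e)); split.
- exact: (hpull_cocycle h' dx').
- exact: triv_nat.
have := hpull_bd h b; apply: is_bd_ext => e; rewrite /hpull /path_pull.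
by congr (x' _ - _); apply: hfibre_eq; apply: kcar_eq => //=; rewrite -sfun_act.
Qed.

(** The coefficients over the total space are pulled back from those of the path
    fibration of the base, so that the total space need not be simply connected. *)
Definition pull_trivialisation : trivialisation k strict_incl G q :=
  @Trivialisation k strict_fibre X strict_incl G q (fun I v => @pull_triv I v)
    pull_triv_lin pull_triv_base pull_triv_fibre pull_triv_bd pull_triv_nat.

End PullTrivialisation.

End StrictFibre.

(** * Singular simplices on finite sets of vertices *)

Section RealContinuity.
Variables (R : realType) (T : topologicalType).
Implicit Types f g : T -> R.

Lemma continuousD_r f g : continuous f -> continuous g -> continuous (fun x => f x + g x).
Proof. by move=> cf cg x; apply: cvgD; [apply: cf | apply: cg]. Qed.

Lemma continuousB_r f g : continuous f -> continuous g -> continuous (fun x => f x - g x).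
Proof. by move=> cf cg x; apply: cvgB; [apply: cf | apply: cg]. Qed.

Lemma continuousM_r f g : continuous f -> continuous g -> continuous (fun x => f x * g x).
Proof. by move=> cf cg x; apply: cvgM; [apply: cf | apply: cg]. Qed.

Lemma continuousV_r f : continuous f -> (forall x, f x != 0) -> continuous (fun x => (f x)^-1).
Proof. by move=> cf f0 x; apply: cvgV => //; apply: cf. Qed.

Lemma continuous_max_r f g : continuous f -> continuous g ->
  continuous (fun x => Num.max (f x) (g x)).
Proof. by move=> cf cg x; apply: continuous_max; [apply: cf | apply: cg]. Qed.

Lemma continuous_min_r f g : continuous f -> continuous g ->
  continuous (fun x => Num.min (f x) (g x)).
Proof. by move=> cf cg x; apply: continuous_min; [apply: cf | apply: cg]. Qed.

Lemma continuous_cst_r (a : R) : continuous (fun _ : T => a).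
Proof. by move=> x; apply: cvg_cst. Qed.

Lemma continuous_sum_r (I : Type) (r : seq I) (P : pred I) (F : I -> T -> R) :
  (forall i, P i -> continuous (F i)) -> continuous (fun x => \sum_(i <- r | P i) F i x).
Proof.
move=> cF; elim: r => [|i r IH].
  under [X in continuous X]eq_fun => x do rewrite big_nil.
  exact: continuous_cst_r.
under [X in continuous X]eq_fun => x do rewrite big_cons.
case Pi: (P i); last exact: IH.
by apply: continuousD_r => //; apply: cF.
Qed.

End RealContinuity.

Definition cts_of (T U : topologicalType) (f : T -> U) (cf : continuous f) :
  continuousType T U := HB.pack f (isContinuous.Build T U f cf).

Lemma continuous_set_val (T : topologicalType) (A : set T) :
  continuous (set_val : A -> T).
Proof. exact: initial_continuous. Qed.

Lemma continuous_into_set (S T : topologicalType) (A : set T) (g : S -> A) :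
  continuous (fun x => set_val (g x)) -> continuous g.
Proof. by move=> cg; apply: continuous_comp_initial. Qed.

Lemma continuous_into_row (R : realType) (S : topologicalType) n (g : S -> 'rV[R]_n) :
  (forall j, continuous (fun x => g x ord0 j)) -> continuous g.
Proof.
move=> cg x A [P gP PA]; have cP j : \forall y \near x, P ord0 j (g y ord0 j).
  exact: (cg j x _ (gP ord0 j)).
have := @filter_forall _ _ _ _ (nbhs_filter x) cP.
by apply: filterS => y Py; apply: PA => i j; rewrite [i]ord1.
Qed.

Section Simplices.
Variable R : realType.

(** Coordinates are numbered through an enumeration of [I], so that the topology is
    that of row vectors; [bary] addresses them by vertices. *)
Definition geosimplex (I : finType) : set 'rV[R]_#|I| :=
  [set t | (forall j, 0 <= t ord0 j) /\ \sum_j t ord0 j = 1].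
Arguments geosimplex I : clear implicits.

Section Coordinates.
Variable I : finType.

Definition bary (t : geosimplex I) (i : I) : R := set_val t ord0 (enum_rank i).

Lemma bary_ge0 t i : 0 <= bary t i.
Proof. by have [h _] := set_mem (valP t); apply: h. Qed.

Lemma sum_enum_rank (F : 'I_#|I| -> R) : \sum_j F j = \sum_i F (enum_rank i).
Proof.
rewrite (reindex (@enum_rank I)) //=.
by exists enum_val => i _; [apply: enum_rankK | apply: enum_valK].
Qed.

Lemma bary_sum t : \sum_i bary t i = 1.
Proof. by have [_ <-] := set_mem (valP t); rewrite sum_enum_rank. Qed.

Lemma bary_le1 t i : bary t i <= 1.
Proof.
rewrite -(bary_sum t) (bigD1 i)//= lerDl sumr_ge0// => j _.
exact: bary_ge0.
Qed.

Lemma bary_inj t t' : (forall i, bary t i = bary t' i) -> t = t'.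
Proof.
move=> e; apply/val_inj/rowP => j; have := e (enum_val j).
by rewrite /bary enum_valK.
Qed.

Lemma point_subproof (a : I -> R) : (forall i, 0 <= a i) -> \sum_i a i = 1 ->
  (\row_j a (enum_val j)) \in geosimplex I.
Proof.
move=> a0 a1; apply/mem_set; split=> [j|]; first by rewrite mxE.
by rewrite sum_enum_rank -a1; apply: eq_bigr => i _; rewrite mxE enum_rankK.
Qed.

Definition simplex_point (a : I -> R) (a0 : forall i, 0 <= a i)
    (a1 : \sum_i a i = 1) : geosimplex I :=
  exist _ (\row_j a (enum_val j)) (point_subproof a0 a1).

Lemma baryE a a0 a1 i : bary (@simplex_point a a0 a1) i = a i.
Proof. by rewrite /bary /set_val /= mxE enum_rankK. Qed.

Lemma continuous_bary i : continuous (fun t : geosimplex I => bary t i).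
Proof.
move=> t; apply: (@continuous_comp _ _ _ (set_val : geosimplex I -> _) (fun M => M ord0 _)).
  exact: continuous_set_val.
exact: coord_continuous.
Qed.

Lemma continuous_into_simplex (S : topologicalType) (g : S -> geosimplex I) :
  (forall i, continuous (fun x => bary (g x) i)) -> continuous g.
Proof.
move=> cg; apply: continuous_into_set; apply: continuous_into_row => j.
by have := cg (enum_val j); rewrite /bary enum_valK.
Qed.

End Coordinates.

Section Push.
Variables (I J : finType) (g : I -> J).

Lemma push_ge0 (t : geosimplex I) j : 0 <= \sum_(i | g i == j) bary t i.
Proof. by apply: sumr_ge0 => i _; apply: bary_ge0. Qed.

Lemma push_sum (t : geosimplex I) : \sum_j \sum_(i | g i == j) bary t i = 1.
Proof.
rewrite -(bary_sum t) [RHS](partition_big g xpredT) //=.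
Qed.

(** The affine map that sends the vertex [i] to the vertex [g i]. *)
Definition push (t : geosimplex I) : geosimplex J := simplex_point (push_ge0 t) (push_sum t).

Lemma bary_push t j : bary (push t) j = \sum_(i | g i == j) bary t i.
Proof. by rewrite baryE. Qed.

Lemma continuous_push : continuous push.
Proof.
apply: continuous_into_simplex => j.
under [X in continuous X]eq_fun => t do rewrite bary_push.
by apply: continuous_sum_r => i _; apply: continuous_bary.
Qed.

Lemma bary_push_inj t i : injective g -> bary (push t) (g i) = bary t i.
Proof.
move=> gi; rewrite bary_push (bigD1 i)//= big1 ?addr0// => i' /andP[/eqP/gi -> ].
by rewrite eqxx.
Qed.

Lemma bary_push_out t j : (forall i, g i != j) -> bary (push t) j = 0.
Proof. by move=> gj; rewrite bary_push big1 // => i; rewrite (negPf (gj i)). Qed.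

End Push.

Lemma push_id (I : finType) (t : geosimplex I) : push id t = t.
Proof. by apply: bary_inj => i; rewrite (@bary_push_inj _ _ id). Qed.

Lemma push_comp (I J L : finType) (g : I -> J) (h : J -> L) (t : geosimplex I) :
  push h (push g t) = push (h \o g) t.
Proof.
apply: bary_inj => l; rewrite !bary_push.
under eq_bigr do rewrite bary_push.
rewrite (exchange_big_dep (fun i => h (g i) == l)) /=; last by move=> j i /eqP <- /eqP <-.
apply: eq_bigr => i il; rewrite (bigD1 (g i)) ?il ?eqxx//= big1 ?addr0// => j.
by move=> /andP[/andP[_ /eqP ->]]; rewrite eqxx.
Qed.

Lemma geosimplex0 : geosimplex 'I_0 -> False.
Proof.
move=> t; have := bary_sum t; rewrite big_ord0 => /esym/eqP.
by rewrite oner_eq0.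
Qed.

Section Sing.
Variable Z : topologicalType.

Definition sing_car (I : finType) := {s : geosimplex I -> Z | continuous s}.

Lemma sing_eq (I : finType) (s s' : sing_car I) :
  (forall t, sval s t = sval s' t) -> s = s'.
Proof.
case: s s' => [s cs] [s' cs'] /= /funext e; subst.
by rewrite (Prop_irrelevance cs cs').
Qed.

Lemma sing_act_subproof (I J : finType) (g : I -> J) (s : sing_car J) :
  continuous (sval s \o push g).
Proof.
by move=> t; apply: continuous_comp; [apply: continuous_push | apply: (proj2_sig s)].
Qed.

Definition sing_act (I J : finType) (g : I -> J) (s : sing_car J) : sing_car I :=
  exist _ (sval s \o push g) (@sing_act_subproof I J g s).

Lemma sing_act_id (I : finType) (s : sing_car I) : sing_act id s = s.
Proof. by apply: sing_eq => t /=; rewrite push_id. Qed.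

Lemma sing_act_comp (I J L : finType) (g : I -> J) (h : J -> L) (s : sing_car L) :
  sing_act g (sing_act h s) = sing_act (h \o g) s.
Proof. by apply: sing_eq => t /=; rewrite push_comp. Qed.

Lemma sing_pt_subproof :
  continuous (fun t : geosimplex 'I_0 => False_rect Z (geosimplex0 t)).
Proof. by move=> t; case: (geosimplex0 t). Qed.

Definition sing_pt : sing_car 'I_0 := exist _ _ sing_pt_subproof.

Lemma sing_pt_uniq s : s = sing_pt.
Proof. by apply: sing_eq => t; case: (geosimplex0 t). Qed.

Definition sing : sset := @SSet sing_car (fun I J => @sing_act I J)
  sing_act_id sing_act_comp sing_pt sing_pt_uniq.

End Sing.

Section SingMap.
Variables (X Y : topologicalType) (p : X -> Y) (cp : continuous p).

Lemma sing_map_subproof (I : finType) (s : sing X I) : continuous (p \o sval s).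
Proof. by move=> t; apply: continuous_comp; [apply: (proj2_sig s) | apply: cp]. Qed.

Definition sing_map_fun (I : finType) (s : sing X I) : sing Y I :=
  exist _ (p \o sval s) (@sing_map_subproof I s).

Lemma sing_map_act (I J : finType) (g : I -> J) (s : sing X J) :
  sing_map_fun (act g s) = act g (sing_map_fun s).
Proof. by apply: sing_eq. Qed.

Definition sing_map : smap (sing X) (sing Y) := @SMap (sing X) (sing Y)
  sing_map_fun (fun I J => @sing_map_act I J).

End SingMap.

End Simplices.

Arguments geosimplex R I : clear implicits.
Arguments sing R Z : clear implicits.
Arguments push {R I J} g t.
Arguments bary {R I} t i.

(** * Serre fibrations are Kan fibrations *)

Section ContinuousCombinators.
Variables (S T U : topologicalType).

Lemma continuous_compose (g : T -> U) (f : S -> T) :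
  continuous g -> continuous f -> continuous (fun x => g (f x)).
Proof. by move=> cg cf x; apply: continuous_comp; [apply: cf | apply: cg]. Qed.

Lemma continuous_pair (f : S -> T) (g : S -> U) :
  continuous f -> continuous g -> continuous (fun x => (f x, g x)).
Proof.
move=> cf cg x; have := cvg_pair (cf x) (cg x).
by apply; apply: nbhs_filter.
Qed.

Lemma continuous_fst : continuous (fst : S * T -> S).
Proof. by move=> x; apply: cvg_fst. Qed.

Lemma continuous_snd : continuous (snd : S * T -> T).
Proof. by move=> x; apply: cvg_snd. Qed.

Lemma continuous_self : continuous (fun x : S => x).
Proof. by move=> x A. Qed.

Lemma continuous_const (t : T) : continuous (fun _ : S => t).
Proof. by move=> x; apply: cvg_cst. Qed.

End ContinuousCombinators.

Lemma continuous_glue (S Z : topologicalType) (I : finType) (A : I -> set S)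
    (g : I -> S -> Z) (F : S -> Z) :
  (forall i, closed (A i)) -> (forall i, continuous (g i)) ->
  (forall t, exists i, A i t) -> (forall i t, A i t -> F t = g i t) -> continuous F.
Proof.
move=> cA cg cov Fg; apply/continuous_closedP => B cB.
have -> : F @^-1` B = \bigcup_(i in [set: I]) (A i `&` (g i @^-1` B)).
  apply/seteqP; split=> [t Bt|t [i _ [At]]]; last by rewrite /= (Fg i).
  by have [i At] := cov t; exists i => //; split => //=; rewrite -(Fg i).
apply: closed_bigcup; first exact: finite_finset.
by move=> i _; apply: closedI => //; apply: preimage_closed.
Qed.

Section UnitInterval.
Variable R : realType.

Lemma unit_point_subproof (s : R) : 0 <= s <= 1 -> s \in unit_interval R.
Proof. by move=> s01; apply/mem_set; rewrite /unit_interval/= in_itv/=. Qed.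

Definition unit_point (s : R) (h : 0 <= s <= 1) : unit_interval R :=
  exist _ s (unit_point_subproof h).

Lemma unit_val01 (s : unit_interval R) : 0 <= set_val s <= 1.
Proof. by have := set_mem (valP s); rewrite /unit_interval/= in_itv. Qed.

Lemma unit_eq (s s' : unit_interval R) : set_val s = set_val s' -> s = s'.
Proof. by move=> e; apply: val_inj. Qed.

End UnitInterval.

Section HomotopyLifting.
Variables (R : realType) (X Y : topologicalType) (p : X -> Y).
Hypothesis fp : serre_fibration R p.

(** A simplex is a retract of a cube. *)
Lemma simplex_lifting (I : finType) (i0 : I) (f : geosimplex R I -> X)
    (H : geosimplex R I * unit_interval R -> Y) :
  continuous f -> continuous H -> (forall t, H (t, zero) = p (f t)) ->
  exists G : geosimplex R I * unit_interval R -> X,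
    [/\ continuous G, forall t, G (t, zero) = f t & forall z, p (G z) = H z].
Proof.
move=> cf cH Hf.
have cubeP (t : geosimplex R I) : set_val t \in cube R #|I|.
  apply/mem_set => j /=; rewrite -[j]enum_valK.
  by rewrite (bary_ge0 t (enum_val j)) (bary_le1 t (enum_val j)).
pose emb t : cube R #|I| := exist _ (set_val t) (cubeP t).
have cemb : continuous emb.
  by apply: continuous_into_set; exact: continuous_set_val.
pose cc (u : cube R #|I|) i : R := set_val u ord0 (enum_rank i).
have cc0 u i : 0 <= cc u i by have /(_ (enum_rank i)) /andP[] := set_mem (valP u).
have ccc i : continuous (fun u => cc u i).
  move=> u; apply: (@continuous_comp _ _ _ (set_val : cube R #|I| -> _) (fun M => M ord0 _)).
    exact: continuous_set_val.
  exact: coord_continuous.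
pose S u := \sum_i cc u i.
have cS : continuous S by apply: continuous_sum_r.
pose a u i := (cc u i + (if i == i0 then Num.max 0 (1 - S u) else 0)) / Num.max 1 (S u).
have m0 u : 0 < Num.max 1 (S u) by rewrite lt_max ltr01.
have a0 u i : 0 <= a u i.
  apply: divr_ge0; last exact: ltW.
  by apply: addr_ge0 => //; case: ifP => // _; rewrite le_max lexx.
have a1 u : \sum_i a u i = 1.
  rewrite -mulr_suml big_split /= -big_mkcond /= big_pred1_eq -/(S u).
  apply: (@mulIf _ (Num.max 1 (S u))); first by rewrite gt_eqF.
  rewrite mulfVK ?gt_eqF// mul1r.
  by rewrite /Num.max; do 2 case: ifP; lra.
pose r u := simplex_point (a0 u) (a1 u).
have cr : continuous r.
  apply: continuous_into_simplex => i.
  under [X in continuous X]eq_fun => u do rewrite baryE.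
  apply: continuousM_r.
    apply: continuousD_r => //; case: (i == i0); last exact: continuous_cst_r.
    apply: continuous_max_r; first exact: continuous_cst_r.
    by apply: continuousB_r => //; exact: continuous_cst_r.
  apply: continuousV_r; last by move=> u; rewrite gt_eqF.
  by apply: continuous_max_r => //; exact: continuous_cst_r.
have rK t : r (emb t) = t.
  apply: bary_inj => i; rewrite baryE /a.
  have -> : S (emb t) = 1 by rewrite -(bary_sum t).
  by rewrite subrr !maxxx divr1; case: ifP; rewrite addr0.
have cH' : continuous (fun z : cube R #|I| * unit_interval R => H (r z.1, z.2)).
  apply: (continuous_compose cH); apply: continuous_pair; last exact: continuous_snd.
  exact: continuous_compose cr (@continuous_fst _ _).
have cf' : continuous (fun u => f (r u)).
  exact: continuous_compose.
have [|G [G0 pG]] := fp.2 _ (cts_of cf') (cts_of cH'); first by move=> s; apply: Hf.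
exists (fun z => G (emb z.1, z.2)); split.
- apply: (continuous_compose (@cts_fun _ _ G)); apply: continuous_pair.
    exact: continuous_compose cemb (@continuous_fst _ _).
  exact: continuous_snd.
- by move=> t; rewrite G0 /= rK.
- by move=> [t s]; rewrite pG /= rK.
Qed.

End HomotopyLifting.

Section HornRetraction.
Variables (R : realType) (I : finType) (a : I).

Local Notation simplex := (geosimplex R I).

(** Distance to the horn with apex [a]; it is positive off the horn. *)
Definition horn_height (t : simplex) : R := \big[Num.min/1]_(i | i != a) bary t i.

Lemma horn_height_le t i : i != a -> horn_height t <= bary t i.
Proof. by move=> ia; apply: bigmin_le_cond. Qed.

Lemma horn_height01 t : 0 <= horn_height t <= 1.
Proof.
rewrite le_bigmin ?ler01//=; first exact: bigmin_le_id.
by move=> i _; apply: bary_ge0.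
Qed.

Lemma horn_heightP t : (exists i, i != a) ->
  exists2 i, i != a & horn_height t = bary t i.
Proof.
move=> [j ja]; have [|i ia e] := @eq_bigmin _ _ I 1 j (fun i => i != a) (bary t) ja.
  by move=> i _; apply: bary_le1.
by exists i.
Qed.

Lemma horn_height0 t i : i != a -> bary t i = 0 -> horn_height t = 0.
Proof.
move=> ia ti; apply/eqP; rewrite eq_le -{1}ti horn_height_le//.
by case/andP: (horn_height01 t).
Qed.

Lemma continuous_horn_height : continuous horn_height.
Proof.
rewrite /horn_height; elim: (index_enum I) => [|i r IH].
  under [X in continuous X]eq_fun => x do rewrite big_nil.
  exact: continuous_cst_r.
under [X in continuous X]eq_fun => x do rewrite big_cons.
case: (i != a) => //.
by apply: continuous_min_r => //; apply: continuous_bary.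
Qed.

Definition drop_by (t : simplex) (s : R) : R := Num.max (horn_height t - s) 0.

Lemma drop_by_ge0 t s : 0 <= drop_by t s.
Proof. by rewrite le_max lexx orbT. Qed.

Lemma drop_by_le t s i : 0 <= s -> i != a -> drop_by t s <= bary t i.
Proof.
move=> s0 ia; rewrite ge_max bary_ge0 andbT.
by apply: le_trans (horn_height_le t ia); rewrite gerBl.
Qed.

Definition slide_coord (t : simplex) (s : unit_interval R) (i : I) : R :=
  if i == a then bary t a + (drop_by t (set_val s)) *+ #|[pred i | i != a]|
  else bary t i - drop_by t (set_val s).

Lemma slide_ge0 t s i : 0 <= slide_coord t s i.
Proof.
have /andP[s0 _] := unit_val01 s.
rewrite /slide_coord; case: eqP => [_|/eqP ia].
  by rewrite addr_ge0 ?bary_ge0// mulrn_wge0// drop_by_ge0.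
by rewrite subr_ge0 drop_by_le.
Qed.

Lemma slide_sum t s : \sum_i slide_coord t s i = 1.
Proof.
rewrite -(bary_sum t) (bigD1 a)//= [RHS](bigD1 a)//= {1}/slide_coord eqxx.
rewrite (eq_bigr (fun i => bary t i - drop_by t (set_val s))); last first.
  by move=> i /negPf ia; rewrite /slide_coord ia.
rewrite big_split /= sumr_const addrACA mulNrn.
by rewrite [X in _ + X]addrN addr0.
Qed.

(** Sliding towards the apex until the horn is reached; the parameter is the
    height at which to stop. *)
Definition slide (t : simplex) (s : unit_interval R) : simplex :=
  simplex_point (slide_ge0 t s) (slide_sum t s).

Lemma continuous_slide : continuous (fun z : simplex * unit_interval R => slide z.1 z.2).
Proof.
have cc i : continuous (fun z : simplex * unit_interval R => bary z.1 i).
  exact: continuous_compose (@continuous_bary R I i) (@continuous_fst _ _).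
have cd : continuous (fun z : simplex * unit_interval R => drop_by z.1 (set_val z.2)).
  apply: continuous_max_r; last exact: continuous_cst_r.
  apply: continuousB_r.
    exact: continuous_compose continuous_horn_height (@continuous_fst _ _).
  exact: continuous_compose (@continuous_set_val _ _) (@continuous_snd _ _).
apply: continuous_into_simplex => i.
under [X in continuous X]eq_fun => z do rewrite baryE.
rewrite /slide_coord; case: (i == a); last exact: continuousB_r.
apply: continuousD_r => //.
under [X in continuous X]eq_fun => z do rewrite -mulr_natl.
by apply: continuousM_r => //; exact: continuous_cst_r.
Qed.

Lemma slide_id t s : horn_height t <= set_val s -> slide t s = t.
Proof.
move=> ts; have d0 : drop_by t (set_val s) = 0.
  by rewrite /drop_by; apply/max_idPr; rewrite subr_le0.
apply: bary_inj => i; rewrite baryE /slide_coord d0 mul0rn addr0 subr0.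
by case: eqP => // ->.
Qed.

Lemma slide_horn t : (exists i, i != a) ->
  exists2 i, i != a & bary (slide t zero) i = 0.
Proof.
move=> /(horn_heightP t)[i ia e]; exists i => //.
rewrite baryE /slide_coord (negPf ia) /drop_by.
have -> : set_val (zero : unit_interval R) = 0 by [].
rewrite subr0 (max_idPl _) ?e ?subrr//; exact: bary_ge0.
Qed.

End HornRetraction.

Lemma push_support (R : realType) (I : finType) (P : pred I) (u : geosimplex R I)
    (ka : I -> {i : I | P i}) :
  (forall i, P i -> val (ka i) = i) -> (forall i, ~~ P i -> bary u i = 0) ->
  push val (push ka u) = u.
Proof.
move=> kaP u0; rewrite push_comp; apply: bary_inj => l; rewrite bary_push.
have [Pl|Pl] := boolP (P l).
  rewrite (bigD1 l) /= ?kaP// big1 ?addr0// => i /andP[/eqP e il].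
  by apply: u0; apply: contraNN il => Pi; rewrite -e /= kaP.
rewrite u0// big1 // => i /eqP e; exfalso.
by move: Pl; rewrite -e /= (valP (ka i)).
Qed.

Section HornFilling.
Variables (R : realType) (X : topologicalType).
Variables (I : finType) (a : I).
Variable x : forall i : {i : I | i != a}, sing R X {j : I | j != val i}.
Hypothesis ia : exists i : I, i != a.
Hypothesis cx : @compatible_family (sing R X) I _
  (fun i : {i : I | i != a} => {j : I | j != val i} : finType) (fun _ => val) x.

Definition horn_apex (i : {i : I | i != a}) : {j : I | j != val i} :=
  exist (fun j => j != val i) a (introN eqP (fun e => elimN eqP (valP i) (esym e))).

Definition horn_collapse (i : {i : I | i != a}) (j : I) : {j : I | j != val i} := insubd (horn_apex i) j.

Lemma horn_collapseE i j : j != val i -> val (horn_collapse i j) = j.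
Proof. by move=> ji; rewrite /horn_collapse val_insubd ji. Qed.

Definition face_value i (u : geosimplex R I) : X := sval (x i) (push (horn_collapse i) u).

Lemma face_value_eq i i' (u : geosimplex R I) :
  bary u (val i) = 0 -> bary u (val i') = 0 -> face_value i u = face_value i' u.
Proof.
move=> ui ui'; pose L : finType := {j : I | (j != val i) && (j != val i')}.
have aL : (a != val i) && (a != val i') by rewrite (valP (horn_apex i)) (valP (horn_apex i')).
pose k (j : I) : L := insubd (exist _ a aL : L) j.
have kE j : (j != val i) && (j != val i') -> val (k j) = j.
  by move=> h; rewrite /k val_insubd h.
have <- : push val (push k u) = u.
  apply: push_support kE _ => j; rewrite negb_and !negbK.
  by move=> /orP[/eqP ->|/eqP ->].
rewrite /face_value !(push_comp val).
have := @cx i i' L (horn_collapse i \o val) (horn_collapse i' \o val).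
have h1 : val \o (horn_collapse i \o (val : L -> I)) = val.
  by apply/funext => j /=; rewrite horn_collapseE//; case/andP: (valP j).
have h2 : val \o (horn_collapse i' \o (val : L -> I)) = val.
  by apply/funext => j /=; rewrite horn_collapseE//; case/andP: (valP j).
rewrite h1 h2 => /(_ erefl) /(congr1 (fun s => sval s (push k u))).
by [].
Qed.

(** The faces of a horn glue to a continuous function on the whole simplex, via
    the retraction. *)
Lemma horn_glue : exists F : geosimplex R I -> X, continuous F /\
  forall t i, bary (slide a t zero) (val i) = 0 -> F t = face_value i (slide a t zero).
Proof.
pose r t := slide a t (zero : unit_interval R).
have cr : continuous r.
  have ct : continuous (fun t : geosimplex R I => (t, zero : unit_interval R)).
    by apply: continuous_pair; [exact: continuous_self | exact: continuous_const].
  exact: continuous_compose (@continuous_slide R I a) ct.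
have ex t : exists i : {i : I | i != a}, bary (r t) (val i) = 0.
  by have [i h e] := slide_horn t ia; exists (exist _ i h).
pose F t := face_value (sval (cid (ex t))) (r t).
have FP t i : bary (r t) (val i) = 0 -> F t = face_value i (r t).
  by move=> e; apply: face_value_eq => //; exact: (svalP (cid (ex t))).
exists F; split => //.
apply: (@continuous_glue _ _ {i : I | i != a}
  (fun i => [set t | bary (r t) (val i) = 0]) (fun i t => face_value i (r t))) => //.
- move=> i; have -> : [set t | bary (r t) (val i) = 0] =
    (fun t => bary (r t) (val i)) @^-1` [set z | z = 0] by [].
  apply: preimage_closed; last exact: closed_eq.
  by move=> t _; apply: (continuous_compose (@continuous_bary R I (val i)) cr).
- move=> i; rewrite /face_value; apply: (continuous_compose (proj2_sig (x i))).
  by apply: continuous_compose cr; apply: continuous_push.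
- by move=> i t; apply: FP.
Qed.

Lemma face_value_face i t : face_value i (push val t) = sval (x i) t.
Proof.
rewrite /face_value push_comp; have -> : horn_collapse i \o val = id; last by rewrite push_id.
by apply/funext => j /=; apply: val_inj; rewrite horn_collapseE// (valP j).
Qed.

Lemma face_coord0 (i : {i : I | i != a}) (t : geosimplex R {j : I | j != val i}) :
  bary (push val t) (val i) = 0.
Proof. by apply: bary_push_out => j; exact: (valP j). Qed.

Lemma slide_face (i : {i : I | i != a}) (t : geosimplex R {j : I | j != val i}) s :
  slide a (push val t) s = push val t.
Proof.
apply: slide_id; rewrite (horn_height0 (valP i) (face_coord0 t)).
by case/andP: (unit_val01 s).
Qed.

Lemma push_ka i (u : geosimplex R I) : bary u (val i) = 0 -> push val (push (horn_collapse i) u) = u.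
Proof.
move=> ui; apply: (@push_support R I (fun j => j != val i)); first exact: horn_collapseE.
by move=> j; rewrite negbK => /eqP ->.
Qed.

End HornFilling.

Lemma sing_kan_complex (R : realType) (Z : topologicalType) : kan_complex (sing R Z).
Proof.
move=> I a x [] ia cx _; have [F [cF FP]] := horn_glue ia cx.
exists (exist _ F cF : sing R Z I) => // i; apply: sing_eq => t /=.
by rewrite (FP _ i) slide_face ?face_value_face// face_coord0.
Qed.

(** Sliding deforms the simplex into the horn, over which a lift is given; lifting
    the deformation backwards and stopping at the height of each point lifts the
    simplex and fixes the horn. *)
Lemma sing_map_kan (R : realType) (X Y : topologicalType) (p : X -> Y)
    (cp : continuous p) : serre_fibration R p -> kan (sing_map R cp).
Proof.
move=> fp I a x y ia cx px; have [F [cF FP]] := horn_glue ia cx.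
have cH : continuous (fun z : geosimplex R I * unit_interval R => sval y (slide a z.1 z.2)).
  exact: continuous_compose (proj2_sig y) (@continuous_slide R I a).
have [t|G [cG G0 pG]] := simplex_lifting fp a cF cH.
  have [i h e] := slide_horn t ia; pose i' : {i : I | i != a} := exist _ i h.
  transitivity (sval y (push val (push (horn_collapse i') (slide a t zero)))).
    by congr (sval y _); exact: esym (@push_ka R I a i' _ e).
  rewrite (FP t i')//.
  by have /(congr1 (fun s => sval s (push (horn_collapse i') (slide a t zero)))) := px i'.
pose hh t : unit_interval R := unit_point (horn_height01 a t).
have chh : continuous hh.
  by apply: continuous_into_set; exact: continuous_horn_height.
have cz : continuous (fun t => G (t, hh t)).
  apply: (continuous_compose cG); apply: continuous_pair => //.
  exact: continuous_self.
exists (exist _ _ cz : sing R X I).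
  by apply: sing_eq => t /=; rewrite pG /= slide_id.
move=> i; apply: sing_eq => t /=.
have -> : hh (push val t) = zero.
  by apply: unit_eq; apply: (horn_height0 (valP i)); exact: face_coord0.
by rewrite G0 (FP _ i) slide_face ?face_value_face// face_coord0.
Qed.

(** * Paths and loops as singular simplices *)

Section Paths.
Variables (R : realType) (Z : topologicalType).

Lemma dot_subproof : \sum_(i < 1) (1 : R) = 1.
Proof. by rewrite big_ord1. Qed.

Definition dot : geosimplex R 'I_1 := simplex_point (fun _ => ler01) dot_subproof.

Lemma dot_uniq (t : geosimplex R 'I_1) : t = dot.
Proof.
apply: bary_inj => i; rewrite baryE [i]ord1.
by have := bary_sum t; rewrite big_ord1.
Qed.

Definition vertex_of (z : Z) : sing R Z 'I_1 :=
  exist _ (fun _ => z) (@continuous_const _ _ z).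

Lemma vertex_eq (w : sing R Z 'I_1) : w = vertex_of (sval w dot).
Proof. by apply: sing_eq => t /=; rewrite [t]dot_uniq. Qed.

Lemma bary01 (I : finType) (t : geosimplex R I) i : 0 <= bary t i <= 1.
Proof. by rewrite bary_ge0 bary_le1. Qed.

Lemma segment_ge0 (s : unit_interval R) (i : 'I_2) :
  0 <= if i == i20 then 1 - set_val s else set_val s.
Proof. by have /andP[s0 s1] := unit_val01 s; case: ifP => _ //; rewrite subr_ge0. Qed.

Lemma segment_sum (s : unit_interval R) :
  \sum_(i < 2) (if i == i20 then 1 - set_val s else set_val s) = 1.
Proof. by rewrite !big_ord_recl big_ord0 /= addr0 subrK. Qed.

Definition segment (s : unit_interval R) : geosimplex R 'I_2 :=
  simplex_point (segment_ge0 s) (segment_sum s).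

Lemma continuous_segment : continuous segment.
Proof.
apply: continuous_into_simplex => i.
under [X in continuous X]eq_fun => s do rewrite baryE.
case: (i == i20); last exact: continuous_set_val.
by apply: continuousB_r; [exact: continuous_cst_r | exact: continuous_set_val].
Qed.

Definition segment_inv (t : geosimplex R 'I_2) : unit_interval R :=
  unit_point (bary01 t i21).

Lemma continuous_segment_inv : continuous segment_inv.
Proof. by apply: continuous_into_set; exact: continuous_bary. Qed.

Lemma bary2 (t : geosimplex R 'I_2) : bary t i20 = 1 - bary t i21.
Proof.
by have := bary_sum t; rewrite !big_ord_recl big_ord0 addr0 => <-; rewrite addrK.
Qed.

Lemma segmentK t : segment (segment_inv t) = t.
Proof.
by apply: bary_inj => i; rewrite baryE; case: (ord2P i) => -> //=; rewrite bary2.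
Qed.

Lemma segment_cst (i : 'I_2) : push (cst_ord i) dot =
  segment (if i == i20 then zero else one).
Proof.
apply: bary_inj => j; rewrite [RHS]baryE; have [ji|ji] := eqVneq j i.
  have -> : bary (push (cst_ord i) dot) j = 1.
    by rewrite ji (bary_push_inj dot ord0 (@cst_ord_inj _ i)) baryE.
  by rewrite ji; case: (ord2P i) => ->; rewrite /= /set_val /= ?subr0.
rewrite bary_push_out; last by move=> l; rewrite /cst_ord eq_sym.
by move: ji; case: (ord2P i) => ->; case: (ord2P j) => -> //= _;
  rewrite /set_val /= ?subrr.
Qed.

Lemma edge_vertex (e : sing R Z 'I_2) (i : 'I_2) :
  act (cst_ord i) e = vertex_of (sval e (segment (if i == i20 then zero else one))).
Proof. by rewrite [LHS]vertex_eq /= segment_cst. Qed.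

Definition edge_of (p : unit_interval R -> Z) (cp : continuous p) : sing R Z 'I_2 :=
  exist _ (fun t => p (segment_inv t)) (continuous_compose cp continuous_segment_inv).

Lemma segment_invK s : segment_inv (segment s) = s.
Proof. by apply: unit_eq; exact: baryE. Qed.

Lemma le_half (a : R) : a <= 2^-1 -> 2^-1 <= 1 - a /\ 0 < 1 - a.
Proof. by split; lra. Qed.

Lemma ge_half (a : R) : 2^-1 < a -> 1 <= 2 * a.
Proof. by lra. Qed.

Hypothesis scZ : simply_connected R Z.

Lemma sing_path_connected (y : Z) : path_connected_from (vertex_of y).
Proof.
move=> w; have [_ pc _] := scZ; have [g] := pc y (sval w dot).
exists (edge_of (@cts_fun _ _ g)).
by rewrite !edge_vertex /= !segment_invK path_zero path_one -vertex_eq.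
Qed.

(** A disc that bounds a loop, reparametrised by a triangle: the first side runs
    along the loop, and the other two stay in the part of the boundary of the
    square that is sent to the base point. *)
Lemma sing_loops_bound : loops_bound (sing R Z).
Proof.
move=> z e e0 e1; have [_ _ nh] := scZ; pose zp := sval z dot.
pose p s := sval e (segment s).
have cp : continuous p.
  exact: continuous_compose (proj2_sig e) continuous_segment.
have p0 : p zero = zp.
  by rewrite /zp -e0 edge_vertex.
have p1 : p one = zp.
  by rewrite /zp -e1 edge_vertex.
clear e0 e1; have [H [H0 H1 Hz Ho]] := nh zp (mk_path cp p0 p1).
pose den (x : geosimplex R 'I_3) : R := Num.max (bary x i30 + bary x i31) (2^-1).
have den0 x : 0 < den x by rewrite lt_max invr_gt0 ltr0n orbT.
have sP x : 0 <= bary x i31 / den x <= 1.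
  apply/andP; split; first by apply: divr_ge0; [exact: bary_ge0 | exact: ltW].
  by rewrite ler_pdivrMr// mul1r le_max lerDr bary_ge0.
have tP (x : geosimplex R 'I_3) : 0 <= Num.min 1 (2 * bary x i32) <= 1.
  by rewrite le_min ler01 mulr_ge0 ?bary_ge0//= ge_min lexx.
pose F x := H (unit_point (sP x), unit_point (tP x)).
have cF : continuous F.
  apply: (continuous_compose (@cts_fun _ _ H)); apply: continuous_pair.
    apply: continuous_into_set; apply: continuousM_r; first exact: continuous_bary.
    apply: continuousV_r; last by move=> x; rewrite gt_eqF.
    apply: continuous_max_r; last exact: continuous_cst_r.
    by apply: continuousD_r; exact: continuous_bary.
  apply: continuous_into_set; apply: continuous_min_r; first exact: continuous_cst_r.
  by apply: continuousM_r; [exact: continuous_cst_r | exact: continuous_bary].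
have zE (u : geosimplex R 'I_2) : sval z (push (fun _ => ord0) u) = zp.
  by rewrite [push _ _]dot_uniq.
have bE (m : 'I_2 -> 'I_3) (u : geosimplex R 'I_2) (i : 'I_2) : injective m -> bary (push m u) (m i) = bary u i.
  by move=> mi; apply: bary_push_inj.
have e01 : injective (edge i30 i31) by apply: edge_inj.
have e12 : injective (edge i31 i32) by apply: edge_inj.
have e02 : injective (edge i30 i32) by apply: edge_inj.
have out (m : 'I_2 -> 'I_3) j : m i20 != j -> m i21 != j ->
    forall u : geosimplex R 'I_2, bary (push m u) j = 0.
  move=> m0 m1 u; apply: bary_push_out => i.
  by case: (ord2P i) => ->.
exists (exist _ F cF : sing R Z 'I_3); split; apply: sing_eq => u /=; rewrite /F.
- have x2 := out (edge i30 i31) i32 isT isT u.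
  have x0 : bary (push (edge i30 i31) u) i30 = bary u i20 := bE _ u i20 e01.
  have x1 : bary (push (edge i30 i31) u) i31 = bary u i21 := bE _ u i21 e01.
  have -> : unit_point (tP (push (edge i30 i31) u)) = zero.
    by apply: unit_eq; rewrite /set_val /= x2 mulr0; apply/min_idPr; exact: ler01.
  rewrite H0 /= /mk_path /p -[in RHS](segmentK u); congr (sval e (segment _)).
  apply: unit_eq; rewrite /set_val /= /den x0 x1 bary2 subrK.
  by rewrite (max_idPl _) ?divr1// invf_le1 ?ler1n ?ltr0n.
- have x0 := out (edge i31 i32) i30 isT isT u.
  have x1 : bary (push (edge i31 i32) u) i31 = bary u i20 := bE _ u i20 e12.
  have x2 : bary (push (edge i31 i32) u) i32 = bary u i21 := bE _ u i21 e12.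
  rewrite zE; have [u1|u1] := leP (bary u i21) (2^-1).
    have -> : unit_point (sP (push (edge i31 i32) u)) = one.
      have [h1 h2] := le_half u1; apply: unit_eq.
      by rewrite /set_val /= /den x0 x1 add0r bary2 (max_idPl h1) divff// gt_eqF.
    exact: Ho.
  have -> : unit_point (tP (push (edge i31 i32) u)) = one.
    by apply: unit_eq; rewrite /set_val /= x2; apply/min_idPl/ge_half.
  exact: H1.
- have x1 := out (edge i30 i32) i31 isT isT u.
  have -> : unit_point (sP (push (edge i30 i32) u)) = zero.
    by apply: unit_eq; rewrite /set_val /= x1 mul0r.
  by rewrite zE Hz.
Qed.

End Paths.

(** * Moore loops *)

Section SubspaceTopology.
Variables (T : topologicalType) (A : set T).

Lemma compact_set_type : compact A -> compact [set: A].
Proof.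
move=> cA F PF _; have [|p [Ap clp]] := cA (fmap (set_val : A -> T) F) (fmap_proper_filter _ PF).
  by apply: (@filterS _ F _ setT); [move=> t _; exact: set_valP | exact: filterT].
exists (exist _ p (mem_set Ap)); split => // B C FB.
rewrite nbhsE => -[O [[W oW WO] Op] OC].
have [||t [[b Bb <-] Wb]] := clp (set_val @` B) W.
- by apply: (@filterS _ F _ B) FB => b Bb; exists b.
- by apply: open_nbhs_nbhs; split => //; move: Op; rewrite -WO.
by exists b; split => //; apply: OC; rewrite -WO.
Qed.

Lemma hausdorff_set_type : hausdorff_space T -> hausdorff_space A.
Proof.
move=> hT p q clpq; apply: val_inj; apply: hT => B C pB qC.
have [t [tB tC]] := clpq _ _ (continuous_set_val pB) (continuous_set_val qC).
by exists (set_val t).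
Qed.

End SubspaceTopology.

Section LoopSpace.
Variables (R : realType) (Y : topologicalType) (y : Y).

Local Notation H := (half_line R).

Lemma half_point_subproof (s : R) : 0 <= s -> s \in half_line R.
Proof. by move=> s0; apply/mem_set; rewrite /half_line/= in_itv/= s0. Qed.

Definition half_point (s : R) (s0 : 0 <= s) : H := exist _ s (half_point_subproof s0).

Lemma half_pointE (s : R) (s0 : 0 <= s) : set_val (half_point s0) = s.
Proof. by []. Qed.

Lemma half_val0 (s : H) : 0 <= set_val s.
Proof. by have := set_mem (valP s); rewrite /half_line/= in_itv /= andbT. Qed.

Lemma max0_ge0 (s : R) : 0 <= Num.max s 0.
Proof. by rewrite le_max lexx orbT. Qed.

Lemma half_line_locally_compact : locally_compact [set: H].
Proof.
move=> x _; pose r (s : R) : H := half_point (max0_ge0 s).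
have cr : continuous r.
  apply: continuous_into_set; apply: continuous_max_r; last exact: continuous_cst_r.
  exact: continuous_self.
(* A compact neighbourhood is obtained by retracting the line onto the half line. *)
have cB : compact (r @` `[0, set_val x + 1]).
  apply: continuous_compact; last exact: segment_compact.
  exact: continuous_subspaceT.
have hH : hausdorff_space H := hausdorff_set_type (@Rhausdorff R).
exists (r @` `[0, set_val x + 1]); last by split => //; apply: compact_closed.
rewrite withinET; have : nbhs x (set_val @^-1` [set s : R | s < set_val x + 1]).
  apply: continuous_set_val; apply: open_nbhs_nbhs; split; first exact: open_lt.
  by rewrite /= ltrDl ltr01.
apply: filterS => s /= sx; exists (set_val s); last first.
  by apply: val_inj; apply/max_idPl/half_val0.
by rewrite in_itv /= half_val0 ltW.
Qed.

(** ** Families of Moore loops as functions of two variables *)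

Definition mev (w : moore_loop_space R y) (s : H) : Y :=
  ((set_val w).1 : H -> Y) s.

Definition mlen (w : moore_loop_space R y) : R := set_val (set_val w).2.

Lemma moore_eq w w' : (forall s, mev w s = mev w' s) -> mlen w = mlen w' -> w = w'.
Proof.
move=> e l; apply: val_inj; rewrite [LHS]surjective_pairing [RHS]surjective_pairing.
by congr pair; [apply/funext | apply: val_inj].
Qed.

Lemma mlen_ge0 w : 0 <= mlen w. Proof. exact: half_val0. Qed.

Lemma mev_continuous w : continuous (mev w).
Proof. by have [c _ _] := set_mem (valP w). Qed.

Lemma mev_zero w s : set_val s = 0 -> mev w s = y.
Proof. by have [_ h _] := set_mem (valP w); apply: h. Qed.

Lemma mev_end w s : mlen w <= set_val s -> mev w s = y.
Proof. by have [_ _ h] := set_mem (valP w); apply: h. Qed.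

Lemma continuous_mlen : continuous mlen.
Proof.
apply: (continuous_compose (@continuous_set_val R _)).
apply: (continuous_compose (@continuous_snd _ _)).
exact: continuous_set_val.
Qed.

Section Family.
Variable T : topologicalType.

(** The half line is locally compact, so that evaluation is jointly continuous for
    the compact-open topology. *)
Lemma continuous_mev (w : T -> moore_loop_space R y) : continuous w ->
  continuous (fun z : T * H => mev (w z.1) z.2).
Proof.
move=> cw; pose g t : {compact-open, H -> Y} := (set_val (w t)).1.
have cg : continuous g.
  apply: (continuous_compose (@continuous_fst _ _)).
  exact: continuous_compose (@continuous_set_val _ _) cw.
have hH : hausdorff_space H := hausdorff_set_type (@Rhausdorff R).
have -> : (fun z : T * H => mev (w z.1) z.2) = uncurry g by apply/funext => -[].
exact: (@continuous_uncurry T H Y g half_line_locally_compact hH cg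
  (fun t => @mev_continuous (w t))).
Qed.

Variables (G : T * H -> Y) (l : T -> R).
Hypotheses (cG : continuous G) (cl : continuous l) (l0 : forall t, 0 <= l t).
Hypothesis G0 : forall t s, set_val s = 0 -> G (t, s) = y.
Hypothesis Gl : forall t s, l t <= set_val s -> G (t, s) = y.

Lemma moore_family_subproof t :
  ((fun s => G (t, s)) : {compact-open, H -> Y}, half_point (l0 t)) \in moore_loop y.
Proof.
apply/mem_set; split => /=; last 2 first.
- by move=> s; apply: G0.
- by move=> s; apply: Gl.
apply: (continuous_compose cG); apply: continuous_pair; last exact: continuous_self.
exact: continuous_const.
Qed.

Definition moore_family t : moore_loop_space R y :=
  exist (fun x => x \in @moore_loop R Y y) _ (moore_family_subproof t).

Lemma continuous_moore_family : continuous moore_family.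
Proof.
apply: continuous_into_set.
have cc : continuous (curry G : T -> {compact-open, H -> Y}).
  exact: continuous_curry_fun.
by apply: (continuous_pair cc); apply: continuous_into_set.
Qed.

End Family.

End LoopSpace.

(** ** Joins with a point *)

Section Compactness.
Variable R : realType.

Lemma compact_simplex (J : finType) : compact [set: geosimplex R J].
Proof.
apply: compact_set_type.
have cK : compact [set v : 'rV[R]_#|J| | forall i, `[(0 : R), 1]%classic (v ord0 i)].
  exact: (@rV_compact R _ (fun _ => `[(0 : R), 1]%classic) (fun _ => @segment_compact R 0 1)).
apply: subclosed_compact _ cK _; last first.
  move=> t [t0 t1] j /=; rewrite in_itv /= t0 -t1 (bigD1 j)//= lerDl sumr_ge0// => i _.
have -> : geosimplex R J =
    (\bigcap_(j in [set: 'I_#|J|]) [set t | 0 <= t ord0 j]) `&` [set t | \sum_j t ord0 j = 1].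
  apply/seteqP; split=> t [t0 t1]; split => // j; last exact: t0.
  by move=> _; exact: t0.
have cc j : continuous (fun t : 'rV[R]_#|J| => t ord0 j) by exact: coord_continuous.
apply: closedI.
  apply: closed_bigI => j _.
  by apply: (@preimage_closed _ _ (fun t : 'rV[R]_#|J| => t ord0 j) [set a | 0 <= a]);
    [move=> t _; exact: cc | exact: closed_ge].
apply: (@preimage_closed _ _ (fun t : 'rV[R]_#|J| => \sum_j t ord0 j) [set a | a = 1]).
  move=> t _; apply: (@continuous_sum_r R 'rV[R]_#|J| 'I_#|J| (index_enum _) xpredT
    (fun j (t : 'rV[R]_#|J|) => t ord0 j)) => j _.
  exact: cc.
exact: closed_eq.
Qed.

Lemma hausdorff_simplex (J : finType) : hausdorff_space (geosimplex R J).
Proof. by apply: hausdorff_set_type; exact: norm_hausdorff. Qed.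

Lemma compact_unit_interval : compact [set: unit_interval R].
Proof. by apply: compact_set_type; exact: segment_compact. Qed.

End Compactness.

Section PointJoin.
Variables (R : realType) (J : finType).
Implicit Types (t : geosimplex R J) (s : unit_interval R).

Definition join_bary t s (x : 'I_1 + J) : R :=
  match x with inl _ => 1 - set_val s | inr j => set_val s * bary t j end.

Lemma join_bary_ge0 t s x : 0 <= join_bary t s x.
Proof.
have /andP[s0 s1] := unit_val01 s; case: x => [_|j] /=; first by rewrite subr_ge0.
by rewrite mulr_ge0// bary_ge0.
Qed.

Lemma join_bary_sum t s : \sum_x join_bary t s x = 1.
Proof. by rewrite big_sumType /= big_ord1 -mulr_sumr bary_sum mulr1 subrK. Qed.

(** The point that divides the segment from the cone point to [t]. *)
Definition point_join t s : geosimplex R ('I_1 + J)%type :=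
  simplex_point (join_bary_ge0 t s) (join_bary_sum t s).

Lemma continuous_point_join :
  continuous (fun z : geosimplex R J * unit_interval R => point_join z.1 z.2).
Proof.
have c2 : continuous (fun z : geosimplex R J * unit_interval R => set_val z.2 : R).
  exact: continuous_compose (@continuous_set_val _ _) (@continuous_snd _ _).
apply: continuous_into_simplex => -[o|j];
  under [X in continuous X]eq_fun => z do rewrite baryE /=.
  by apply: continuousB_r => //; exact: continuous_cst_r.
apply: continuousM_r => //.
exact: continuous_compose (@continuous_bary R J j) (@continuous_fst _ _).
Qed.

Lemma bary_cone_point (x : 'I_1 + J) :
  bary (push inl (dot R)) x = if x is inl _ then 1 else 0.
Proof.
case: x => [o|j]; last by rewrite bary_push_out.
by rewrite bary_push_inj ?baryE// => a b [].
Qed.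

Lemma point_join0 t s : set_val s = 0 -> point_join t s = push inl (dot R).
Proof.
move=> s0; apply: bary_inj => x; rewrite baryE bary_cone_point.
by case: x => [o|j] /=; rewrite s0 ?subr0 ?mul0r.
Qed.

Lemma point_join1 t s : set_val s = 1 -> point_join t s = push inr t.
Proof.
move=> s1; apply: bary_inj => -[o|j]; rewrite baryE /= s1 ?subrr ?mul1r.
  by rewrite bary_push_out.
by rewrite bary_push_inj// => a b [].
Qed.

Lemma point_joinP (z : geosimplex R ('I_1 + J)%type) :
  z = push inl (dot R) \/ exists t s, z = point_join t s.
Proof.
pose s := \sum_j bary z (inr j).
have zs : bary z (inl ord0) + s = 1.
  by rewrite -(bary_sum z) big_sumType /= big_ord1.
have s0 : 0 <= s by apply: sumr_ge0 => j _; exact: bary_ge0.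
have [s00|sn0] := eqVneq s 0.
  left; apply: bary_inj => x; rewrite bary_cone_point; case: x => [o|j].
    by rewrite [o]ord1 -zs s00 addr0.
  apply/eqP; rewrite eq_le bary_ge0 andbT -s00 /s (bigD1 j)//= lerDl sumr_ge0// => i _.
  exact: bary_ge0.
right; have a0 j : 0 <= bary z (inr j) / s by rewrite divr_ge0// bary_ge0.
have a1 : \sum_j bary z (inr j) / s = 1 by rewrite -mulr_suml divff.
have s01 : 0 <= s <= 1 by rewrite s0 -zs lerDr bary_ge0.
exists (simplex_point a0 a1), (unit_point s01); apply: bary_inj => -[o|j]; rewrite baryE /=.
  by rewrite [o]ord1 -zs addrK.
by rewrite baryE mulrC divfK.
Qed.

Lemma point_join_inj t t' s s' : point_join t s = point_join t' s' ->
  s = s' /\ (set_val s = 0 \/ t = t').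
Proof.
move=> e; have ss : set_val s = set_val s'.
  have := congr1 (bary^~ (inl ord0)) e; rewrite !baryE /= => /addrI.
  exact: oppr_inj.
split; first exact: unit_eq.
have [s0|s0] := eqVneq (set_val s) 0; [by left | right].
apply: bary_inj => j; have := congr1 (bary^~ (inr j)) e; rewrite !baryE /= -ss.
exact: mulfI.
Qed.

End PointJoin.

Lemma push_point_join (R : realType) (J J' : finType) (h : J' -> J)
    (t : geosimplex R J') (s : unit_interval R) :
  push (joinmap id h) (point_join t s) = point_join (push h t) s.
Proof.
apply: bary_inj => -[o|j]; rewrite bary_push baryE big_sumType /=.
  rewrite [X in _ + X]big_pred0 ?addr0//.
  by rewrite [o]ord1 (eq_bigl (pred1 ord0)) ?big_pred1_eq ?baryE// => i; rewrite [i]ord1.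
rewrite [X in X + _]big_pred0 ?add0r//.
by rewrite bary_push mulr_sumr; apply: eq_bigr => i _; rewrite baryE.
Qed.

(** ** Simplicial loops are Moore loops *)

Section LoopComparison.
Variables (R : realType) (Y : topologicalType) (y : Y).

Local Notation H := (half_line R).
Local Notation Om := (moore_loop_space R y).
Local Notation yv := (vertex_of R y).

(** The homotopy fibre of the inclusion of the base point. *)
Definition simplicial_loops : sset := hfibre (const_map yv) yv.

Local Notation P := simplicial_loops.

Definition total_simplex (J : finType) (e : P J) : sing R Y ('I_1 + J)%type :=
  (sval (sval e)).1.

Lemma total_simplex_inj (J : finType) (e e' : P J) :
  total_simplex e = total_simplex e' -> e = e'.
Proof. by move=> ee; apply: hfibre_eq; apply: kcar_eq => //; case: (_.2); case: (_.2). Qed.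

Lemma total_simplex_cone (J : finType) (e : P J) :
  sval (total_simplex e) (push inl (dot R)) = y.
Proof. by have := proj2_sig e => /(congr1 (fun s => sval s (dot R))). Qed.

Lemma total_simplex_base (J : finType) (e : P J) t :
  sval (total_simplex e) (push inr t) = y.
Proof. by have /(congr1 (fun s => sval s t)) := proj2_sig (sval e). Qed.

Lemma clip01 (s : H) : 0 <= Num.min (set_val s) 1 <= 1.
Proof. by rewrite le_min half_val0 ler01 ge_min lexx orbT. Qed.

Definition clip (s : H) : unit_interval R := unit_point (clip01 s).

Lemma continuous_clip : continuous clip.
Proof.
apply: continuous_into_set; apply: continuous_min_r; last exact: continuous_cst_r.
exact: continuous_set_val.
Qed.

Section UnitLoop.
Variables (J : finType) (e : P J).

Definition unit_eval (z : geosimplex R J * H) : Y :=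
  sval (total_simplex e) (point_join z.1 (clip z.2)).

Lemma continuous_unit_eval : continuous unit_eval.
Proof.
have c : continuous (fun z : geosimplex R J * H => (z.1, clip z.2)).
  apply: continuous_pair; first exact: continuous_fst.
  exact: continuous_compose continuous_clip (@continuous_snd _ _).
have cj := continuous_compose (@continuous_point_join R J) c.
exact: continuous_compose (proj2_sig (total_simplex e)) cj.
Qed.

Lemma unit_eval0 t (s : H) : set_val s = 0 -> unit_eval (t, s) = y.
Proof.
move=> s0; rewrite /unit_eval point_join0 ?total_simplex_cone//.
by rewrite /set_val /= s0; apply/min_idPl/ler01.
Qed.

Lemma unit_eval1 t (s : H) : 1 <= set_val s -> unit_eval (t, s) = y.
Proof.
move=> s1; rewrite /unit_eval point_join1 ?total_simplex_base//.
by rewrite /set_val /=; apply/min_idPr.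
Qed.

Definition unit_loop_fun : geosimplex R J -> Om :=
  moore_family continuous_unit_eval (fun _ => ler01) unit_eval0 unit_eval1.

Lemma continuous_unit_loop : continuous unit_loop_fun.
Proof. by apply: continuous_moore_family; exact: continuous_cst_r. Qed.

Definition unit_loop_car : sing R Om J := exist _ unit_loop_fun continuous_unit_loop.

End UnitLoop.

Lemma mev_unit_loop (J : finType) (e : P J) t s :
  mev (sval (unit_loop_car e) t) s = sval (total_simplex e) (point_join t (clip s)).
Proof. by []. Qed.

Lemma unit_loop_act (I J : finType) (g : I -> J) (e : P J) :
  unit_loop_car (act g e) = act g (unit_loop_car e).
Proof.
apply: sing_eq => t; apply: moore_eq => // s.
by rewrite [RHS]mev_unit_loop -push_point_join.
Qed.

Definition unit_loop : smap P (sing R Om) :=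
  @SMap P (sing R Om) unit_loop_car unit_loop_act.

Definition unit_half (s : unit_interval R) : H :=
  half_point (proj1 (andP (unit_val01 s))).

Lemma continuous_unit_half : continuous unit_half.
Proof. by apply: continuous_into_set; exact: continuous_set_val. Qed.

Lemma clip_half s : clip (unit_half s) = s.
Proof. by apply: unit_eq; apply/min_idPl; case/andP: (unit_val01 s). Qed.

Lemma unit_loop_inj (J : finType) (e e' : P J) :
  sfun unit_loop e = sfun unit_loop e' -> e = e'.
Proof.
move=> ee; apply: total_simplex_inj; apply: sing_eq => z.
have [->|[t [s ->]]] := point_joinP z; first by rewrite !total_simplex_cone.
have /(congr1 (fun w => mev (sval w t) (unit_half s))) := ee.
by rewrite !mev_unit_loop clip_half.
Qed.

(** Families of loops of length one are adjoint to singular simplices: the join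
    with a point is a quotient of the cylinder, because a continuous map from a
    compact space to a Hausdorff one is closed. *)
Lemma unit_loop_surj (J : finType) (w : sing R Om J) :
  (forall t, mlen (sval w t) = 1) -> exists e, sfun unit_loop e = w.
Proof.
move=> w1; pose ev (z : geosimplex R J * unit_interval R) := mev (sval w z.1) (unit_half z.2).
have cev : continuous ev.
  have c : continuous (fun z : geosimplex R J * unit_interval R => (z.1, unit_half z.2)).
    apply: continuous_pair; first exact: continuous_fst.
    exact: continuous_compose continuous_unit_half (@continuous_snd _ _).
  exact: continuous_compose (continuous_mev (proj2_sig w)) c.
have ev0 t s : set_val s = 0 -> ev (t, s) = y by move=> s0; apply: mev_zero.
have ev1 t s : set_val s = 1 -> ev (t, s) = y.
  by move=> s1; apply: mev_end; rewrite w1 -s1.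
pose join (z : geosimplex R J * unit_interval R) := point_join z.1 z.2.
have exF z : exists b, (z = push inl (dot R) -> b = y) /\
    forall t s, z = point_join t s -> b = ev (t, s).
  have [->|[t [s ->]]] := point_joinP z.
    exists y; split => // t s e; rewrite ev0//.
    have := congr1 (bary^~ (inl ord0)) e; rewrite bary_cone_point baryE /= => /eqP.
    by rewrite -subr_eq0 opprB addrC subrK => /eqP.
  exists (ev (t, s)); split.
    move=> e; apply: ev0; have := congr1 (bary^~ (inl ord0)) e.
    rewrite bary_cone_point baryE /= => /eqP; rewrite eq_sym -subr_eq0 opprB addrC subrK.
    by move/eqP.
  move=> t' s' /point_join_inj[<- [s0|->]] //.
  by rewrite !ev0.
have [F FP] := choice exF.
have F0 : F (push inl (dot R)) = y by apply: (FP _).1.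
have FE t s : F (point_join t s) = ev (t, s) by apply: (FP _).2.
have cF : continuous F.
  apply/continuous_closedP => B cB.
  have -> : F @^-1` B = join @` (ev @^-1` B) `|` ([set push inl (dot R)] `&` [set z | B (F z)]).
    apply/seteqP; split=> [z Bz|z [[[t s] Bz <-]|[-> Bz]]] //=; last by rewrite FE.
    have [z0|[t [s zts]]] := point_joinP z; first by right; rewrite -z0.
    by left; exists (t, s); rewrite ?zts//= -FE -zts.
  apply: closedU.
    apply: compact_closed; first exact: hausdorff_simplex.
    apply: continuous_compact.
      by apply: continuous_subspaceT; exact: continuous_point_join.
    have cK : compact [set: geosimplex R J * unit_interval R].
      rewrite -setXTT; apply: compact_setX; first exact: compact_simplex.
      exact: compact_unit_interval.
    apply: (subclosed_compact _ cK) => //.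
    by apply: preimage_closed => // z _; exact: cev.
  have [By|By] := pselect (B y); last first.
    by rewrite (_ : _ `&` _ = set0); [exact: closed0 | apply/seteqP; split => // z [/= -> ]; rewrite F0].
  rewrite (_ : _ `&` _ = [set push inl (dot R)]).
    by apply: compact_closed; [exact: hausdorff_simplex | exact: compact_set1].
  by apply/seteqP; split=> [z [] //|z /= ->]; rewrite F0.
pose s : sing R Y ('I_1 + J)%type := exist _ F cF.
have sP : act inr s = sfun (const_map yv) (tt : point_sset J).
  by apply: sing_eq => t /=; rewrite -(@point_join1 _ _ _ one)// FE ev1.
pose e : kcar (const_map yv) 'I_1 J := exist _ (s, tt) sP.
have eP : front e = yv by apply: sing_eq => t; rewrite /= [t]dot_uniq F0.
exists (exist _ e eP); apply: sing_eq => t; apply: moore_eq; last exact: esym (w1 t).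
move=> r; rewrite mev_unit_loop [LHS]FE /ev /=.
have [r1|r1] := leP (set_val r) 1.
  by congr mev; apply: val_inj; rewrite /= /set_val /=; apply/min_idPl.
have r1' : mlen (sval w t) <= set_val r by rewrite w1 ltW.
rewrite [RHS](mev_end r1') mev_end// w1 /set_val /=.
by rewrite le_min lexx andbT ltW.
Qed.

End LoopComparison.

(** ** Moore loops contract to loops of length one *)

Section Ratio.
Variables (R : realType) (T : topologicalType) (c a D : T -> R).
Hypotheses (cc : continuous c) (ca : continuous a) (cD : continuous D).
Hypotheses (c0 : forall z, 0 <= c z) (a0 : forall z, 0 <= a z).
Hypothesis D0 : forall z, a z + c z = 0 -> D z = 0.

Lemma ratio_ge0 (x b : R) : 0 <= x -> 0 <= b -> 0 <= x / (b + x).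
Proof. by move=> x0 b0; rewrite divr_ge0// addr_ge0. Qed.

Lemma ratio_le1 (x b : R) : 0 <= x -> 0 <= b -> x / (b + x) <= 1.
Proof.
move=> x0 b0; have [e|ne] := eqVneq (b + x) 0; first by rewrite e invr0 mulr0.
by rewrite ler_pdivrMr ?mul1r ?lerDr// lt_def ne addr_ge0.
Qed.

(** The ratio is bounded, and [D] tends to 0 where the ratio is undefined. *)
Lemma continuous_ratio : continuous (fun z => c z / (a z + c z) * D z).
Proof.
have cs : continuous (fun z => a z + c z) by apply: continuousD_r.
move=> z0; have [e|ne] := eqVneq (a z0 + c z0) 0; last first.
  by apply: cvgM; [apply: cvgM; [exact: cc | apply: cvgV => //; exact: cs] | exact: cD].
suff : c z / (a z + c z) * D z @[z --> z0] --> (0 : R).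
  by rewrite /continuous_at D0// mulr0.
apply/norm_cvg0P; have nD : `|D z| @[z --> z0] --> (0 : R).
  by apply/norm_cvg0P; rewrite -(D0 e); exact: cD.
apply: (squeeze_cvgr _ (@cvg_cst _ (0 : R) _ _ _) nD).
near=> z; rewrite normr_ge0 /= normrM ler_piMl// ger0_norm ?ratio_ge0//.
by rewrite ratio_le1.
Unshelve. all: by end_near. Qed.

End Ratio.

(** A loop of length [l] is run at increasing speed until it fits into unit time,
    or is prolonged at the base point if it is short; the parameter [u] of this
    deformation runs from 0 to 1. *)
Section SpeedLength.
Variable R : realType.

Definition speed (u l : R) := 1 + u * (Num.max l 1 - 1).
Definition new_length (u l : R) := l + u * (1 - l).

Lemma speed_ge0 u l : 0 <= u -> 0 <= speed u l.
Proof. by move=> u0; rewrite addr_ge0// mulr_ge0// subr_ge0 le_max lexx orbT. Qed.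

Lemma new_length_ge0 u l : 0 <= u -> u <= 1 -> 0 <= l -> 0 <= new_length u l.
Proof.
move=> u0 u1 l0; have -> : new_length u l = (1 - u) * l + u by rewrite /new_length; ring.
by rewrite addr_ge0// mulr_ge0// subr_ge0.
Qed.

Lemma speed_length u l : 0 <= u -> u <= 1 -> 0 <= l -> l <= speed u l * new_length u l.
Proof.
move=> u0 u1 l0; rewrite /speed /new_length; have [l1|l1] := leP l 1.
  by rewrite subrr mulr0 addr0 mul1r lerDl mulr_ge0// subr_ge0.
have -> : (1 + u * (l - 1)) * (l + u * (1 - l)) = l + u * (1 - u) * (l - 1) ^+ 2 by ring.
by rewrite lerDl mulr_ge0 ?sqr_ge0// mulr_ge0// subr_ge0.
Qed.

End SpeedLength.

Section LoopCone.
Variables (R : realType) (Y : topologicalType) (y : Y) (I : finType) (i0 : I).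

Local Notation H := (half_line R).
Local Notation Om := (moore_loop_space R y).
Local Notation Psi := (unit_loop R y).

Lemma mev_congr (l l' : Om) (s s' : H) : l = l' -> set_val s = set_val s' ->
  mev l s = mev l' s'.
Proof. by move=> -> e; congr mev; apply: val_inj. Qed.

Section Cone.
Variables (n : nat) (w : sing R Om (I + 'I_n)%type).
Hypothesis wP : forall t, mlen (sval w (push inr t)) = 1.

Local Notation splx := (geosimplex R (I + 'I_n.+1)%type).

(** The ratio vanishes on the base of the cone, and is 1 on the part of the back
    face that is not in the base; it is undefined only where the given loops have
    length one already. *)
Definition apex_part (z : splx) := bary z (inr ord0).
Definition front_part m (z : geosimplex R (I + 'I_m)%type) := \sum_i bary z (inl i).
Definition cone_ratio (z : splx) := apex_part z / (front_part z + apex_part z).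
Definition base_loop (z : splx) : Om := sval w (push (merge_apex i0) z).

Lemma apex_part_ge0 z : 0 <= apex_part z. Proof. exact: bary_ge0. Qed.
Lemma front_part_ge0 m z : 0 <= @front_part m z.
Proof. by apply: sumr_ge0 => i _; exact: bary_ge0. Qed.

Lemma cone_ratio_ge0 z : 0 <= cone_ratio z.
Proof. by apply: ratio_ge0; [exact: apex_part_ge0 | exact: front_part_ge0]. Qed.

Lemma cone_ratio_le1 z : cone_ratio z <= 1.
Proof. by apply: ratio_le1; [exact: apex_part_ge0 | exact: front_part_ge0]. Qed.

Lemma continuous_base_loop : continuous base_loop.
Proof. exact: continuous_compose (proj2_sig w) (@continuous_push _ _ _ _). Qed.

Lemma back_length z : front_part z + apex_part z = 0 -> mlen (base_loop z) = 1.
Proof.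
move=> /eqP; rewrite paddr_eq0 ?front_part_ge0 ?apex_part_ge0// => /andP[/eqP f0 /eqP a0].
rewrite /base_loop; have f0' i : bary z (inl i) = 0.
  apply/eqP; rewrite eq_le bary_ge0 andbT -f0 /front_part (bigD1 i)//= lerDl.
  by apply: sumr_ge0 => j _; exact: bary_ge0.
have h0 (j : 'I_n) : 0 <= bary z (inr (lift ord0 j)) by exact: bary_ge0.
have h1 : \sum_(j < n) bary z (inr (lift ord0 j)) = 1.
  rewrite -(bary_sum z) big_sumType /= [X in _ = X + _]big1// add0r big_ord_recl.
  by rewrite [bary z (inr ord0)]a0 add0r.
pose t0 := simplex_point h0 h1.
suff -> : push (merge_apex i0) z = push inr t0 by [].
apply: bary_inj => -[i|j].
  rewrite [RHS]bary_push_out// bary_push big1 // => -[i' _|j'] //=.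
  by case: (unliftP ord0 j') => [j''|] ->.
rewrite [RHS]bary_push_inj; last by move=> a b [].
rewrite [RHS]baryE bary_push (bigD1 (inr (lift ord0 j))) /=; last by rewrite liftK.
rewrite big1 ?addr0// => x /andP[/eqP xj]; case: x xj => [i|j'] //=.
by case: (unliftP ord0 j') => [j''|] -> // [->]; rewrite eqxx.
Qed.

Definition cone_speed z := speed (cone_ratio z) (mlen (base_loop z)).
Definition cone_length z := new_length (cone_ratio z) (mlen (base_loop z)).

Lemma cone_speed_ge0 z : 0 <= cone_speed z.
Proof. by apply: speed_ge0; exact: cone_ratio_ge0. Qed.

Lemma cone_length_ge0 z : 0 <= cone_length z.
Proof.
by apply: new_length_ge0; [exact: cone_ratio_ge0 | exact: cone_ratio_le1 | exact: mlen_ge0].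
Qed.

Let cl : continuous (fun z => mlen (base_loop z)).
Proof. exact: continuous_compose (@continuous_mlen _ _ _) continuous_base_loop. Qed.

Let cfront : continuous (@front_part n.+1).
Proof. by apply: continuous_sum_r => i _; exact: continuous_bary. Qed.

Let cratio (D : splx -> R) : continuous D ->
  (forall z, front_part z + apex_part z = 0 -> D z = 0) ->
  continuous (fun z => cone_ratio z * D z).
Proof.
move=> cD D0; apply: (@continuous_ratio R _ apex_part (@front_part n.+1) D) => //.
- exact: continuous_bary.
- exact: apex_part_ge0.
- exact: front_part_ge0.
Qed.

Lemma continuous_cone_speed : continuous cone_speed.
Proof.
apply: continuousD_r; first exact: continuous_cst_r.
apply: cratio.
  apply: continuousB_r; last exact: continuous_cst_r.
  by apply: continuous_max_r => //; exact: continuous_cst_r.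
by move=> z /back_length ->; rewrite maxxx subrr.
Qed.

Lemma continuous_cone_length : continuous cone_length.
Proof.
apply: continuousD_r => //; apply: cratio.
  by apply: continuousB_r => //; exact: continuous_cst_r.
by move=> z /back_length ->; rewrite subrr.
Qed.

Lemma scaled_ge0 z (s : H) : 0 <= cone_speed z * set_val s.
Proof. by rewrite mulr_ge0// ?cone_speed_ge0// half_val0. Qed.

Definition cone_eval (z : splx * H) : Y :=
  mev (base_loop z.1) (half_point (scaled_ge0 z.1 z.2)).

Lemma continuous_cone_eval : continuous cone_eval.
Proof.
have c : continuous (fun z : splx * H => (z.1, half_point (scaled_ge0 z.1 z.2))).
  apply: continuous_pair; first exact: continuous_fst.
  apply: continuous_into_set; apply: continuousM_r.
    exact: continuous_compose continuous_cone_speed (@continuous_fst _ _).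
  exact: continuous_compose (@continuous_set_val _ _) (@continuous_snd _ _).
have := continuous_compose (continuous_mev continuous_base_loop) c.
by [].
Qed.

Lemma cone_eval0 z (s : H) : set_val s = 0 -> cone_eval (z, s) = y.
Proof. by move=> s0; apply: mev_zero; rewrite half_pointE s0 mulr0. Qed.

Lemma cone_eval1 z (s : H) : cone_length z <= set_val s -> cone_eval (z, s) = y.
Proof.
move=> ls; apply: mev_end; apply: le_trans (speed_length _ _ _) _;
  [exact: cone_ratio_ge0 | exact: cone_ratio_le1 | exact: mlen_ge0 |].
by rewrite half_pointE ler_wpM2l// cone_speed_ge0.
Qed.

Definition cone_family : splx -> Om :=
  moore_family continuous_cone_eval cone_length_ge0 cone_eval0 cone_eval1.

Definition loop_cone : sing R Om (I + 'I_n.+1)%type :=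
  exist _ cone_family (@continuous_moore_family R Y y _ cone_eval cone_length
    continuous_cone_eval continuous_cone_length cone_length_ge0 cone_eval0 cone_eval1).

Lemma mlen_loop_cone z : mlen (sval loop_cone z) = cone_length z.
Proof. by []. Qed.

Lemma mev_loop_cone z s :
  mev (sval loop_cone z) s = mev (base_loop z) (half_point (scaled_ge0 z s)).
Proof. by []. Qed.

Lemma loop_cone_base : act (joinmap id (lift ord0)) loop_cone = w.
Proof.
apply: sing_eq => t; have bE : base_loop (push (joinmap id (lift ord0)) t) = sval w t.
  by rewrite /base_loop push_comp merge_apex0 push_id.
have u0 : cone_ratio (push (joinmap id (lift ord0)) t) = 0.
  by rewrite /cone_ratio /apex_part bary_push_out ?mul0r// => -[].
apply: moore_eq => [s|].
  rewrite [LHS]mev_loop_cone; apply: (mev_congr bE).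
  by rewrite half_pointE /cone_speed u0 /speed mul0r addr0 mul1r.
by rewrite [LHS]mlen_loop_cone /cone_length u0 bE /new_length mul0r addr0.
Qed.

Lemma loop_cone_back t : mlen (sval loop_cone (push inr t)) = 1.
Proof.
rewrite mlen_loop_cone; have f0 : front_part (push inr t) = 0.
  by rewrite /front_part big1 // => i _; rewrite bary_push_out.
have [a0|a0] := eqVneq (apex_part (push inr t)) 0.
  have l1 : mlen (base_loop (push inr t)) = 1 by apply: back_length; rewrite f0 a0 addr0.
  by rewrite /cone_length l1 /new_length subrr mulr0 addr0.
rewrite /cone_length /cone_ratio f0 add0r divff// /new_length mul1r.
by rewrite addrC subrK.
Qed.

End Cone.

Lemma loop_cone_face n (w : sing R Om (I + 'I_n.+1)%type) (w' : sing R Om (I + 'I_n)%type)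
    (wP : forall t, mlen (sval w (push inr t)) = 1)
    (wP' : forall t, mlen (sval w' (push inr t)) = 1) (i : 'I_n.+1) :
  act (joinmap id (lift i)) w = w' ->
  act (joinmap id (lift (lift ord0 i))) (loop_cone wP) = loop_cone wP'.
Proof.
move=> ww; apply: sing_eq => t; set m := joinmap id _.
have mi : injective m.
  by apply: joinmap_inj => //; exact: lift_inj.
have rE : cone_ratio (push m t) = cone_ratio t.
  have aE : apex_part (push m t) = apex_part t.
    rewrite /apex_part -[in RHS](bary_push_inj t _ mi); congr bary.
    by congr inr; apply: val_inj.
  have fE : front_part (push m t) = front_part t.
    by apply: eq_bigr => j _; exact: (bary_push_inj t (inl j) mi).
  by rewrite /cone_ratio aE fE.
have bE : base_loop w (push m t) = base_loop w' t.
  by rewrite /base_loop -ww /= !push_comp merge_apex_lift.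
apply: moore_eq => [s|].
  rewrite [LHS]mev_loop_cone [RHS]mev_loop_cone; apply: (mev_congr bE).
  by rewrite !half_pointE /cone_speed rE bE.
by rewrite [LHS]mlen_loop_cone [RHS]mlen_loop_cone /cone_length rE bE.
Qed.

Lemma kcar_unit_eq (J : finType) (e e' : kcar Psi I J) :
  (sval e).1 = (sval e').1 -> e = e'.
Proof.
move=> ee; apply: kcar_eq => //; apply: unit_loop_inj.
by rewrite -(proj2_sig e) ee (proj2_sig e').
Qed.

Lemma kcar_unit_length (J : finType) (e : kcar Psi I J) t :
  mlen (sval (sval e).1 (push inr t)) = 1.
Proof.
have /(congr1 (fun s => sval s t)) /= h := proj2_sig e.
by rewrite [sval _ _]h.
Qed.

(** Loops of arbitrary length on the simplex are stretched, as the cone is climbed,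
    to loops of length one on its back face. *)
Lemma unit_loop_cone : exists h, @is_cone (vsemi Psi I) h.
Proof.
have ex n (e : vsemi Psi I n) : exists e' : vsemi Psi I n.+1,
    (sval e').1 = loop_cone (kcar_unit_length e).
  have [|d dE] := @unit_loop_surj R Y y _ (act inr (loop_cone (kcar_unit_length e))).
    by move=> t; exact: loop_cone_back.
  by exists (exist _ (loop_cone (kcar_unit_length e), d) (esym dE)).
have [h hP] : exists h : forall n (e : vsemi Psi I n), vsemi Psi I n.+1,
    forall n e, (sval (h n e)).1 = loop_cone (kcar_unit_length e).
  by exists (fun n e => sval (cid (ex n e))) => n e; exact: (svalP (cid (ex n e))).
exists h; split=> [n e|n e i]; apply: kcar_unit_eq; rewrite /= !hP.
  exact: loop_cone_base.
exact: loop_cone_face.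
Qed.

End LoopCone.

Lemma simplicial_loops_acyclic (R : realType) (k : fieldType) (Y : topologicalType) (y : Y) n :
  acyclic k (semi_of (simplicial_loops R y)) n <->
  acyclic k (semi_of (sing R (moore_loop_space R y))) n.
Proof.
apply: (@acyclic_pullback k _ _ (unit_loop R y)) => p.
by have [h hc] := unit_loop_cone R y (ord0 : 'I_p.+1); exact: cone_exact hc.
Qed.

(** * Singular cohomology and homological dimension *)

Section Acyclicity.
Variable k : fieldType.

Lemma cohomology_nonzero (C : nat -> lmodType k) (d : forall n, {linear C n -> C n.+1}) n :
  (exists x : cohomology d n, x != 0) <-> exists2 c, d n c = 0 & ~ is_coboundary d c.
Proof.
have pi0 (z : cocycles d n) :
    \pi_(cohomology d n) z = 0 :> cohomology d n <-> is_coboundary d (cochain_of z).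
  have <- : \pi_(cohomology d n) 0 = 0 :> cohomology d n.
    have := @pi_lquotD _ _ _ (@coboundary_submod_closed _ _ d n) 0 0.
    by rewrite addr0 => /eqP; rewrite -subr_eq0 opprD addrA subrr sub0r oppr_eq0 => /eqP.
  rewrite pi_lquotE subr0; split=> [|h]; last exact/asboolP.
  by rewrite unfold_in => /asboolP.
split=> [[x x0]|[c dc nc]].
  have dx : d n (cochain_of (repr x)) = 0 by case: (repr x) => c /= cc; exact/eqP.
  exists (cochain_of (repr x)) => // bx; move/eqP: x0; apply.
  by rewrite -[x]reprK; exact/pi0.
have cc : c \in cocycle d (n := n) by exact/eqP.
exists (\pi_(cohomology d n) (Cocycle cc)); apply/eqP => /pi0.
exact: nc.
Qed.

Lemma acyclic_retract (A C : sset) (f : smap A C) (g : smap C A) n :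
  (forall (I : finType) (t : A I), sfun g (sfun f t) = t) ->
  acyclic k (semi_of C) n -> acyclic k (semi_of A) n.
Proof.
move=> fgK ac c dc; have dcg : @is_cocycle k (semi_of C) k^o n (fun s => c (sfun g s)).
  move=> s; rewrite -[RHS](dc (sfun g s)) /cob; apply: eq_bigr => i _.
  by rewrite /= sfun_act.
have := ac _ dcg; case: n c {ac dc dcg} => [|n] c /=.
  by move=> h t; rewrite -[t]fgK.
move=> [w cw]; exists (fun t => w (sfun f t)) => t.
rewrite -[t in c t]fgK cw /cob; apply: eq_bigr => i _.
by rewrite /= sfun_act.
Qed.

End Acyclicity.

Section StandardSimplices.
Variables (R : realType) (n : nat).

Lemma std_ge0 (t : simplex R n) i : 0 <= set_val t ord0 i.
Proof. by have [h _] := set_mem (valP t); exact: h. Qed.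

Lemma std_sum (t : simplex R n) : \sum_i set_val t ord0 i = 1.
Proof. by have [_ h] := set_mem (valP t); exact: h. Qed.

Definition of_std (t : simplex R n) : geosimplex R 'I_n.+1 :=
  simplex_point (std_ge0 t) (std_sum t).

Lemma to_std_subproof (t : geosimplex R 'I_n.+1) : \row_i bary t i \in simplex R n.
Proof.
apply/mem_set; split=> [i|]; first by rewrite mxE bary_ge0.
by rewrite -(bary_sum t); apply: eq_bigr => i _; rewrite mxE.
Qed.

Definition to_std (t : geosimplex R 'I_n.+1) : simplex R n :=
  exist _ (\row_i bary t i) (to_std_subproof t).

Lemma to_stdE t i : set_val (to_std t) ord0 i = bary t i.
Proof. by rewrite /set_val /= mxE. Qed.

Lemma of_stdK t : to_std (of_std t) = t.
Proof. by apply/val_inj/rowP => i; rewrite [LHS]to_stdE baryE. Qed.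

Lemma to_stdK t : of_std (to_std t) = t.
Proof. by apply: bary_inj => i; rewrite baryE to_stdE. Qed.

Lemma continuous_of_std : continuous of_std.
Proof.
apply: continuous_into_simplex => i.
under [X in continuous X]eq_fun => t do rewrite baryE.
move=> t; apply: (@continuous_comp _ _ _ (set_val : simplex R n -> _) (fun M => M ord0 _)).
  exact: continuous_set_val.
exact: coord_continuous.
Qed.

Lemma continuous_to_std : continuous to_std.
Proof.
apply: continuous_into_set; apply: continuous_into_row => i.
under [X in continuous X]eq_fun => t do rewrite to_stdE.
exact: continuous_bary.
Qed.

End StandardSimplices.

Lemma of_std_face (R : realType) n (i : 'I_n.+2) (t : simplex R n) :
  of_std (face i t) = push (lift i) (of_std t).
Proof.
apply: bary_inj => j; rewrite [LHS]baryE {1}/set_val /= mxE.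
case: unliftP => [j'|] ->; last by rewrite bary_push_out// => l; rewrite eq_sym neq_lift.
by rewrite bary_push_inj ?baryE//; exact: lift_inj.
Qed.

Section SingularCohomologyAcyclic.
Variables (R : realType) (k : fieldType) (Z : topologicalType).

Definition of_singular n (s : singular_simplex R Z n) : sing R Z 'I_n.+1 :=
  exist _ (fun t => s (to_std t))
    (continuous_compose (@cts_fun _ _ s) (@continuous_to_std R n)).

Definition to_singular n (s : sing R Z 'I_n.+1) : singular_simplex R Z n :=
  cts_of (continuous_compose (proj2_sig s) (@continuous_of_std R n)).

Lemma of_singularK n : cancel (@of_singular n) (@to_singular n).
Proof. by move=> s; apply/continuousEP => t; rewrite /= of_stdK. Qed.

Lemma to_singularK n : cancel (@to_singular n) (@of_singular n).
Proof. by move=> s; apply: sing_eq => t; rewrite /= to_stdK. Qed.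

Lemma to_singular_face n (s : sing R Z 'I_n.+2) i :
  to_singular (act (lift i) s) = simplex_face (to_singular s) i.
Proof. by apply/continuousEP => t; rewrite /= of_std_face. Qed.

Lemma singular_diff_cob n (c : singular_cochain R k Z n) (s : sing R Z 'I_n.+2) :
  @cob k (semi_of (sing R Z)) k^o n.+1 (fun s => c (to_singular s)) s =
  singular_diff c (to_singular s).
Proof. by apply: eq_bigr => i _; rewrite /= to_singular_face. Qed.

Lemma singular_cohomology_nonzero n :
  (exists x : singular_cohomology R k Z n, x != 0) <->
  ~ acyclic k (semi_of (sing R Z)) n.
Proof.
pose d m : {linear singular_cochain R k Z m -> singular_cochain R k Z m.+1} :=
  @singular_diff R k Z m.
have cocyE (c : singular_cochain R k Z n) : d n c = 0 <->
    @is_cocycle k (semi_of (sing R Z)) k^o n (fun s => c (to_singular s)).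
  split=> [dc s|dc]; first by rewrite singular_diff_cob -[singular_diff c]/(d n c) dc.
  by apply/funext => s; rewrite -[s]of_singularK -[LHS]singular_diff_cob dc.
have bdE (c : singular_cochain R k Z n) : is_coboundary d c <->
    @is_bd k (semi_of (sing R Z)) k^o n (fun s => c (to_singular s)).
  case: n c {cocyE} => [|n] c /=.
    split=> [-> //|h]; apply/funext => s; by rewrite -[s]of_singularK h.
  split=> [[w <-]|[w cw]].
    by exists (fun s => w (to_singular s)) => s; rewrite singular_diff_cob.
  exists (fun s => w (of_singular s)); apply/funext => s.
  rewrite -[s]of_singularK cw -[LHS]singular_diff_cob; apply: eq_bigr => i _.
  by rewrite to_singularK.
split=> [/cohomology_nonzero[c dc nc] ac|nac].
  by apply: nc; apply/bdE; apply: ac; apply/cocyE.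
have [c dc nc] := not_acyclic nac; apply/cohomology_nonzero.
have cE : c = (fun s => c (of_singular (to_singular s))).
  by apply/funext => s; rewrite to_singularK.
exists (fun s => c (of_singular s)); first by apply/cocyE; rewrite -cE.
by move=> /bdE; rewrite -cE.
Qed.

Lemma hd_empty : (forall n, acyclic k (semi_of (sing R Z)) n) -> hd R k Z = -oo%E.
Proof.
move=> ac; rewrite /hd (_ : [set _ | j in _] = set0) ?ereal_sup0//.
by apply/seteqP; split => // x [j /singular_cohomology_nonzero []].
Qed.

Lemma hd_top m : ~ acyclic k (semi_of (sing R Z)) m ->
  (forall n, (m < n)%N -> acyclic k (semi_of (sing R Z)) n) -> hd R k Z = m%:R%:E.
Proof.
move=> nac ac; apply/eqP; rewrite eq_le; apply/andP; split.
  apply: ge_ereal_sup => x [j /singular_cohomology_nonzero nj <-].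
  by rewrite lee_fin ler_nat leqNgt; apply/negP => /ac.
by apply: ereal_sup_ubound; exists m => //; exact/singular_cohomology_nonzero.
Qed.

Lemma hd_cases : (hd R k Z < +oo)%E ->
  (forall n, acyclic k (semi_of (sing R Z)) n) \/
  exists2 m, ~ acyclic k (semi_of (sing R Z)) m &
    forall n, (m < n)%N -> acyclic k (semi_of (sing R Z)) n.
Proof.
move=> fin; have [ac|/existsNP[n0 n0ac]] := pselect (forall n, acyclic k (semi_of (sing R Z)) n).
  by left.
right; pose P n := `[< ~ acyclic k (semi_of (sing R Z)) n >].
have bound n : P n -> (n%:R%:E <= hd R k Z)%E.
  move=> /asboolP nac; apply: ereal_sup_ubound; exists n => //.
  exact/singular_cohomology_nonzero.
have [M PM] : exists M, forall n, P n -> (n <= M)%N.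
  have := bound n0 (asboolT n0ac); move: fin bound.
  case: (hd R k Z) => [r| |] // _ bound _.
  exists (Num.truncn r) => n /bound; rewrite lee_fin => nr.
  by rewrite truncn_ge_nat// (le_trans _ nr).
have exP : exists n, P n by exists n0; exact/asboolP.
exists (ex_maxn exP PM); case: ex_maxnP => m /asboolP // _ mmax n mn.
apply: contrapT => nac; have := mmax n (asboolT nac); lia.
Qed.

End SingularCohomologyAcyclic.

(** ** The singular simplices of a fibre *)

Section Fibres.
Variables (R : realType) (X Y : topologicalType) (p : X -> Y) (cp : continuous p) (y : Y).

Local Notation F := (fibre p y).
Local Notation S := (strict_fibre (sing_map R cp) (vertex_of R y)).

Lemma strict_of_fibre_subproof (J : finType) (s : sing R F J) :
  continuous (fun t => set_val (sval s t) : X).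
Proof. exact: continuous_compose (@continuous_set_val _ _) (proj2_sig s). Qed.

Lemma strict_of_fibre_subproof' (J : finType) (s : sing R F J) :
  sfun (sing_map R cp) (exist _ _ (@strict_of_fibre_subproof J s) : sing R X J) =
  act (@to_ord1 J) (vertex_of R y).
Proof. by apply: sing_eq => t; exact: (set_mem (valP (sval s t))). Qed.

Definition strict_of_fibre : smap (sing R F) S.
Proof.
apply: (@SMap (sing R F) S (fun J s => exist _ _ (strict_of_fibre_subproof' s))).
by move=> I J g s; apply: strict_eq; apply: sing_eq.
Defined.

Lemma fibre_of_strict_subproof (J : finType) (s : S J) t :
  sval (sval s) t \in p @^-1` [set y].
Proof. by apply/mem_set; have /(congr1 (fun s => sval s t)) := proj2_sig s. Qed.

Definition fibre_point (J : finType) (s : S J) t : F :=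
  exist (fun x => x \in p @^-1` [set y]) _ (fibre_of_strict_subproof s t).

Lemma continuous_fibre_point (J : finType) (s : S J) :
  continuous (fibre_point s).
Proof. by apply: continuous_into_set; exact: (proj2_sig (sval s)). Qed.

Definition fibre_of_strict : smap S (sing R F).
Proof.
apply: (@SMap S (sing R F) (fun J s => exist _ _ (@continuous_fibre_point J s))).
by move=> I J g s; apply: sing_eq => t; apply: val_inj.
Defined.

Lemma fibre_acyclic (k : fieldType) n :
  acyclic k (semi_of (sing R F)) n <-> acyclic k (semi_of S) n.
Proof.
split.
  apply: (@acyclic_retract k _ _ fibre_of_strict strict_of_fibre) => I s.
  by apply: strict_eq; apply: sing_eq.
apply: (@acyclic_retract k _ _ strict_of_fibre fibre_of_strict) => I s.
by apply: sing_eq => t; apply: val_inj.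
Qed.

End Fibres.

Arguments fibre_acyclic {R X Y p} cp y k n.

(** ** Additivity of the homological dimension *)

Lemma moore_loops_nonempty (R : realType) (Y : topologicalType) (y : Y) :
  inhabited (moore_loop_space R y).
Proof.
have c : continuous (fun _ : Y * half_line R => y) by exact: continuous_const.
exact: (inhabits (@moore_family R Y y Y (fun=> y) (fun=> 0) c (fun=> lexx 0)
  (fun _ _ _ => erefl) (fun _ _ _ => erefl) y)).
Qed.

(** The constant function 1 is a cocycle that is not zero. *)
Lemma nonempty_acyclic0 (R : realType) (k : fieldType) (Z : topologicalType) :
  inhabited Z -> ~ acyclic k (semi_of (sing R Z)) 0.
Proof.
move=> [z] /(_ (fun=> 1)) ac; have /(_ (vertex_of R z))/eqP : forall s : sing R Z 'I_1, 1 = 0 :> k.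
  apply: ac => s; rewrite /cob !big_ord_recl big_ord0 /= expr0 expr1 scale1r scaleN1r.
  by rewrite addr0 subrr.
by rewrite oner_eq0.
Qed.

Lemma total_above (k : fieldType) (A C : sset) (f : smap A C) (G : semi) m n :
  (forall q, trivialisation k f G q) -> (forall i, (m < i)%N -> acyclic k (semi_of C) i) ->
  (forall i, (n < i)%N -> acyclic k G i) ->
  forall i, (m + n < i)%N -> acyclic k (semi_of A) i.
Proof.
move=> T aC aG i mni; apply: (@total_acyclic k _ _ f G T) => a b ab.
have [ma|am] := ltnP m a; [left; exact: aC | right; apply: aG; lia].
Qed.

Local Open Scope ereal_scope.

Theorem theorem5p5 (R : realType) (k : fieldType) (X Y : topologicalType)
    (p : X -> Y) (y : Y)
    (fib_p : serre_fibration R p)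
    (fdX : forall j : nat, finite_dimensional (singular_cohomology R k X j))
    (fdY : forall j : nat, finite_dimensional (singular_cohomology R k Y j))
    (scY : simply_connected R Y) :
  (hd R k (fibre p y) < +oo -> hd R k Y < +oo ->
     hd R k X = hd R k (fibre p y) + hd R k Y) /\
  (hd R k X < +oo -> hd R k (moore_loop_space R y) < +oo ->
     hd R k X = hd R k (fibre p y) - hd R k (moore_loop_space R y)).
Proof.
have cp : continuous p := fib_p.1.
have kp : kan (sing_map R cp) := sing_map_kan fib_p.
have kY := @sing_kan_complex R Y.
have T (A : sset) (f : smap A (sing R Y)) q :
    trivialisation k f (semi_of (hfibre f (vertex_of R y))) q.
  exact: (transport_trivialisation k f q kY (sing_loops_bound scY) (sing_path_connected scY y)).
split.
(* The homotopy fibres of [p] over the simplices of [Y]. *)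
- pose Gf := semi_of (hfibre (sing_map R cp) (vertex_of R y)).
  have GF n : acyclic k (semi_of (sing R (fibre p y))) n <-> acyclic k Gf n.
    apply: (iff_trans (fibre_acyclic cp y k n)); apply: (@acyclic_pullback k _ _ (to_hfibre _ _)) => r.
    exact: to_hfibre_exact.
  move=> /hd_cases[aF _|[n nF aF] /hd_cases[aY|[m nY aY]]].
  + rewrite (hd_empty aF) (@hd_empty R k X)// => n.
    by apply: (total_acyclic (T _ (sing_map R cp))) => a b _; right; exact/GF.
  + rewrite (hd_empty aY) addeNy (@hd_empty R k X)// => i.
    by apply: (total_acyclic (T _ (sing_map R cp))) => a b _; left; exact: aY.
  rewrite (hd_top nF aF) (hd_top nY aY) -EFinD -natrD addnC; apply: hd_top.
    apply: (total_corner (T _ (sing_map R cp))) => //; first by move=> /GF.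
    by move=> q nq; apply/GF; exact: aF.
  by apply: (total_above (T _ (sing_map R cp))) => // i ni; apply/GF; exact: aF.
(* The homotopy fibres of the inclusion of the fibre over the simplices of [X]. *)
pose So := semi_of (simplicial_loops R y).
have GO n : acyclic k So n <-> acyclic k (semi_of (sing R (moore_loop_space R y))) n.
  exact: simplicial_loops_acyclic.
have T' q := pull_trivialisation kp (T _ (const_map (vertex_of R y)) q).
move=> /hd_cases[aX _|[m nX aX] /hd_cases[aO|[n nO aO]]].
- rewrite (hd_empty aX) (@hd_empty R k (fibre p y))// => n; apply/(fibre_acyclic cp y k _).
  by apply: (total_acyclic T') => a b _; left; exact: aX.
(* A loop space contains the constant loop, hence has cohomology in degree 0. *)
- by case: (nonempty_acyclic0 (moore_loops_nonempty R y) (aO 0%N)).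
rewrite (hd_top nX aX) (hd_top nO aO) (@hd_top R k (fibre p y) (m + n)%N).
- by rewrite -EFinB natrD addrK.
- move=> /(fibre_acyclic cp y k _); apply: (total_corner T') => //; first by move=> /GO.
  by move=> q nq; apply/GO; exact: aO.
move=> i ni; apply/(fibre_acyclic cp y k _).
by apply: (total_above T' aX) ni => j nj; apply/GO; exact: aO.
Qed.
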